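(* Let $p$ be an odd prime such that $p=x^2+y^2$ with integers $x,y$ satisfying $4\mid x-1$ and $2\mid y$. Then $$\sum_{k=0}^{p-1}\frac{(k+1)\binom{2k}{k}^2}{8^k}+\sum_{k=0}^{(p-1)/2}\frac{(2k+1)\binom{2k}{k}^2}{(-16)^k}\equiv 2\left(\frac{2}{p}\right)x\pmod{p^3}.$$
   Context: $\left(\frac{\cdot}{p}\right)$ denotes the Legendre symbol. For rational numbers $a,b$ with denominators prime to $p$, $a\equiv b\pmod{p^m}$ means $(a-b)/p^m$ is a rational number with denominator prime to $p$. *)

(* Defs.v *)
From mathcomp Require Import all_boot all_order all_algebra.
Set Implicit Arguments. Unset Strict Implicit. Unset Printing Implicit Defensive.
Import Order.TTheory GRing.Theory Num.Theory.
Local Open Scope ring_scope.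

Definition legendre (a : int) (p : nat) : int :=
  if (p%:Z %| a)%Z then 0
  else if [exists z : 'I_p, (p%:Z %| (z%:Z) ^+ 2 - a)%Z] then 1 else -1.

Definition rat_cong (p m : nat) (a b : rat) : Prop :=
  coprime `|denq ((a - b) / (p%:R ^+ m))|%N p.

(* Main.v *)
Require Import Defs.
From mathcomp Require Import all_boot all_order all_algebra all_fingroup all_solvable all_field.
From mathcomp Require Import zify ring lra.
Set Implicit Arguments. Unset Strict Implicit. Unset Printing Implicit Defensive.
Import Order.TTheory GRing.Theory Num.Theory.
Local Open Scope ring_scope.

(** Put n = (p-1)/2 = 2m, u_k = (C(2k,k)/4^k)^2 and l = (-1)^m = (2/p).  Twice
the left-hand side is (K1 + K2) + (W1 + W2), where K1 = sum_(k<p) 2^k u_k,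
K2 = sum_(k<=n) (-1)^k u_k, and W1, W2 carry the extra weights 2k+1 and 4k+1.

The series sum u_k t^k solves the Legendre equation, so that the Wronskians of its
truncations, and of their images under t -> 1 - t, have explicit derivatives;
evaluating them at t = 2 and t = -1 gives P (W1 + W2) = 2p (mod p^3), where
P = sum_k C(n,k) C(n+k,k) is congruent to K1 and K2 modulo p^2.

Modulo p^3, u_k is an affine combination of the coefficients of the Legendre
polynomials of degrees n and n + p, and the symmetry t -> 1 - t relates their
values at 2 and -1.  This expresses K1 + K2 through values of
Phi(x,y) = [t^n] (1-t)^x (1+t)^y at x, y in n + pZ.  Phi is symmetric, and modulo
p^3 quadratic in the multiples of p, so all these values follow from the closed
forms of Phi on the diagonal x = y and at (n-p, n+p).  The harmonic sums left
over modulo p cancel by Landen's transformation evaluated at a square root of -1.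

On the other side, -2 l x = sum_s chi(s^3 - s) by Jacobsthal; summing over
Teichmueller representatives, and replacing chi by a quintic polynomial in
(s^3 - s)^n, turns this modulo p^3 into binomials C(2m,m), C(6m,.), C(10m,.).
Both sides are then compared through their expansions in p. *)

(** * Rationals integral at p *)

(** No congruence for [x] by a single binomial coefficient enters. The number b = C(2m,m) stays an
    unknown unit modulo p. After multiplication by b, up to sign, both sides become polynomials in
    p, b and the first two elementary symmetric functions [sigma1] and [e2] of the reciprocals of
    m+1, ..., 2m, and these are compared coefficient by coefficient. That so few quantities suffice
    is due to p = 4m + 1: the product of 1 + xp/k over m < k <= 2m ([Dprod]) is a ratio of binomials
    at integers x and a power of 2 at x = -1/2. Multiplication by b is forced on both sides:
    C(6m,3m) and C(10m,3m) have a factor p and simple expansions only when multiplied by b, and the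
    Wronskians determine W only through [Pc], which is b up to sign modulo p. Degree n + p is needed
    because u_k matches the coefficients of degree n only modulo p^2. It costs a block of
    coefficients at p <= k <= p + n lying outside the sums; this block is again a value of Phi, up
    to a correction by harmonic sums. *)

Lemma signrB (n j : nat) : (j <= n)%N -> (-1) ^+ (n - j) = (-1) ^+ n * (-1) ^+ j :> rat.
Proof. by move=> h; rewrite -signr_odd oddB // signr_addb !signr_odd. Qed.

(** This is the localization of the integers at p. The denominator need not be reduced, so closure
    under sums and products is immediate; [pint_denq] returns to the reduced denominator of
    [rat_cong]. *)
Definition pint (p : nat) (x : rat) : Prop :=
  exists (d : nat) (a : int), coprime d p /\ x * d%:R = a%:~R.

Definition eqm (p k : nat) (x y : rat) : Prop :=
  exists2 z, pint p z & x - y = p%:R ^+ k * z.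

Section PIntegers.
Variable p : nat.
Hypothesis p_pr : prime p.

Lemma coprime_neq0 d : coprime d p -> d%:R != 0 :> rat.
Proof.
move=> cdp; rewrite pnatr_eq0; case: d cdp => //.
by rewrite /coprime gcd0n => /eqP p1; have := p_pr; rewrite p1.
Qed.

Lemma p_neq0 : p%:R != 0 :> rat.
Proof. by rewrite pnatr_eq0; case: p p_pr. Qed.

Lemma pint_int (a : int) : pint p a%:~R.
Proof. by exists 1%N, a; rewrite coprime1n mulr1. Qed.

Lemma pint_nat (a : nat) : pint p a%:R.
Proof. by rewrite -[a%:R]/((a%:Z)%:~R); apply: pint_int. Qed.

Lemma pint0 : pint p 0. Proof. exact: (pint_nat 0). Qed.
Lemma pint1 : pint p 1. Proof. exact: (pint_nat 1). Qed.

Lemma pintD x y : pint p x -> pint p y -> pint p (x + y).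
Proof.
case=> d [a [cd xd]] [e [b [ce ye]]].
exists (d * e)%N, (a * e%:Z + b * d%:Z); rewrite coprimeMl cd ce; split=> //.
rewrite natrM intrD !intrM -xd -ye; ring.
Qed.

Lemma pintN x : pint p x -> pint p (- x).
Proof. by case=> d [a [cd xd]]; exists d, (- a); rewrite mulNr xd mulrNz. Qed.

Lemma pintM x y : pint p x -> pint p y -> pint p (x * y).
Proof.
case=> d [a [cd xd]] [e [b [ce ye]]].
exists (d * e)%N, (a * b); rewrite coprimeMl cd ce; split=> //.
rewrite natrM intrM -xd -ye; ring.
Qed.

Lemma pintX x k : pint p x -> pint p (x ^+ k).
Proof.
by move=> px; elim: k => [|k ih]; rewrite ?expr0 ?exprS; [exact: pint1 | exact: pintM].
Qed.

Lemma pint_sum (I : Type) (r : seq I) (P : pred I) (F : I -> rat) :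
  (forall i, P i -> pint p (F i)) -> pint p (\sum_(i <- r | P i) F i).
Proof. by move=> h; elim/big_ind: _ => //; [exact: pint0 | exact: pintD]. Qed.

Lemma pint_prod (I : Type) (r : seq I) (P : pred I) (F : I -> rat) :
  (forall i, P i -> pint p (F i)) -> pint p (\prod_(i <- r | P i) F i).
Proof. by move=> h; elim/big_ind: _ => //; [exact: pint1 | exact: pintM]. Qed.

Lemma pintV (d : nat) : coprime d p -> pint p d%:R^-1.
Proof.
by move=> cd; exists d, 1; split=> //; rewrite mulVf // coprime_neq0.
Qed.

Lemma pintVX (d k : nat) : coprime d p -> pint p (d%:R ^+ k)^-1.
Proof. by move=> cd; rewrite -exprVn; apply/pintX/pintV. Qed.

Lemma pint_div (x : rat) (d : nat) : coprime d p -> pint p x -> pint p (x / d%:R).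
Proof. by move=> cd px; apply: pintM => //; apply: pintV. Qed.

Lemma coprime_lt d : (0 < d < p)%N -> coprime d p.
Proof.
case/andP=> d0 dp; rewrite coprime_sym prime_coprime //.
by apply: contraL dp => /dvdn_leq; rewrite -leqNgt; apply.
Qed.

Lemma pintV_lt d : (0 < d < p)%N -> pint p d%:R^-1.
Proof. by move=> /coprime_lt; apply: pintV. Qed.

Lemma pint_denq x : pint p x -> coprime `|denq x| p.
Proof.
case=> d [a [cd xd]].
have e : numq x * d%:Z = a * denq x.
  by apply: (@intr_inj rat); rewrite !intrM numqE -xd; ring.
have dv : (`|denq x| %| `|numq x| * d)%N.
  by rewrite -[d]/(`|d%:Z|%N) -abszM e abszM dvdn_mull.
rewrite Gauss_dvdr in dv; last by rewrite coprime_sym coprime_num_den.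
exact: coprime_dvdl dv cd.
Qed.

Lemma eqm_refl k x : eqm p k x x.
Proof. by exists 0; [exact: pint0 | rewrite subrr mulr0]. Qed.

Lemma eqm_eq k x y : x = y -> eqm p k x y.
Proof. by move=> ->; apply: eqm_refl. Qed.

Lemma eqm_sym k x y : eqm p k x y -> eqm p k y x.
Proof. by case=> z pz e; exists (- z); [exact: pintN | rewrite mulrN -e opprB]. Qed.

Lemma eqm_trans k y x z : eqm p k x y -> eqm p k y z -> eqm p k x z.
Proof.
case=> a pa ea [b pb eb]; exists (a + b); first exact: pintD.
by rewrite mulrDr -ea -eb; ring.
Qed.

Lemma eqmD k x x' y y' : eqm p k x x' -> eqm p k y y' -> eqm p k (x + y) (x' + y').
Proof.
case=> a pa ea [b pb eb]; exists (a + b); first exact: pintD.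
by rewrite mulrDr -ea -eb; ring.
Qed.

Lemma eqmN k x x' : eqm p k x x' -> eqm p k (- x) (- x').
Proof. by case=> z pz e; exists (- z); [exact: pintN | rewrite mulrN -e; ring]. Qed.

Lemma eqmM k x x' y y' : eqm p k x x' -> eqm p k y y' -> pint p x -> pint p y' ->
  eqm p k (x * y) (x' * y').
Proof.
case=> a pa ea [b pb eb] px py; exists (a * y' + x * b).
  by apply: pintD; apply: pintM.
have -> : x * y - x' * y' = (x - x') * y' + x * (y - y') by ring.
by rewrite ea eb; ring.
Qed.

Lemma eqm_mull k x y y' : pint p x -> eqm p k y y' -> eqm p k (x * y) (x * y').
Proof.
move=> px [z pz e]; exists (x * z); first exact: pintM.
by rewrite -mulrBr e; ring.
Qed.

Lemma eqm_mulr k x y y' : pint p x -> eqm p k y y' -> eqm p k (y * x) (y' * x).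
Proof. by move=> px; rewrite ![_ * x]mulrC; apply: eqm_mull. Qed.

Lemma eqm_sum k (I : Type) (r : seq I) (P : pred I) (F G : I -> rat) :
  (forall i, P i -> eqm p k (F i) (G i)) ->
  eqm p k (\sum_(i <- r | P i) F i) (\sum_(i <- r | P i) G i).
Proof.
move=> h; elim/big_rec2: _ => [|i x y Pi e]; first exact: eqm_refl.
by apply: eqmD => //; apply: h.
Qed.

Lemma eqm_leq j k x y : (j <= k)%N -> eqm p k x y -> eqm p j x y.
Proof.
move=> jk [z pz e]; exists (p%:R ^+ (k - j) * z).
  by apply: pintM => //; apply/pintX/pint_nat.
by rewrite mulrA -exprD subnKC.
Qed.

Lemma eqm_pint k x y : eqm p k x y -> pint p y -> pint p x.
Proof.
case=> z pz e py; have -> : x = y + p%:R ^+ k * z by rewrite -e; ring.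
by apply: pintD => //; apply: pintM => //; apply/pintX/pint_nat.
Qed.

Lemma eqm_mulp j k x y : eqm p k x y -> eqm p (j + k) (p%:R ^+ j * x) (p%:R ^+ j * y).
Proof. by case=> z pz e; exists z => //; rewrite -mulrBr e exprD mulrA. Qed.

Lemma eqm_cancel (d : nat) k x y : coprime d p ->
  eqm p k (d%:R * x) (d%:R * y) -> eqm p k x y.
Proof.
move=> cd [z pz e]; exists (z / d%:R); first exact: pint_div.
have d0 := coprime_neq0 cd.
by rewrite mulrA -e -mulrBr [d%:R * _]mulrC mulfK.
Qed.

Lemma eqm_rat_cong k x y : eqm p k x y -> coprime `|denq ((x - y) / (p%:R ^+ k))| p.
Proof.
case=> z pz ->; rewrite mulrAC divff ?mul1r; first exact: pint_denq.
by rewrite expf_neq0 // p_neq0.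
Qed.

End PIntegers.

Ltac pint_tac :=
  lazymatch goal with
  | |- pint _ (_ + _) => apply: pintD; pint_tac
  | |- pint _ (- _) => apply: pintN; pint_tac
  | |- pint _ (_ * _) => apply: pintM; pint_tac
  | |- pint _ (_ ^+ _) => apply: pintX; pint_tac
  | |- pint _ 0 => exact: pint0
  | |- pint _ 1 => exact: pint1
  | |- pint _ (GRing.natmul 1 _) => exact: pint_nat
  | |- pint _ (intmul 1 _) => exact: pint_int
  | |- pint _ ?y => first [match goal with H : pint _ ?x |- _ => constr_eq x y; exact H end | try assumption]
  end.

(** * Jacobsthal sums *)

Section QuadraticCharacter.
Variables (F : finFieldType) (h : nat).
Hypothesis cardF : #|F| = h.*2.+1.
Hypothesis h_gt0 : (0 < h)%N.

(** Euler's criterion serves as the definition of the quadratic character; its values are in [int],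
    so that character sums live in characteristic zero. *)
Definition chi (a : F) : int :=
  if a == 0 then 0 else if a ^+ h == 1 then 1 else -1.

Lemma expf_order (a : F) : a != 0 -> a ^+ h.*2 = 1.
Proof.
move=> a0; apply: (mulfI a0); rewrite mulr1 -exprS -cardF; exact: expf_card.
Qed.

Lemma prim_rootF : {z : F | h.*2.-primitive_root z}.
Proof.
pose rs := enum [pred x : F | x != 0].
have h2 : (0 < h.*2)%N by rewrite double_gt0.
have u1 : all h.*2.-unity_root rs.
  by apply/allP=> x; rewrite mem_enum inE => x0; apply/unity_rootP; apply: expf_order.
have sz : (h.*2 <= size rs)%N.
  have e : #|[pred x : F | x != 0]| = h.*2.
    have := cardC1 (0 : F); rewrite cardF /= => <-.
    by apply: eq_card => x; rewrite !inE.
  by rewrite -cardE e.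
have := has_prim_root h2 u1 (enum_uniq _) sz.
by move=> /hasP/sig2W [z _ pz]; exists z.
Qed.

Lemma oneN1 : (1 : F) != -1.
Proof.
have [z pz] := prim_rootF; apply/eqP => e.
have two0 : (2%:R : F) = 0 by rewrite mulr2n {2}e subrr.
have zh : (z ^+ h) ^+ 2 = 1 by rewrite -exprM muln2 prim_expr_order.
have : z ^+ h == 1.
  have : (z ^+ h - 1) ^+ 2 == 0.
    by rewrite sqrrB1 zh -mulr_natl two0 mul0r subr0 addrC -mulr2n -mulr_natl two0 mul0r.
  by rewrite expf_eq0 /= subr_eq0.
rewrite -(prim_order_dvd pz) => /dvdn_leq; lia.
Qed.

Lemma exp_half (a : F) : a != 0 -> (a ^+ h == 1) || (a ^+ h == -1).
Proof.
by move=> a0; rewrite -eqf_sqr -exprM muln2 expf_order // expr1n.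
Qed.

Lemma chi_sq_root (a : F) : a != 0 -> a ^+ h = 1 -> exists b, a = b ^+ 2.
Proof.
move=> a0 ah; have [z pz] := prim_rootF.
have [i ei] := prim_rootP pz (expf_order a0).
have : z ^+ (i * h) == 1 by rewrite exprM -ei ah.
rewrite -(prim_order_dvd pz) => dv.
have {dv}/dvdnP [j ej] : (2 %| i)%N by rewrite -(dvdn_pmul2r h_gt0) mul2n.
by exists (z ^+ j); rewrite -exprM -ej.
Qed.

Lemma chi0 : chi 0 = 0. Proof. by rewrite /chi eqxx. Qed.
Lemma chi1 : chi 1 = 1. Proof. by rewrite /chi oner_eq0 expr1n eqxx. Qed.

Lemma chi_ne0 a : a != 0 -> chi a = 1 \/ chi a = -1.
Proof. by rewrite /chi => /negPf ->; case: ifP; [left | right]. Qed.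

Lemma chi_eq1 a : chi a = 1 -> a != 0 /\ a ^+ h = 1.
Proof. by rewrite /chi; case: eqP => // /eqP ?; case: eqP. Qed.

Lemma chiF a : (chi a)%:~R = a ^+ h.
Proof.
rewrite /chi; case: eqP => [->|/eqP a0]; first by rewrite expr0n eqn0Ngt h_gt0.
have /orP [/eqP -> | /eqP ->] := exp_half a0; first by rewrite eqxx.
by rewrite eq_sym (negPf oneN1).
Qed.

Lemma chiM : {morph chi : a b / a * b}.
Proof.
move=> a b; have [->|a0] := eqVneq a 0; first by rewrite !mul0r chi0 mul0r.
have [->|b0] := eqVneq b 0; first by rewrite !mulr0 chi0 mulr0.
have e : ((chi (a * b))%:~R : F) = (chi a)%:~R * (chi b)%:~R by rewrite !chiF exprMn.
have ab0 : a * b != 0 by rewrite mulf_neq0.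
have n1 : ((1%:Z)%:~R : F) <> (-1)%:~R by rewrite rmorphN1 => /eqP; rewrite (negPf oneN1).
rewrite -intrM in e.
by case: (chi_ne0 a0) (chi_ne0 b0) (chi_ne0 ab0) e => -> [] -> [] -> //= /esym.
Qed.

Lemma chi_sqr a : a != 0 -> chi (a ^+ 2) = 1.
Proof. by move=> a0; rewrite expr2 chiM; case: (chi_ne0 a0) => ->. Qed.

Lemma chiX2 a : chi a ^+ 2 = (a != 0)%:R.
Proof.
have [->|a0] := eqVneq a 0; first by rewrite chi0.
by case: (chi_ne0 a0) => ->.
Qed.

Lemma nonresidue : exists c, chi c = -1.
Proof.
have [z pz] := prim_rootF; exists z.
have z0 : z != 0.
  apply/eqP=> z0; have := prim_expr_order pz.
  by rewrite z0 expr0n double_eq0 eqn0Ngt h_gt0 /= => /eqP; rewrite eq_sym oner_eq0.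
rewrite /chi (negPf z0) -(prim_order_dvd pz); case: ifP => // /dvdn_leq; lia.
Qed.

Lemma sum_mul (G : F -> int) c : c != 0 -> \sum_a G (c * a) = \sum_a G a.
Proof.
move=> c0; rewrite [RHS](reindex (fun a => c * a)) //.
by exists (fun a => c^-1 * a) => a _; rewrite ?mulKf ?mulVKf.
Qed.

Lemma sum_add (G : F -> int) c : \sum_a G (a + c) = \sum_a G a.
Proof.
rewrite [RHS](reindex (fun a => a + c)) //.
by exists (fun a => a - c) => a _; rewrite ?addrK ?subrK.
Qed.

Lemma sum_chi : \sum_a chi a = 0.
Proof.
have [c ec] := nonresidue.
have c0 : c != 0 by apply/eqP=> c0; move: ec; rewrite c0 chi0.
have e := sum_mul chi c0.
have : \sum_a chi (c * a) = - \sum_a chi a.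
  by rewrite -sumrN; apply: eq_bigr => a _; rewrite chiM ec mulN1r.
rewrite e; lia.
Qed.

(** Once [b] is moved to 0, inverting [s] makes the quadratic linear up to a square. The full linear
    sum vanishes, and its value at 0, missed by the inversion, is [chi 1]. *)
Lemma sum_chi_quad a b : a != b -> \sum_s chi ((s - a) * (s - b)) = -1.
Proof.
move=> ab; rewrite -(sum_add _ b).
have -> : \sum_s chi ((s + b - a) * (s + b - b)) = \sum_s chi (1 - (a - b) * s) - chi 1.
  rewrite (bigD1 0) //= addrK mulr0 chi0 add0r.
  rewrite [X in _ = X - _](bigD1 0) //= mulr0 subr0 [X in _ = X - _]addrC addrK.
  rewrite [RHS](reindex_inj (can_inj (@invrK F))) /=.
  apply: eq_big => [s|s s0]; first by rewrite invr_eq0.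
  have -> : (s + b - a) * (s + b - b) = s ^+ 2 * (1 - (a - b) / s) by field.
  by rewrite chiM chi_sqr // mul1r.
have -> : \sum_s chi (1 - (a - b) * s) = \sum_s chi s.
  rewrite (sum_mul (fun s => chi (1 - s))) ?subr_eq0 //.
  rewrite [RHS](reindex (fun s => 1 - s)) //.
  by exists (fun s => 1 - s) => s _; rewrite subKr.
by rewrite sum_chi chi1.
Qed.

Lemma sum_chi_sq : \sum_a chi a ^+ 2 = h.*2%:R.
Proof.
under eq_bigr do rewrite chiX2 mulrb.
rewrite -big_mkcond /= sumr_const.
have -> // : #|[pred a : F | a != 0]| = h.*2.
by have := cardC1 (0 : F); rewrite cardF /= => <-; apply: eq_card => x; rewrite !inE.
Qed.

(** The Jacobsthal sum: minus the trace of Frobenius of the curve Y^2 = X^3 - a X. *)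
Definition jac (a : F) : int := \sum_s chi (s * (s ^+ 2 - a)).

Lemma jac_sqr a t : t != 0 -> jac (a * t ^+ 2) = chi t * jac a.
Proof.
move=> t0; rewrite /jac -(sum_mul _ t0) mulr_sumr; apply: eq_bigr => s _.
have -> : t * s * ((t * s) ^+ 2 - a * t ^+ 2) = t ^+ 2 * (t * (s * (s ^+ 2 - a))) by ring.
by rewrite chiM chi_sqr // mul1r chiM.
Qed.

Hypothesis chiN1 : chi (-1) = 1.

(** The square is expanded and summed over [a] first. The inner quadratic sum is constant except
    when s^2 = t^2; the constant part dies because [chi] sums to 0, leaving t = s and t = -s. *)
Lemma sum_jac_sq : \sum_a jac a ^+ 2 = 2 * (h.*2.+1)%:R * h.*2%:R.
Proof.
have inner s t : \sum_a chi ((s ^+ 2 - a) * (t ^+ 2 - a))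
    = (h.*2.+1)%:R * (s ^+ 2 == t ^+ 2)%:R - 1.
  have -> : \sum_a chi ((s ^+ 2 - a) * (t ^+ 2 - a)) =
            \sum_a chi ((a - s ^+ 2) * (a - t ^+ 2)).
    by apply: eq_bigr => a _; congr chi; ring.
  have [->|st] := eqVneq (s ^+ 2) (t ^+ 2); last by rewrite sum_chi_quad // mulr0.
  under eq_bigr do rewrite chiM -expr2.
  rewrite -(sum_add _ (t ^+ 2)); under eq_bigr do rewrite addrK.
  rewrite sum_chi_sq; rewrite mulr1; lia.
have -> : \sum_a jac a ^+ 2 =
   \sum_s \sum_t chi (s * t) * \sum_a chi ((s ^+ 2 - a) * (t ^+ 2 - a)).
  under eq_bigr do rewrite expr2 /jac mulr_suml.
  rewrite exchange_big /=; apply: eq_bigr => s _.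
  under eq_bigr do rewrite mulr_sumr.
  rewrite exchange_big /=; apply: eq_bigr => t _.
  rewrite mulr_sumr; apply: eq_bigr => a _; rewrite -!chiM; congr chi; ring.
under eq_bigr => s _ do under eq_bigr => t _ do rewrite inner mulrBr mulr1.
under eq_bigr => s _ do rewrite sumrB.
rewrite sumrB.
have -> : \sum_s \sum_t chi (s * t) = 0.
  under eq_bigr => s _ do under eq_bigr => t _ do rewrite chiM.
  by under eq_bigr => s _ do rewrite -mulr_sumr sum_chi mulr0; rewrite big1.
rewrite subr0.
have -> : \sum_s \sum_t chi (s * t) * ((h.*2.+1)%:R * (s ^+ 2 == t ^+ 2)%:R)
   = \sum_s (h.*2.+1)%:R * (2 * chi s ^+ 2).
  apply: eq_bigr => s _.
  have [->|s0] := eqVneq s 0.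
    by rewrite chi0 big1 ?expr0n ?mulr0 // => t _; rewrite mul0r chi0 mul0r.
  have sNs : - s != s.
    rewrite -subr_eq0 -opprD oppr_eq0 -[s + s](mulr2n) -mulr_natl mulf_neq0 //.
    by have := oneN1; rewrite -subr_eq0 opprK -natr1 natr1.
  rewrite (bigD1 s) // (bigD1 (- s)) //= sqrrN eqxx mulr1 -!expr2 big1 => [|t /andP [t1 t2]].
    rewrite mulrN -mulN1r !chiM chiN1 -!expr2; ring.
  have -> : (s ^+ 2 == t ^+ 2) = false; last by rewrite !mulr0.
  by rewrite eq_sym eqf_sqr (negPf t1) (negPf t2).
rewrite -mulr_sumr -mulr_sumr sum_chi_sq; ring.
Qed.

Lemma jac_sum_sq c : chi c = -1 -> jac 1 ^+ 2 + jac c ^+ 2 = 4 * (h.*2.+1)%:R.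
Proof.
move=> ec.
have c0 : c != 0 by apply/eqP=> c0; move: ec; rewrite c0 chi0.
(* Up to sign, [jac a] depends only on the class of [a] modulo squares; the factors 1 + chi a and 1
   - chi a select the class, and [jac 0] is 0. *)
have val a : 2 * jac a ^+ 2 = (1 + chi a) * chi a ^+ 2 * jac 1 ^+ 2
                          + (1 - chi a) * chi a ^+ 2 * jac c ^+ 2.
  have [->|a0] := eqVneq a 0.
    rewrite chi0 expr0n /= !mulr0 !mul0r /jac.
    have -> : \sum_s chi (s * (s ^+ 2 - 0)) = \sum_s chi s.
      apply: eq_bigr => s _; have [->|s0] := eqVneq s 0; first by rewrite mul0r.
      by rewrite subr0 chiM chi_sqr // mulr1.
    by rewrite sum_chi.
  case: (chi_ne0 a0) => ea; rewrite ea.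
    have [_ /(chi_sq_root a0) [b eb]] := chi_eq1 ea.
    have b0 : b != 0 by apply: contraNneq a0 => b0; rewrite eb b0 expr0n.
    have -> : jac a = chi b * jac 1 by rewrite -jac_sqr // mul1r eb.
    by case: (chi_ne0 b0) => ->; ring.
  have e2 : chi (a / c) = 1.
    have : chi (a / c * c) = -1 by rewrite divfK.
    rewrite chiM ec; lia.
  have [ac0 ach] := chi_eq1 e2; have [b eb] := chi_sq_root ac0 ach.
  have b0 : b != 0 by apply: contraNneq ac0 => b0; rewrite eb b0 expr0n.
  have -> : jac a = chi b * jac c.
    by rewrite -jac_sqr // -eb mulrC divfK.
  by case: (chi_ne0 b0) => ->; ring.
have : 2 * \sum_a jac a ^+ 2 = h.*2%:R * (jac 1 ^+ 2 + jac c ^+ 2).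
  rewrite mulr_sumr; under eq_bigr do rewrite val.
  rewrite big_split /= -!mulr_suml.
  have c3 a : chi a * chi a ^+ 2 = chi a.
    by rewrite chiX2; case: eqVneq => [->|]; rewrite ?chi0 ?mul0r ?mulr1.
  under eq_bigr do rewrite mulrDl mul1r c3.
  under [X in _ + X * _]eq_bigr do rewrite mulrBl mul1r c3.
  rewrite big_split sumrB /= sum_chi sum_chi_sq; ring.
rewrite sum_jac_sq => e.
have h0 : (h.*2%:R : int) != 0 by rewrite pnatr_eq0 double_eq0 -lt0n.
apply: (mulfI h0); rewrite -e; ring.
Qed.

(** Away from 0, 1 and -1, the product of 1 + chi over s - 1, s, s + 1 is 0 or 8. Expanding it
    produces [jac 1] together with sums already known; the result fixes the sign of [jac 1]. *)
Lemma jac1_mod8 : exists k : int, h.*2%:R - 10 - 4 * chi 2%:R + jac 1 = 8 * k.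
Proof.
have n1 : (1 : F) != -1 by exact: oneN1.
have n2 : (2%:R : F) != 0 by move: n1; rewrite -subr_eq0 opprK -natr1 natr1.
have c2N : chi (- 2%:R) = chi 2%:R by rewrite -mulN1r chiM chiN1 mul1r.
pose D (s : F) := [&& s != 0, s != 1 & s != -1].
have rm (G : F -> int) : \sum_(s | D s) G s = \sum_s G s - G 0 - G 1 - G (-1).
  rewrite [in RHS](bigD1 0) //= [in RHS](bigD1 1) ?oner_eq0 //=.
  rewrite [in RHS](bigD1 (-1)) /=; last by rewrite oppr_eq0 oner_eq0 eq_sym n1.
  rewrite (eq_bigl D); last by move=> s; rewrite /D andbA.
  ring.
pose S := \sum_(s | D s) (1 + chi (s - 1)) * (1 + chi s) * (1 + chi (s + 1)).
have [k ek] : exists k, S = 8 * k.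
  suff /dvdzP [k ->] : (8 %| S)%Z by exists k; rewrite mulrC.
  apply: rpred_sum => s /and3P [s0 s1 sN1].
  have a1 : s - 1 != 0 by rewrite subr_eq0.
  have a2 : s + 1 != 0 by rewrite addr_eq0.
  by case: (chi_ne0 s0) (chi_ne0 a1) (chi_ne0 a2) => -> [] -> [] ->.
move: ek; have -> : S =
  \sum_(s | D s) 1 + \sum_(s | D s) chi (s - 1) + \sum_(s | D s) chi s
  + \sum_(s | D s) chi (s + 1)
  + \sum_(s | D s) chi ((s - 1) * (s - 0)) + \sum_(s | D s) chi ((s - 0) * (s - (-1)))
  + \sum_(s | D s) chi ((s - 1) * (s - (-1)))
  + \sum_(s | D s) chi (s * (s ^+ 2 - 1)).
  rewrite -!big_split /=; apply: eq_bigr => s _.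
  have -> : s * (s ^+ 2 - 1) = (s - 1) * s * (s + 1) by ring.
  rewrite !subr0 opprK !chiM; ring.
rewrite !rm !sum_chi_quad ?(oner_eq0, n1, oppr_eq0) //; last by rewrite eq_sym oppr_eq0 oner_eq0.
rewrite (sum_add chi (-1)) (sum_add chi 1) sum_chi -/(jac 1).
rewrite sumr_const cardF /=.
have e1 : (1 - 1 : F) = 0 by rewrite subrr.
have e2 : (-1 + 1 : F) = 0 by rewrite addNr.
have e3 : (-1 - 1 : F) = - 2%:R by ring.
have e4 : (1 + 1 : F) = 2%:R by ring.
rewrite !(subr0, sub0r, add0r, opprK, e1, e2, e3, e4, mulr0, mul0r, mul1r, mulr1).
rewrite !(expr1n, sqrrN, e1, chi0, chi1, chiN1, c2N, mulr0, mulN1r, opprK, chiM, mul1r, mulr1).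
move=> H.
by exists k; rewrite -H -natr1; ring.
Qed.

End QuadraticCharacter.

Lemma intr_Fp_eq0 (p : nat) (a : int) : prime p -> (a%:~R == 0 :> 'F_p) = (p%:Z %| a)%Z.
Proof.
by move=> p_pr; rewrite (dvdz_pcharf (pchar_Fp p_pr)).
Qed.

Lemma odd_int (x : int) : ~~ (2 %| x)%Z -> exists a, x = 2 * a + 1.
Proof. by move=> xo; exists (x %/ 2)%Z; lia. Qed.

(** Up to the sign of v, p divides x v - y u, with quotient k. Brahmagupta's identity forces k^2 <=
    1. If k = 0 the squares agree; otherwise x u + y v = 0, which yields p = x^2 + u^2, absurd by
    parity. *)
Lemma sum_two_squares_unique (p : nat) (x y u v : int) : prime p -> odd p ->
  p%:Z = x ^+ 2 + y ^+ 2 -> p%:Z = u ^+ 2 + v ^+ 2 ->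
  ~~ (2 %| x)%Z -> ~~ (2 %| u)%Z -> x ^+ 2 = u ^+ 2.
Proof.
move=> p_pr p_odd e1 e2 xo uo.
have p0 : p%:Z != 0 by case: (p) p_pr.
have d : (p%:Z %| (x * v - y * u) * (x * v + y * u))%Z.
  apply/dvdzP; exists (x ^+ 2 - u ^+ 2).
  have -> : v ^+ 2 = p%:Z - u ^+ 2 -> y ^+ 2 = p%:Z - x ^+ 2 ->
     (x * v - y * u) * (x * v + y * u) = (x ^+ 2 - u ^+ 2) * p%:Z.
    move=> ev ey; transitivity (x ^+ 2 * v ^+ 2 - y ^+ 2 * u ^+ 2); first by ring.
    by rewrite ev ey; ring.
  - by [].
  - by rewrite e2; ring.
  - by rewrite e1; ring.
have key w : p%:Z = u ^+ 2 + w ^+ 2 -> (p%:Z %| x * w - y * u)%Z -> x ^+ 2 = u ^+ 2.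
  move=> ew /dvdzP [k ek].
  have sq : (x * u + y * w) ^+ 2 + k ^+ 2 * p%:Z ^+ 2 = p%:Z ^+ 2.
    rewrite -exprMn -ek; transitivity ((x ^+ 2 + y ^+ 2) * (u ^+ 2 + w ^+ 2)); first by ring.
    by rewrite -e1 -ew expr2.
  have [k0|k0] := eqVneq k 0.
    rewrite k0 mul0r in ek.
    have exw : x ^+ 2 * w ^+ 2 = y ^+ 2 * u ^+ 2.
      by rewrite -!exprMn; congr (_ ^+ 2); apply/eqP; rewrite -subr_eq0 ek.
    apply: (mulfI p0); transitivity ((u ^+ 2 + w ^+ 2) * x ^+ 2); first by rewrite -ew.
    transitivity ((x ^+ 2 + y ^+ 2) * u ^+ 2); last by rewrite -e1.
    by rewrite !mulrDl [w ^+ 2 * _]mulrC exw mulrC.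
  have k1 : 1 <= k ^+ 2 by rewrite -gtz0_ge1 lt_def sqrf_eq0 k0 sqr_ge0.
  have z0 : x * u + y * w = 0.
    apply/eqP; rewrite -sqrf_eq0; apply/eqP/le_anti; rewrite sqr_ge0 andbT.
    have -> : (x * u + y * w) ^+ 2 = - ((k ^+ 2 - 1) * p%:Z ^+ 2).
      by rewrite -[LHS](addrK (k ^+ 2 * p%:Z ^+ 2)) sq; ring.
    by rewrite oppr_le0 mulr_ge0 ?sqr_ge0 // subr_ge0.
  have : (x * u) ^+ 2 = (y * w) ^+ 2 by rewrite -[RHS]sqrrN; congr (_ ^+ 2); apply/eqP; rewrite -subr_eq0 opprK z0.
  rewrite !exprMn.
  have -> : w ^+ 2 = p%:Z - u ^+ 2 by rewrite ew; ring.
  have -> : y ^+ 2 = p%:Z - x ^+ 2 by rewrite e1; ring.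
  move=> e; have {e} e : p%:Z * (x ^+ 2 + u ^+ 2) = p%:Z * p%:Z.
    transitivity (p%:Z * p%:Z + (x ^+ 2 * u ^+ 2 - (p%:Z - x ^+ 2) * (p%:Z - u ^+ 2))).
      by ring.
    by rewrite e subrr addr0.
  have {}e := mulfI p0 e.
  have : ~~ (2 %| p%:Z)%Z by rewrite dvdzE /= dvdn2 p_odd.
  have [a ea] := odd_int xo; have [b eb] := odd_int uo.
  rewrite -e => /negP []; apply/dvdzP.
  exists (2 * a ^+ 2 + 2 * a + 2 * b ^+ 2 + 2 * b + 1).
  by rewrite ea eb; ring.
have : (p%:Z %| x * v - y * u)%Z || (p%:Z %| x * v + y * u)%Z.
  by move: d; rewrite !dvdzE abszM Euclid_dvdM.
case/orP; first exact: key.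
move=> d2; apply: (key (- v)); first by rewrite sqrrN.
have -> : x * - v - y * u = - (x * v + y * u) by ring.
by rewrite dvdzE abszN -dvdzE.
Qed.

Lemma odd_parts (x t : int) : (4 %| x - 1)%Z -> ~~ (2 %| x)%Z /\ ~~ (2 %| 1 + 2 * t)%Z.
Proof. by move=> x4; split; lia. Qed.

(** Here [2 + 4 * t] is [jac 1], [M] is [m] and [e] is the character of 2; the congruence modulo 8
    decides the sign that the squares leave open. *)
Lemma jac_sign (x t k j e M : int) : (4 %| x - 1)%Z ->
  (x == 1 + 2 * t) || (x == - (1 + 2 * t)) ->
  4 * M - 10 - 4 * e + (2 + 4 * t) = 8 * k ->
  e = 1 /\ M = j * 2 \/ e = -1 /\ M = 1 + j * 2 ->
  2 + 4 * t = - (2 * e * x).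
Proof. by move=> x4 /orP [] /eqP ex eM [] [] ? ?; subst e M; lia. Qed.

Section Jacobsthal.
Variables (p m : nat) (x y : int).
Hypothesis p_pr : prime p.
Hypothesis ep : p = (4 * m).+1.
Hypothesis exy : p%:Z = x ^+ 2 + y ^+ 2.
Hypothesis x4 : (4 %| x - 1)%Z.

Let m_gt0 : (0 < m)%N.
Proof. by move: p_pr; rewrite ep; case: m. Qed.

Let cardF : #|{: 'F_p}| = (m.*2).*2.+1.
Proof. by rewrite card_Fp // ep; lia. Qed.

Let m2_gt0 : (0 < m.*2)%N. Proof. by rewrite double_gt0. Qed.

Let p_odd : odd p. Proof. by rewrite ep; lia. Qed.

Lemma chi_N1 : chi (m.*2) (-1 : 'F_p) = 1.
Proof. by rewrite /chi oppr_eq0 oner_eq0 -signr_odd odd_double eqxx. Qed.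

(** With i = x / y a square root of -1, 2 i = (1 + i)^2, so 2 and i have the same character, and
    i^(2m) = (-1)^m. *)
Lemma chi2E : chi (m.*2) (2%:R : 'F_p) = (-1) ^+ m.
Proof.
have y0 : (y%:~R : 'F_p) != 0.
  apply/eqP => y0.
  have : ((x ^+ 2 + y ^+ 2)%:~R : 'F_p) = 0.
    by rewrite -exy -[(p%:Z)%:~R]/(p%:R) pchar_Fp_0.
  rewrite rmorphD !rmorphXn /= y0 expr0n addr0 => /eqP; rewrite expf_eq0 /= => x0.
  have dx : (p%:Z %| x)%Z by rewrite -intr_Fp_eq0.
  have dy : (p%:Z %| y)%Z by rewrite -intr_Fp_eq0 // y0.
  move: dx dy exy => /dvdzP [a ->] /dvdzP [b ->].
  have -> : (a * p%:Z) ^+ 2 + (b * p%:Z) ^+ 2 = p%:Z * (p%:Z * (a ^+ 2 + b ^+ 2)) by ring.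
  move=> e; have : (p%:Z %| 1)%Z.
    have p0 : p%:Z != 0 by case: (p) p_pr.
    apply/dvdzP; exists (a ^+ 2 + b ^+ 2); apply: (mulfI p0); rewrite mulr1 {1}e; ring.
  by rewrite dvdzE /= dvdn1 => /eqP p1; have := p_pr; rewrite p1.
pose i : 'F_p := x%:~R / y%:~R.
have i2 : i ^+ 2 = -1.
  have : ((x ^+ 2 + y ^+ 2)%:~R : 'F_p) = 0.
    by rewrite -exy -[(p%:Z)%:~R]/(p%:R) pchar_Fp_0.
  rewrite rmorphD !rmorphXn /= => /eqP; rewrite addr_eq0 => /eqP e.
  by rewrite /i expr_div_n e mulNr divff // sqrf_eq0.
have i0 : i != 0 by rewrite -sqrf_eq0 i2 oppr_eq0 oner_eq0.
have e2 : 2%:R * i = (1 + i) ^+ 2.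
  by rewrite sqrrD i2 expr1n mul1r; ring.
have t0 : (2%:R : 'F_p) != 0.
  by have := oneN1 cardF m2_gt0; rewrite -subr_eq0 opprK -natr1 natr1.
have c1 : chi m.*2 (2%:R : 'F_p) * chi m.*2 i = 1.
  rewrite -chiM // e2 chi_sqr //.
  by rewrite -sqrf_eq0 -e2 mulf_neq0.
have ci : chi m.*2 i = (-1) ^+ m.
  rewrite /chi (negPf i0) -mul2n exprM i2 -[(-1 : 'F_p) ^+ m]signr_odd -[RHS]signr_odd.
  case: (odd m); rewrite /= ?expr1 ?expr0 ?eqxx //.
  by case: eqP => // e; have := oneN1 cardF m2_gt0; rewrite -[X in X != _]e eqxx.
by move: c1; rewrite ci -signr_odd; case: (odd m); rewrite /= ?expr0 ?expr1; lia.
Qed.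

Lemma legendre2E : legendre 2 p = (-1) ^+ m.
Proof.
rewrite -chi2E /legendre.
have n2 : ~~ (p%:Z %| 2)%Z.
  rewrite dvdzE /=; apply/negP => /dvdn_leq; rewrite ep; lia.
rewrite (negPf n2).
have t0 : (2%:R : 'F_p) != 0 by rewrite -[2%:R]/((2%:Z)%:~R) intr_Fp_eq0.
case: existsP => [[z hz]|nz].
  rewrite -intr_Fp_eq0 // rmorphB rmorphXn /= subr_eq0 in hz.
  by rewrite -[2%:R]/((2%:Z)%:~R) -(eqP hz) chi_sqr // -sqrf_eq0 (eqP hz).
case: (chi_ne0 m.*2 t0) => // /(chi_eq1) [_ /(chi_sq_root cardF m2_gt0 t0) [b eb]].
case: nz.
have lt_b : (b < p)%N by rewrite -[X in (_ < X)%N](Fp_cast p_pr) ltn_ord.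
exists (Ordinal lt_b).
rewrite -intr_Fp_eq0 // rmorphB rmorphXn /= -[(b%:Z)%:~R]/(b%:R) natr_Zp -eb subrr //.
Qed.

(** Half of [jac 1] is odd, and its square is part of a representation of p as a sum of two squares,
    so it is x or -x; [jac1_mod8] then selects the sign. *)
Lemma jacobsthal : jac m.*2 (1 : 'F_p) = - (2 * (-1) ^+ m * x).
Proof.
have [c ec] := nonresidue cardF m2_gt0.
have := jac_sum_sq cardF m2_gt0 chi_N1 ec.
have [k ek] := jac1_mod8 cardF m2_gt0 chi_N1.
rewrite chi2E in ek.
set J := jac _ _ in ek *; set J' := jac _ _ => e.
have epz : p%:Z = (4 * m%:Z) + 1 by rewrite ep; lia.
have eq4 : ((m.*2).*2.+1)%:R = p%:Z by rewrite ep; lia.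
rewrite eq4 in e.
have [t et] : exists t, J = 2 + 4 * t.
  move: ek; rewrite -signr_odd; case: (odd m); rewrite /= ?expr0 ?expr1 => ek.
    by exists (1 - m%:Z + 2 * k); lia.
  by exists (3 - m%:Z + 2 * k); lia.
have [w ew] : exists w, J' = 2 * w.
  have : (2 %| J')%Z.
    have : (2 %| J' ^+ 2)%Z by apply/dvdzP; exists (2 * p%:Z - 2 * (1 + 2 * t) ^+ 2);
      rewrite -[LHS](addKr (J ^+ 2)) e et; ring.
    by rewrite !dvdzE abszX Euclid_dvdX // andbT.
  by move=> /dvdzP [w ew]; exists w; rewrite ew mulrC.
have e4 : p%:Z = (1 + 2 * t) ^+ 2 + w ^+ 2 by apply: (@mulfI _ 4%:R) => //; rewrite -e et ew; ring.
have [xo to] := odd_parts t x4.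
have /eqP := sum_two_squares_unique p_pr p_odd exy e4 xo to.
rewrite eqf_sqr => H; rewrite et; move: ek; rewrite et.
rewrite (_ : (m.*2).*2%:R = 4 * m%:R); last by rewrite -!muln2 !natrM; ring.
have em : m%:R = (odd m)%:R + m./2%:R * 2 :> int.
  by rewrite -{1}[m]odd_double_half -muln2 natrD natrM.
rewrite -signr_odd; case: (odd m) em => /= em ek; apply: (jac_sign x4 H ek).
  by right; split; [rewrite expr1 | exact: em].
by left; split; [rewrite expr0 | rewrite em add0r].
Qed.
End Jacobsthal.

(** * Teichmueller representatives *)

Section PIntegersMore.
Variable p : nat.
Hypothesis p_pr : prime p.

Lemma eqmX k x y n : eqm p k x y -> pint p x -> pint p y -> eqm p k (x ^+ n) (y ^+ n).
Proof.
move=> e px py; elim: n => [|n ih]; first by rewrite !expr0; apply: eqm_refl.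
by rewrite !exprS; apply: eqmM => //; apply: pintX.
Qed.

(** The cofactor of x - y in x^p - y^p is congruent to p y^(p-1), hence supplies one more factor
    p. *)
Lemma eqm_expp k x y : (0 < k)%N -> eqm p k x y -> pint p x -> pint p y ->
  eqm p k.+1 (x ^+ p) (y ^+ p).
Proof.
move=> k0 e px py.
have [w pw ew] : eqm p 1 (\sum_(i < p) x ^+ (p.-1 - i) * y ^+ i) 0.
  apply: (@eqm_trans _ _ (p%:R * y ^+ p.-1)); last first.
    by exists (y ^+ p.-1); [apply: pintX | rewrite subr0 expr1].
  have -> : p%:R * y ^+ p.-1 = \sum_(i < p) y ^+ (p.-1 - i) * y ^+ i.
    transitivity (\sum_(i < p) y ^+ p.-1); first by rewrite sumr_const card_ord mulr_natl.
    apply: eq_bigr => i _; rewrite -exprD; congr (_ ^+ _).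
    have := ltn_ord i; lia.
  apply: eqm_sum => i _; apply: eqm_mulr; first exact: pintX.
  exact: eqmX (eqm_leq _ e) px py.
rewrite subr0 expr1 in ew.
case: e => z pz ez; exists (z * w); first exact: pintM.
by rewrite subrXX ez ew exprS; ring.
Qed.

Lemma eqm_intFp (a b : int) : a%:~R = b%:~R :> 'F_p -> eqm p 1 a%:~R b%:~R.
Proof.
move=> e; have : (p%:Z %| a - b)%Z by rewrite -intr_Fp_eq0 // intrB e subrr.
case/dvdzP => k ek; exists k%:~R; first exact: pint_int.
by rewrite -intrB ek intrM expr1 mulrC.
Qed.

Lemma eqm_natFp (a b : nat) : a%:R = b%:R :> 'F_p -> eqm p 1 a%:R b%:R.
Proof. by move=> e; have := @eqm_intFp a b; apply. Qed.

End PIntegersMore.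

Section Teichmuller.
Variables (p m : nat).
Hypothesis p_pr : prime p.
Hypothesis ep : p = (4 * m).+1.

Let m_gt0 : (0 < m)%N.
Proof. by move: p_pr; rewrite ep; case: m. Qed.

Let cardF : #|{: 'F_p}| = (m.*2).*2.+1.
Proof. by rewrite card_Fp // ep; lia. Qed.

Let m2_gt0 : (0 < m.*2)%N. Proof. by rewrite double_gt0. Qed.

(* [a ^ (p ^ 2)] agrees with the Teichmueller representative of [a] only modulo [p ^ 3]. *)
Definition teich (a : 'F_p) : rat := (nat_of_ord a)%:R ^+ (p * p).

Lemma pint_teich a : pint p (teich a).
Proof. exact/pintX/pint_nat. Qed.
Hint Resolve pint_teich : core.

Lemma eqm_teich (x y : rat) : eqm p 1 x y -> pint p x -> pint p y ->
  eqm p 3 (x ^+ (p * p)) (y ^+ (p * p)).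
Proof.
move=> e px py; rewrite !exprM.
by apply: eqm_expp => //; [apply: eqm_expp | exact: pintX | exact: pintX].
Qed.

Lemma teichM a b : eqm p 3 (teich (a * b)) (teich a * teich b).
Proof.
rewrite /teich -exprMn; apply: eqm_teich; [|exact: pint_nat|by apply: pintM => //; exact: pint_nat].
by rewrite -natrM; apply: eqm_natFp => //; rewrite natrM !natr_Zp.
Qed.

Lemma teich1 : teich 1 = 1.
Proof. by rewrite /teich /= expr1n. Qed.

Lemma teich0 : teich 0 = 0.
Proof. by rewrite /teich /= expr0n muln_eq0 /= eqn0Ngt prime_gt0. Qed.

Lemma teichX a k : eqm p 3 (teich (a ^+ k)) (teich a ^+ k).
Proof.
elim: k => [|k ih]; first by rewrite !expr0 teich1; apply: eqm_refl.
rewrite !exprS; apply: (eqm_trans (teichM _ _)); exact: eqm_mull.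
Qed.

(** Multiplication by a generator z permutes the terms, so the sum is annihilated by z^j - 1, which
    is prime to p unless 4m divides j. *)
Lemma sum_teichX j : eqm p 3 (\sum_(a | a != 0) teich a ^+ j)
  (if (4 * m %| j)%N then (p.-1)%:R else 0).
Proof.
have mm : (m.*2.*2 = 4 * m)%N by lia.
case: ifP => dj.
  have -> : (p.-1)%:R = \sum_(a : 'F_p | a != 0) 1 :> rat.
    rewrite sumr_const; congr (_ *+ _).
    have := cardC1 (0 : 'F_p); rewrite card_Fp // => <-.
  apply: eqm_sum => a a0; apply: (eqm_trans (eqm_sym (teichX _ _))).
  case/dvdnP: dj => k ->; rewrite mulnC exprM -mm (expf_order cardF a0) expr1n teich1.
  exact: eqm_refl.
have [z pz] := prim_rootF cardF m2_gt0.
have z0 : z != 0.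
  apply/eqP=> z0; have := prim_expr_order pz.
  by rewrite z0 expr0n double_eq0 eqn0Ngt m2_gt0 /= => /eqP; rewrite eq_sym oner_eq0.
have zj : z ^+ j != 1 by rewrite -(prim_order_dvd pz) mm dj.
(* [N] is a natural number equal to [teich z ^+ j], so that [N.-1] can be cancelled by
   [eqm_cancel]. *)
pose N := ((nat_of_ord z ^ (p * p)) ^ j)%N.
set S := \sum_(a | _) _.
have pS : pint p S by apply: pint_sum => a _; apply: pintX.
have e1 : eqm p 3 (teich z ^+ j * S) S.
  rewrite {2}/S (reindex_inj (mulfI z0)) mulr_sumr /=.
  rewrite [X in eqm _ _ _ X](eq_bigl (fun a => a != 0)); last first.
    by move=> a; rewrite mulf_eq0 (negPf z0).
  apply: eqm_sum => a a0; rewrite -exprMn; apply: eqmX => //; last exact: pintM.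
  exact/eqm_sym/teichM.
have eN : teich z ^+ j = N%:R by rewrite /N !natrX.
have N0 : (0 < N)%N by rewrite !expn_gt0 lt0n (inj_eq val_inj z 0) z0.
have zN : N%:R = z ^+ j :> 'F_p.
  rewrite /N !natrX natr_Zp exprM.
  by have := expf_card z; rewrite card_Fp // => ez; rewrite !ez.
have cN : coprime N.-1 p.
  rewrite coprime_sym prime_coprime //; apply: contraNN zj.
  by rewrite (dvdn_pcharf (pchar_Fp p_pr)) -subn1 natrB // subr_eq0 zN.
apply: (eqm_cancel p_pr cN); rewrite mulr0.
have -> : N.-1%:R * S = teich z ^+ j * S - S.
  by rewrite eN -subn1 natrB // mulrBl mul1r.
rewrite -[X in eqm _ _ _ X](subrr S); apply: eqmD => //; exact: eqm_refl.
Qed.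

(* The quintic takes the values [8] and [-8] at [1] and [-1], to third order. *)
Lemma chi_poly (a : 'F_p) (v : int) : v%:~R = a -> a != 0 ->
  let w : rat := v%:~R ^+ m.*2 in
  eqm p 3 (8%:R * (chi m.*2 a)%:~R) (15%:R * w - 10%:R * w ^+ 3 + 3%:R * w ^+ 5).
Proof.
move=> va a0 w.
have : eqm p 1 w (chi m.*2 a)%:~R.
  rewrite /w -rmorphXn; apply: eqm_intFp => //.
  by rewrite (chiF cardF m2_gt0) rmorphXn /= va.
have pw : pint p w by apply/pintX/pint_int.
case: (chi_ne0 m.*2 a0) => -> [z pz]; rewrite expr1 => ew; apply: eqm_sym.
  exists (z ^+ 3 * (3%:R * w ^+ 2 + 9%:R * w + 8%:R)).
    by pint_tac.
  by rewrite mulrA -exprMn -ew; ring.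
exists (z ^+ 3 * (3%:R * w ^+ 2 - 9%:R * w + 8%:R)).
  by pint_tac.
by rewrite mulrA -exprMn -ew; ring.
Qed.

Lemma teich_cubic_chi (a : 'F_p) :
  let w := (teich a * (teich a ^+ 2 - 1)) ^+ m.*2 in
  eqm p 3 (8%:R * (chi m.*2 (a * (a ^+ 2 - 1)))%:~R) (15%:R * w - 10%:R * w ^+ 3 + 3%:R * w ^+ 5).
Proof.
pose v : int := (nat_of_ord a)%:Z ^+ (p * p) * (((nat_of_ord a)%:Z ^+ (p * p)) ^+ 2 - 1).
have ev : teich a * (teich a ^+ 2 - 1) = v%:~R.
  by rewrite /v /teich !(rmorphM, rmorphB, rmorphXn, rmorph1).
have va : v%:~R = a * (a ^+ 2 - 1).
  have e : ((nat_of_ord a)%:Z ^+ (p * p))%:~R = a.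
    rewrite rmorphXn /= -[((nat_of_ord a)%:Z)%:~R]/((nat_of_ord a)%:R) natr_Zp exprM.
    by have := expf_card a; rewrite card_Fp // => e; rewrite !e.
  by rewrite /v !(rmorphM, rmorphB, rmorphXn, rmorph1) /= -[in LHS]rmorphXn /= e.
move=> w; have [a0|a0] := eqVneq (a * (a ^+ 2 - 1)) 0; last first.
  by rewrite /w ev; apply: chi_poly.
(* For a = 0, 1 or -1 the cubic vanishes at the representative modulo p^3, not merely modulo p, so
   both sides are 0. *)
have e0 : eqm p 3 (teich a * (teich a ^+ 2 - 1)) 0.
  move/eqP: a0; rewrite mulf_eq0 => /orP [/eqP ->|].
    by rewrite teich0 mul0r; apply: eqm_refl.
  rewrite subr_eq0 => /eqP a2; rewrite -[X in eqm _ _ _ X](mulr0 (teich a)).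
  apply: eqm_mull => //; rewrite -[X in eqm _ _ _ X](subrr 1).
  apply: eqmD; last exact: eqm_refl.
  by apply: (eqm_trans (eqm_sym (teichX _ _))); rewrite a2 teich1; apply: eqm_refl.
have pv : pint p (teich a * (teich a ^+ 2 - 1)) by rewrite ev; apply: pint_int.
have w0 : eqm p 3 w 0.
  have := eqmX m.*2 e0 pv (pint0 p); by rewrite expr0n double_eq0 eqn0Ngt m_gt0.
have pw : pint p w by apply: pintX.
rewrite a0 chi0 mulr0; case: w0 => z pz; rewrite subr0 => ew.
apply: eqm_sym; exists (z * (15%:R - 10%:R * w ^+ 2 + 3%:R * w ^+ 4)).
  by pint_tac.
by rewrite mulrA -ew; ring.
Qed.

Lemma big_arith (G : nat -> rat) e :
  \sum_(i < 2 * m * e | (i %% (2 * m) == m)%N) G i = \sum_(j < e) G (m + 2 * m * j)%N.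
Proof.
elim: e => [|e ih]; first by rewrite muln0 !big_ord0.
rewrite big_ord_recr /= -ih mulnS addnC big_mkcond big_split_ord /= -big_mkcond /=.
congr (_ + _).
have lt_m : (m < 2 * m)%N by lia.
rewrite (bigD1 (Ordinal lt_m)) //= mulnC modnMDl modn_small // eqxx addnC big1 ?addr0.
  by rewrite mulnC.
move=> i /negP ni; rewrite modnMDl modn_small //; case: eqP => // ei.
by case: ni; apply/eqP/val_inj.
Qed.

(** In the binomial expansion only exponents divisible by 4m survive the power sums. Since [e] is
    odd, this means i = m modulo 2m, and all surviving terms carry the sign (-1)^m. *)
Lemma sum_teich_power e : odd e ->
  eqm p 3 (\sum_(a : 'F_p) (teich a * (teich a ^+ 2 - 1)) ^+ (m.*2 * e))
    ((p.-1)%:R * (-1) ^+ m * \sum_(j < e) 'C(2 * m * e, m + 2 * m * j)%:R).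
Proof.
move=> oe; have e0 : (0 < e)%N by case: e oe.
have M0 : (0 < m.*2 * e)%N by rewrite muln_gt0 m2_gt0.
rewrite (bigD1 0) //= teich0 mul0r expr0n eqn0Ngt M0 add0r.
have -> : \sum_(a : 'F_p | a != 0) (teich a * (teich a ^+ 2 - 1)) ^+ (m.*2 * e) =
   \sum_(i < (2 * m * e).+1) ((-1) ^+ i * 'C(2 * m * e, i)%:R)
       * \sum_(a : 'F_p | a != 0) teich a ^+ (2 * m * e + 2 * i).
  under [RHS]eq_bigr do rewrite mulr_sumr.
  rewrite exchange_big /=; apply: eq_bigr => a _.
  rewrite exprMn addrC -mul2n exprDn mulr_sumr; apply: eq_bigr => i _.
  have -> : (-1) ^+ (2 * m * e - i) = (-1) ^+ i :> rat.
    rewrite -signr_odd oddB; last by rewrite -ltnS.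
    by rewrite (_ : odd (2 * m * e) = false) ?signr_odd // -mulnA mul2n odd_double.
  by rewrite -mulr_natr exprD [_ ^+ (2 * i)]exprM; ring.
have dvd i : (4 * m %| 2 * m * e + 2 * i)%N = (i %% (2 * m) == m)%N.
  have -> : (4 * m = 2 * (2 * m))%N by lia.
  have -> : (2 * m * e + 2 * i = 2 * (m * e + i))%N by lia.
  rewrite dvdn_pmul2l //.
  have [k ek] : exists k, e = (2 * k + 1)%N by exists e./2; lia.
  have -> : (m * e + i = k * (2 * m) + (m + i))%N by rewrite ek; lia.
  rewrite (dvdn_addr _ (dvdn_mull k (dvdnn (2 * m)))).
  have lt_r : (i %% (2 * m) < 2 * m)%N by rewrite ltn_mod; lia.
  rewrite {1}(divn_eq i (2 * m)) addnCA (dvdn_addr _ (dvdn_mull _ (dvdnn (2 * m)))).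
  apply/idP/eqP => [/dvdnP [c ec]|->]; last by rewrite addnn mul2n.
  by case: c ec => [|[|c]] ec; lia.
apply: (@eqm_trans _ _ (\sum_(i < (2 * m * e).+1 | (i %% (2 * m) == m)%N)
    (-1) ^+ i * 'C(2 * m * e, i)%:R * (p.-1)%:R)).
  rewrite [X in eqm _ _ _ X]big_mkcond /=; apply: eqm_sum => i _.
  have pc : pint p ((-1) ^+ i * 'C(2 * m * e, i)%:R).
    by apply: pintM; [apply/pintX/pintN/pint1 | exact: pint_nat].
  have := eqm_mull pc (sum_teichX (2 * m * e + 2 * i)); rewrite dvd.
  by case: ifP => // _; rewrite mulr0.
rewrite big_mkcond big_ord_recr /= -big_mkcond /=.
have -> : ((2 * m * e) %% (2 * m) == m)%N = false.
  by rewrite mulnC modnMl; case: (m) m_gt0.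
rewrite addr0 (big_arith (fun i => (-1) ^+ i * 'C(2 * m * e, i)%:R * (p.-1)%:R)).
rewrite mulr_sumr.
have -> : \sum_(j < e) (-1) ^+ (m + 2 * m * j) * 'C(2 * m * e, m + 2 * m * j)%:R * p.-1%:R
  = \sum_(i < e) p.-1%:R * (-1) ^+ m * 'C(2 * m * e, m + 2 * m * i)%:R :> rat.
  apply: eq_bigr => j _; rewrite exprD.
  have -> : (-1) ^+ (2 * m * j) = 1 :> rat by rewrite -mulnA exprM sqrrN !expr1n.
  by ring.
exact: eqm_refl.
Qed.

Lemma jac_modp3 : eqm p 3 (8%:R * (jac m.*2 (1 : 'F_p))%:~R)
  ((p.-1)%:R * (-1) ^+ m * (15%:R * 'C(2 * m, m)%:R
     - 10%:R * (2%:R * 'C(6 * m, m)%:R + 'C(6 * m, 3 * m)%:R)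
     + 3%:R * (2%:R * 'C(10 * m, m)%:R + 2%:R * 'C(10 * m, 3 * m)%:R + 'C(10 * m, 5 * m)%:R))).
Proof.
pose v a := (teich a * (teich a ^+ 2 - 1)).
apply: (@eqm_trans _ _ (15%:R * (\sum_(a : 'F_p) v a ^+ (m.*2 * 1))
    - 10%:R * (\sum_(a : 'F_p) v a ^+ (m.*2 * 3)) + 3%:R * (\sum_(a : 'F_p) v a ^+ (m.*2 * 5)))).
  rewrite !mulr_sumr -sumrB -big_split /= rmorph_sum mulr_sumr /=.
  apply: eqm_sum => a _; rewrite muln1 !exprM.
  exact: teich_cubic_chi.
have e1 := @sum_teich_power 1 isT; have e3 := @sum_teich_power 3 isT.
have e5 := @sum_teich_power 5 isT.
apply: (@eqm_trans _ _ _ _ _ (eqmD (eqmD (eqm_mull (pint_nat p 15) e1)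
   (eqmN (eqm_mull (pint_nat p 10) e3))) (eqm_mull (pint_nat p 3) e5))).
rewrite !big_ord_recr !big_ord0 /= !add0r.
have -> : (m + 2 * m * 0 = m)%N by lia.
have -> : (2 * m * 1 = 2 * m)%N by lia.
have -> : (2 * m * 3 = 6 * m)%N by lia.
have -> : (2 * m * 5 = 10 * m)%N by lia.
have -> : (m + 2 * m = 3 * m)%N by lia.
have -> : (m + 2 * m * 2 = 5 * m)%N by lia.
have -> : (m + 6 * m = 7 * m)%N by lia.
have -> : (m + 2 * m * 4 = 9 * m)%N by lia.
have -> : 'C(6 * m, 5 * m) = 'C(6 * m, m).
  by rewrite -bin_sub; last lia; congr 'C(_, _); lia.
have -> : 'C(10 * m, 9 * m) = 'C(10 * m, m).
  by rewrite -bin_sub; last lia; congr 'C(_, _); lia.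
have -> : 'C(10 * m, 7 * m) = 'C(10 * m, 3 * m).
  by rewrite -bin_sub; last lia; congr 'C(_, _); lia.
by apply: eqm_eq; ring.
Qed.
End Teichmuller.

(** * Truncated solutions of Legendre's equation *)

Definition u (k : nat) : rat := ('C(k.*2, k)%:R / 4%:R ^+ k) ^+ 2.

Lemma u0 : u 0 = 1.
Proof. by rewrite /u bin0 expr0 divr1 expr1n. Qed.

Lemma bin_centralS k : (k.+1 * 'C(k.+1.*2, k.+1) = 2 * (k.*2.+1) * 'C(k.*2, k))%N.
Proof.
have e1 := mul_bin_diag k.*2.+2 k; have e2 := mul_bin_down k.*2.+1 k.
rewrite /= in e1 e2; rewrite doubleS -e1.
have e3 : (k.*2.+1 - k = k.+1)%N by lia.
by rewrite e3 in e2; rewrite -[RHS]mulnA e2 mulnA; congr (_ * _)%N; lia.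
Qed.

Lemma uS k : (2 * k.+1)%:R ^+ 2 * u k.+1 = (k.*2.+1)%:R ^+ 2 * u k.
Proof.
have f4 : (4%:R : rat) ^+ k != 0 by rewrite expf_neq0.
rewrite /u -!exprMn; congr (_ ^+ 2).
have := congr1 (fun n => n%:R : rat) (bin_centralS k); rewrite !natrM => e.
rewrite exprS; transitivity (k.+1%:R * 'C(k.+1.*2, k.+1)%:R * 2%:R / (4%:R * 4%:R ^+ k) : rat).
  by field.
by rewrite e; field.
Qed.

Definition U (N : nat) : {poly rat} := \sum_(k < N) u k *: 'X^k.

(** The hypergeometric operator of 2F1(1/2, 1/2; 1; t), which kills the series of the [u k]. It is
    self-adjoint, being y -> (4t(1-t) y')' - y; hence the derivative of [wr] below. *)
Definition legop (y : {poly rat}) : {poly rat} :=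
  4%:R * 'X * (1 - 'X) * y^`()^`() + 4%:R * (1 - 2%:R * 'X) * y^`() - y.

Lemma legopD y z : legop (y + z) = legop y + legop z.
Proof. by rewrite /legop !derivD; ring. Qed.

Lemma legopZ c y : legop (c *: y) = c *: legop y.
Proof. by rewrite /legop !derivZ -!mul_polyC; ring. Qed.

Lemma deriv_nat k : (k%:R : {poly rat})^`() = 0.
Proof. by rewrite -polyC_natr derivC. Qed.

Lemma horner_nat k t : (k%:R : {poly rat}).[t] = k%:R.
Proof. by rewrite -polyC_natr hornerC. Qed.

Lemma horner_one t : (1 : {poly rat}).[t] = 1.
Proof. exact: (horner_nat 1). Qed.

Lemma comp_nat k (q : {poly rat}) : k%:R \Po q = k%:R.
Proof. by rewrite -polyC_natr comp_polyC. Qed.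

Lemma comp_one (q : {poly rat}) : 1 \Po q = 1.
Proof. exact: (comp_nat 1). Qed.

Lemma legopXS k : legop ('X^(k.+1)) =
  (((2 * k.+1)%:R : rat) ^+ 2) *: 'X^k - (((k.*2.+3)%:R : rat) ^+ 2) *: 'X^(k.+1).
Proof.
have -> : (k.*2.+3 = 2 * k + 3)%N by lia.
have d1 j : ('X^(j.+1) : {poly rat})^`() = j.+1%:R * 'X^j by rewrite derivXn mulr_natl.
rewrite -!mul_polyC !polyC_exp !polyC_natr /legop d1.
rewrite derivM deriv_nat mul0r add0r; case: k => [|k].
  by rewrite expr0 -[1]/(1%:P) derivC; ring.
by rewrite d1 !exprS !natrD !natrM -!natr1; ring.
Qed.

(** The recurrence [uS] cancels every coefficient but the one at the point of truncation. *)
Lemma legopU N : legop (U N.+1) = - (((N.*2.+1)%:R ^+ 2 * u N) *: 'X^N).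
Proof.
elim: N => [|N ih]; rewrite /U big_ord_recr /= -/(U _).
  have d1 : (1 : {poly rat})^`() = 0 by exact: derivC.
  by rewrite /U big_ord0 add0r u0 expr0 mulr1 expr1n !scale1r /legop d1 deriv0; ring.
rewrite legopD ih legopZ legopXS scalerBr !scalerA [u N.+1 * _]mulrC uS.
by rewrite [u N.+1 * _]mulrC addrA addNr add0r.
Qed.

(** * Wronskians of truncated solutions at -1 and 2 *)

Definition wr (y z : {poly rat}) := 'X * (1 - 'X) * (y * z^`() - y^`() * z).

Lemma deriv_wr y z : 4%:R * (wr y z)^`() = y * legop z - z * legop y.
Proof.
have d1 : (1 : {poly rat})^`() = 0 by exact: derivC.
by rewrite /wr /legop !(derivM, derivB, derivX) d1; ring.
Qed.

Lemma poly_deriv_eq (E F : {poly rat}) : E^`() = F^`() -> E.[0] = F.[0] -> E = F.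
Proof.
move=> d e; apply/polyP=> [[|i]]; first by rewrite -!horner_coef0.
have := congr1 (fun q : {poly rat} => q`_i) d; rewrite !coef_deriv.
have i0 : i.+1%:R != 0 :> rat by rewrite pnatr_eq0.
by rewrite -[E`_ _ *+ _]mulr_natr -[F`_ _ *+ _]mulr_natr => h; apply: (mulIf i0 h).
Qed.

Lemma deriv_monomial (c : rat) k : ((c / k.+1%:R) *: 'X^(k.+1))^`() = c *: 'X^k.
Proof.
rewrite derivZ derivXn /= -scaler_nat scalerA divfK //.
by rewrite pnatr_eq0.
Qed.

Lemma deriv_sum (R : nzRingType) (I : Type) (r : seq I) (P : pred I) (F : I -> {poly R}) :
  (\sum_(i <- r | P i) F i)^`() = \sum_(i <- r | P i) (F i)^`().
Proof. exact: (big_morph _ (@derivD R) (@deriv0 R)). Qed.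

Lemma hornerU N t : (U N).[t] = \sum_(k < N) u k * t ^+ k.
Proof. by rewrite /U horner_sum; apply: eq_bigr => k _; rewrite hornerZ hornerXn. Qed.

Lemma hornerdU N t : t * (U N)^`().[t] = \sum_(k < N) k%:R * u k * t ^+ k.
Proof.
rewrite /U deriv_sum horner_sum mulr_sumr; apply: eq_bigr => k _.
rewrite derivZ hornerZ derivXn hornerMn hornerXn -mulr_natr.
by case: k => [[|k] hk] /=; rewrite ?mulr0 ?mul0r // exprS; ring.
Qed.

Definition Km (n : nat) : rat := \sum_(k < n) u k * (-1) ^+ k.
(** The weights of [Wm] and [Wp] turn the values of t y' into U - 4U' at -1 and U + 4U' at 2; a
    difference of products K W of two solutions is then a multiple of their Wronskian. *)
Definition Wm (n : nat) : rat := \sum_(k < n) (4 * k).+1%:R * u k * (-1) ^+ k.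
Definition Kp (n : nat) : rat := \sum_(k < n) u k * 2%:R ^+ k.
Definition Wp (n : nat) : rat := \sum_(k < n) (k.*2).+1%:R * u k * 2%:R ^+ k.

Lemma KmE n : (U n).[-1] = Km n. Proof. exact: hornerU. Qed.
Lemma KpE n : (U n).[2%:R] = Kp n. Proof. exact: hornerU. Qed.

Lemma WmE n : Wm n = (U n).[-1] - 4%:R * (U n)^`().[-1].
Proof.
have -> : 4%:R * (U n)^`().[-1] = - 4%:R * (-1 * (U n)^`().[-1]) by ring.
rewrite hornerU hornerdU mulr_sumr -sumrB; apply: eq_bigr => k _.
rewrite -natr1 natrM; ring.
Qed.

Lemma WpE n : Wp n = (U n).[2%:R] + 4%:R * (U n)^`().[2%:R].
Proof.
have -> : 4%:R * (U n)^`().[2%:R] = 2%:R * (2%:R * (U n)^`().[2%:R]) by ring.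
rewrite hornerU hornerdU mulr_sumr -big_split; apply: eq_bigr => k _ /=.
rewrite -natr1 -muln2 natrM; ring.
Qed.

Definition A_ (n : nat) : rat := (n.*2.+1)%:R ^+ 2 * u n.

Lemma wr_heads n N :
  2%:R * (Km n.+1 * Wm N.+1 - Wm n.+1 * Km N.+1) =
    A_ n * \sum_(k < N.+1) u k * (-1) ^+ (n + k).+1 / (n + k).+1%:R
    - A_ N * \sum_(k < n.+1) u k * (-1) ^+ (N + k).+1 / (N + k).+1%:R.
Proof.
pose mon c M L := \sum_(k < L.+1) (c * u k / (M + k).+1%:R) *: 'X^((M + k).+1) : {poly rat}.
have dmon c M L : (mon c M L)^`() = (c *: 'X^M) * U L.+1.
  rewrite /mon deriv_sum /U mulr_sumr; apply: eq_bigr => k _.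
  rewrite deriv_monomial exprD -!mul_polyC rmorphM /=; ring.
have e : 4%:R * wr (U n.+1) (U N.+1) = mon (A_ n) n N - mon (A_ N) N n.
  apply: poly_deriv_eq.
    rewrite derivM derivB !dmon deriv_nat mul0r add0r deriv_wr !legopU /A_.
    by rewrite -!mul_polyC; ring.
  rewrite hornerM /wr !hornerM hornerX !mul0r mulr0 hornerD hornerN /mon !horner_sum.
  by rewrite !big1 ?subrr // => k _; rewrite hornerZ hornerXn expr0n mulr0.
have := congr1 (fun q => q.[-1]) e.
have hm c M L : (mon c M L).[-1] = c * \sum_(k < L.+1) u k * (-1) ^+ (M + k).+1 / (M + k).+1%:R.
  rewrite /mon horner_sum mulr_sumr; apply: eq_bigr => k _.
  by rewrite hornerZ hornerXn; ring.
rewrite hornerD hornerN !hm => <-.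
rewrite !WmE -!KmE /wr !(horner_nat, horner_one, hornerX, hornerC, horner_comp, hornerM, hornerD, hornerN); ring.
Qed.

Lemma deriv_flip (q : {poly rat}) : (q \Po (1 - 'X))^`() = - (q^`() \Po (1 - 'X)).
Proof.
have d : (1 - 'X : {poly rat})^`() = - 1 by rewrite derivB derivX (deriv_nat 1) sub0r.
by rewrite deriv_comp d mulrN1.
Qed.

Lemma comp_polyN (q r : {poly rat}) : (- q) \Po r = - (q \Po r).
Proof. by rewrite -[- q]sub0r comp_polyB comp_poly0 sub0r. Qed.

Lemma legop_flip y : legop (y \Po (1 - 'X)) = legop y \Po (1 - 'X).
Proof.
rewrite /legop !deriv_flip derivN deriv_flip opprK.
rewrite !(comp_nat, comp_one, comp_polyX, comp_polyB, comp_polyD, comp_polyM).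
ring.
Qed.

(** [legop] commutes with t -> 1 - t, so the flipped truncation is a second truncated solution. If A
    is the antiderivative of t^N z, then 4 [wr] is [A_ N] times A(t) + A(1-t) - A(1), here taken at
    t = 2. *)
Lemma wr_flip N : ~~ odd N -> 
  2%:R * (Wp N.+1 * Km N.+1 - Kp N.+1 * Wm N.+1) =
   A_ N * \sum_(k < N.+1) (U N.+1 \Po (1 - 'X))`_k
       * (2%:R ^+ (N + k).+1 - (-1) ^+ k - 1) / (N + k).+1%:R.
Proof.
move=> eN; set g := U N.+1; set z := g \Po (1 - 'X).
have sg : (size g <= N.+1)%N.
  apply: (leq_trans (size_sum _ _ _)); apply/bigmax_leqP => k _.
  by apply: (leq_trans (size_scale_leq _ _)); rewrite size_polyXn ltn_ord.
have sz : (size z <= N.+1)%N.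
  rewrite size_comp_poly2 // -opprB size_polyN -[1]/(1%:P) size_XsubC //.
have zE : z = \sum_(k < N.+1) z`_k *: 'X^k.
  rewrite -[LHS]coefK; rewrite poly_def; rewrite (big_ord_widen _ (fun k => z`_k *: 'X^k) sz).
  rewrite [RHS](bigID (fun k : 'I_N.+1 => (k < size z)%N)) /= [X in _ + X]big1 ?addr0 //.
  by move=> k; rewrite -leqNgt => /leq_sizeP ->; rewrite ?scale0r.
pose A : {poly rat} := \sum_(k < N.+1) (z`_k / (N + k).+1%:R) *: 'X^((N + k).+1).
have dA : A^`() = 'X^N * z.
  rewrite [in RHS]zE /A deriv_sum mulr_sumr; apply: eq_bigr => k _.
  by rewrite deriv_monomial exprD -!mul_polyC; ring.
have zz : z \Po (1 - 'X) = g.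
  by rewrite /z -comp_polyA comp_polyB comp_polyX -[1]/(1%:P) comp_polyC subKr comp_polyXr.
have A0 : A.[0] = 0.
  by rewrite /A horner_sum big1 // => k _; rewrite hornerZ hornerXn expr0n mulr0.
have e : 4%:R * wr g z = (A_ N)%:P * (A + (A \Po (1 - 'X)) - A.[1]%:P).
  apply: poly_deriv_eq.
    rewrite derivM deriv_nat mul0r add0r deriv_wr legop_flip.
    rewrite derivM derivC mul0r add0r !(derivD, derivN) derivC oppr0 addr0.
    rewrite deriv_flip dA comp_polyM zz comp_Xn_poly.
    rewrite legopU -/(A_ N) comp_polyN comp_polyZ comp_Xn_poly -!mul_polyC; ring.
  rewrite hornerM /wr !hornerM hornerX !mul0r mulr0 !(hornerD, hornerN, hornerC, horner_comp) A0.
  by rewrite ?horner_one ?hornerX ?subr0 add0r subrr mulr0.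
have := congr1 (fun q => q.[2%:R]) e.
have -> : (4%:R * wr g z).[2%:R] = 2%:R * (Wp N.+1 * Km N.+1 - Kp N.+1 * Wm N.+1).
  rewrite WpE WmE -KmE -KpE -/g /wr /z deriv_flip.
  rewrite !(horner_nat, horner_one, hornerX, hornerC, horner_comp, hornerM, hornerD, hornerN).
  have -> : (1 + - 2%:R : rat) = -1 by [].
  ring.
move=> ->; rewrite !(horner_nat, horner_one, hornerX, hornerC, horner_comp, hornerM, hornerD, hornerN).
have -> : (1 - 2%:R : rat) = -1 by [].
congr (_ * _); rewrite /A !horner_sum -big_split -sumrB /=; apply: eq_bigr => k _.
rewrite !hornerZ !hornerXn expr1n.
have -> : (-1) ^+ (N + k).+1 = - (-1) ^+ k :> rat.
  by rewrite -signr_odd /= oddD (negPf eN) /= signrN signr_odd.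
ring.
Qed.

(* ['X * legop] conjugated by multiplication by the formal power ['X ^ (P / 2)] *)
Definition revop (P : rat) (z : {poly rat}) : {poly rat} :=
  4%:R * 'X ^+ 2 * (1 - 'X) * z^`()^`()
  + 4%:R * 'X * (1 - 2%:R * 'X - P%:P * (1 - 'X)) * z^`()
  + (P%:P ^+ 2 * (1 - 'X) + (2%:R * P%:P - 1) * 'X) * z.

Lemma revopXn P j : revop P ('X^j) =
  ((2%:R * j%:R - P) ^+ 2)%:P * 'X^j - ((2%:R * j%:R - P + 1) ^+ 2)%:P * 'X^(j.+1).
Proof.
have d1 k : ('X^(k.+1) : {poly rat})^`() = k.+1%:R * 'X^k by rewrite derivXn mulr_natl.
rewrite !(polyC_exp, polyCD, polyCB, polyCN, polyCM, polyC_natr) polyC1 /revop.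
case: j => [|[|j]].
- by rewrite expr0 (deriv_nat 1) deriv0; ring.
- by rewrite d1 derivM !deriv_nat expr0 ?(deriv_nat 1); ring.
by rewrite d1 derivM deriv_nat d1 !exprS -!natr1; ring.
Qed.

(** Up to the factor X^(P/2), the reversed truncation is the partial sum of u_k X^(-k-1/2), the
    solution at infinity; again only the boundary term survives. *)
Lemma revop_U n : revop (n.*2.+1)%:R (\sum_(j < n.+1) u (n - j) *: 'X^j) = (A_ n)%:P.
Proof.
set P : rat := (n.*2.+1)%:R.
have revopD y z : revop P (y + z) = revop P y + revop P z.
  by rewrite /revop !derivD; ring.
have revopZ c y : revop P (c *: y) = c *: revop P y.
  by rewrite /revop !derivZ -!mul_polyC; ring.
have key M : (M <= n)%N -> revop P (\sum_(j < M.+1) u (n - j) *: 'X^j)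
   = (A_ n)%:P - (((2 * (n - M))%:R ^+ 2 * u (n - M))%:P * 'X^(M.+1)).
  elim: M => [|M ih] hM.
    rewrite big_ord1 revopZ revopXn subn0 expr0 expr1.
    have -> : 2%:R * 0%:R - P = - P by ring.
    have -> : - P + 1 = - (2 * n)%:R by rewrite /P -natr1 mul2n; ring.
    by rewrite /A_ -/P !sqrrN -!mul_polyC !polyCM; ring.
  rewrite big_ord_recr /= revopD ih ?(ltnW hM) // revopZ revopXn.
  have -> : (n - M = (n - M.+1).+1)%N by lia.
  rewrite uS; set v := u _; set i := (n - M.+1)%N.
  have -> : 2%:R * M.+1%:R - P = - (i.*2.+1)%:R.
    have -> : P = (2 * M.+1 + i.*2.+1)%:R by rewrite /P; congr _%:R; rewrite /i; lia.
    by rewrite natrD natrM; ring.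
  have -> : - (i.*2.+1)%:R + 1 = - (2 * i)%:R :> rat by rewrite -natr1 mul2n; ring.
  by rewrite !sqrrN -!mul_polyC !polyCM; ring.
by rewrite key // subnn muln0 expr0n /= !mul0r subr0.
Qed.

(** The Wronskian of a truncation with itself is zero and says nothing on this product, so the
    truncation at 0 is paired with the one at infinity instead. The map t -> 1/t fixes -1, and there
    the two have the same values up to sign. *)
Lemma head_product n :
  (-1) ^+ n * (Km n.+1 * Wm n.+1) =
  A_ n * \sum_(i < n.+1) (-1) ^+ i * u i / ((n.*2.+1)%:R - 2%:R * i%:R).
Proof.
set y := U n.+1; pose z : {poly rat} := \sum_(j < n.+1) u (n - j) *: 'X^j.
set P : rat := (n.*2.+1)%:R.
have Pne k : 2%:R * k%:R - P != 0.
  rewrite subr_eq0 /P -natrM eqr_nat; apply/eqP; lia.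
pose E := 4%:R * 'X * (1 - 'X) * (y * z^`() - y^`() * z) - 2%:R * P%:P * (1 - 'X) * y * z.
pose F : {poly rat} := \sum_(k < n.+1) (u k / (2%:R * k%:R - P)) *: 'X^k
   + \sum_(j < n.+1) (u (n - j) / (2%:R * (n.+1 + j)%:R - P)) *: 'X^(n.+1 + j).
(* [D] is 2X d/dX conjugated by X^(P/2), and [E] is the Wronskian after the same conjugation. As P
   is odd, [D] kills no nonzero polynomial, so no initial value is needed. *)
pose D (q : {poly rat}) := 2%:R * 'X * q^`() - P%:P * q.
have Dm c k : D ((c / (2%:R * k%:R - P)) *: 'X^k) = c *: 'X^k.
  have -> : c *: 'X^k = (c / (2%:R * k%:R - P))%:P * (2%:R * k%:R - P%:P) * 'X^k :> {poly rat}.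
    rewrite -mul_polyC -[in LHS](divfK (Pne k) c).
    by rewrite [in LHS]polyCM; congr (_ * _ * _); rewrite polyCB polyCM !polyC_natr.
  rewrite /D derivZ derivXn -!mul_polyC.
  case: k => [|k]; first by rewrite mulr0n; ring.
  by rewrite -[_ *+ _]mulr_natl exprS /=; ring.
have DD q1 q2 : D (q1 + q2) = D q1 + D q2 by rewrite /D derivD; ring.
have D0 : D 0 = 0 by rewrite /D deriv0 !mulr0 subrr.
have DF : D F = y + 'X^(n.+1) * z.
  rewrite /F DD !(big_morph D DD D0); congr (_ + _); first by apply: eq_bigr.
  rewrite /z mulr_sumr; apply: eq_bigr => j _.
  by rewrite Dm exprD -!mul_polyC; ring.
have DE : D E = (2%:R * A_ n)%:P * (y + 'X^(n.+1) * z).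
  have -> : D E = 2%:R * (y * revop P z - 'X * z * legop y).
    have dP : (P%:P)^`() = 0 by exact: derivC.
    have d1 : (1 : {poly rat})^`() = 0 by exact: derivC.
    rewrite /D /E /revop /legop !(derivM, derivB, derivX) !deriv_nat d1 dP; ring.
  by rewrite revop_U legopU -/(A_ n) -!mul_polyC exprS [(2%:R * _)%:P]polyCM polyC_natr; ring.
have DI q : D q = 0 -> q = 0.
  move=> dq; apply/polyP=> i; rewrite coef0.
  have := congr1 (fun q : {poly rat} => q`_i) dq.
  rewrite /D coef0 coefB coefCM -mulrA -polyC_natr coefCM coefXM coef_deriv.
  case: i => [|i] /=.
    by rewrite mulr0 sub0r => /eqP; rewrite oppr_eq0 mulf_eq0 pnatr_eq0 /= => /eqP.
  move=> h; have : (2%:R * i.+1%:R - P) * q`_i.+1 = 0 by rewrite -[RHS]h -[q`_ _ *+ _]mulr_natr; ring.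
  by move/eqP; rewrite mulf_eq0 (negPf (Pne _)) => /eqP.
have EF : E = (2%:R * A_ n)%:P * F.
  apply/eqP; rewrite -subr_eq0; apply/eqP/DI.
  have -> : D (E - (2%:R * A_ n)%:P * F) = D E - (2%:R * A_ n)%:P * D F.
    rewrite /D derivB derivM derivC; ring.
  by rewrite DE DF subrr.
have := congr1 (fun q => q.[-1]) EF.
have zv : z.[-1] = (-1) ^+ n * y.[-1].
  rewrite /y hornerU /z horner_sum mulr_sumr (reindex_inj rev_ord_inj) /=.
  apply: eq_bigr => j _; have hj := ltn_ord j.
  rewrite subSS hornerZ hornerXn subKn // mulrCA; congr (_ * _).
  by rewrite signrB // signrMK.
have zd : z^`().[-1] = (-1) ^+ n * (- n%:R * y.[-1] - y^`().[-1]).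
  have -> : z^`().[-1] = \sum_(j < n.+1) u (n - j) * (- j%:R * (-1) ^+ j).
    rewrite /z deriv_sum horner_sum; apply: eq_bigr => j _.
    rewrite derivZ hornerZ derivXn hornerMn hornerXn -mulr_natr.
    by case: j => [[|j] hj] /=; rewrite ?oppr0 ?mul0r ?mulr0 // exprS; ring.
  have -> : - n%:R * y.[-1] - y^`().[-1] = - n%:R * y.[-1] + (-1) * y^`().[-1] by ring.
  rewrite /y hornerU hornerdU mulr_sumr -big_split mulr_sumr (reindex_inj rev_ord_inj) /=.
  apply: eq_bigr => j _; have hj := ltn_ord j.
  rewrite subSS subKn // natrB //.
  by rewrite signrB //; ring.
have Fv : F.[-1] = - 2%:R * \sum_(i < n.+1) (-1) ^+ i * u i / (P - 2%:R * i%:R).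
  rewrite /F hornerD !horner_sum [X in _ + X](reindex_inj rev_ord_inj) -big_split mulr_sumr /=.
  apply: eq_bigr => i _; have hi := ltn_ord i.
  rewrite !hornerZ !hornerXn subSS subKn //.
  have -> : (2%:R * (n.+1 + (n - i))%:R - P) = P - 2%:R * i%:R.
    have -> : (n.+1 + (n - i) = n.*2.+1 - i)%N by lia.
    by rewrite natrB; [rewrite -/P; ring | lia].
  have -> : (-1) ^+ (n.+1 + (n - i)) = - (-1) ^+ i :> rat.
    have -> : (n.+1 + (n - i) = n.*2.+1 - i)%N by lia.
    rewrite signrB; last lia.
    by rewrite -[(-1) ^+ n.*2.+1]signr_odd /= odd_double expr1 mulN1r.
  have -> : (P - 2%:R * i%:R)^-1 = - (2%:R * i%:R - P)^-1 by rewrite -invrN opprB.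
  ring.
rewrite hornerM hornerC Fv /E.
rewrite !(horner_nat, horner_one, hornerX, hornerC, horner_comp, hornerM, hornerD, hornerN) zv zd.
move=> e; apply: (@mulfI _ (- 4%:R)) => //.
rewrite WmE -KmE -/y.
have -> : - 4%:R * (A_ n * \sum_(i < n.+1) (-1) ^+ i * u i / (P - 2%:R * i%:R)) =
  2%:R * A_ n * (- 2%:R * \sum_(i < n.+1) (-1) ^+ i * u i / (P - 2%:R * i%:R)) by ring.
rewrite -e.
have -> : P = 2%:R * n%:R + 1 by rewrite /P -natr1 -mul2n natrM.
ring.
Qed.

(** * The coefficients of (1 - t)^x (1 + t)^y *)

Definition gbin (x : rat) (k : nat) : rat := (\prod_(j < k) (x - j%:R)) / k`!%:R.

Definition Phi (n : nat) (x y : rat) : rat :=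
  \sum_(k < n.+1) (-1) ^+ k * gbin x k * gbin y (n - k).

Lemma fact_neq0 k : k`!%:R != 0 :> rat.
Proof. by rewrite pnatr_eq0 -lt0n fact_gt0. Qed.

Lemma gbin_nat N k : gbin N%:R k = 'C(N, k)%:R.
Proof.
rewrite /gbin; apply: (canLR (mulfK (fact_neq0 k))).
rewrite -natrM bin_ffact; elim: k => [|k ih]; first by rewrite big_ord0 ffactn0.
rewrite big_ord_recr /= ih ffactnSr natrM.
have [kN|Nk] := leqP k N; first by rewrite natrB.
by rewrite ffact_small // !mul0r.
Qed.

Lemma gbin_neg M k : gbin (- (M.+1)%:R) k = (-1) ^+ k * 'C(M + k, k)%:R.
Proof.
rewrite /gbin; apply: (canLR (mulfK (fact_neq0 k))).
rewrite -mulrA -natrM bin_ffact; elim: k => [|k ih].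
  by rewrite big_ord0 addn0 ffactn0 expr0 mulr1.
rewrite big_ord_recr /= ih exprS addnS ffactSS natrM -!natr1 natrD; ring.
Qed.

Lemma Phi_sym n x y : Phi n x y = (-1) ^+ n * Phi n y x.
Proof.
rewrite /Phi (reindex_inj rev_ord_inj) mulr_sumr; apply: eq_bigr => k _ /=.
have hk : (k <= n)%N by rewrite -ltnS.
rewrite subSS subKn //.
rewrite signrB //; ring.
Qed.

Lemma binMC M k n : (k <= n)%N -> ('C(M + k, k) * 'C(M, n - k) = 'C(n, k) * 'C(M + k, n))%N.
Proof.
move=> kn; have [nM|Mn] := leqP n (M + k); last first.
  by rewrite (@bin_small M (n - k)) ?(@bin_small (M + k) n) ?muln0 //; lia.
have c1 := @bin_fact (M + k) k; have c2 := @bin_fact M (n - k).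
have c3 := @bin_fact n k; have c4 := @bin_fact (M + k) n.
have {}c1 : ('C(M + k, k) * (k`! * M`!) = (M + k)`!)%N.
  by rewrite -c1; [rewrite addnK | lia].
have {}c2 : ('C(M, n - k) * ((n - k)`! * (M + k - n)`!) = M`!)%N.
  by rewrite -c2; [congr (_ * (_ * _`!))%N; lia | lia].
have {}c3 := c3 kn; have {}c4 := c4 nM.
have f0 : (0 < k`! * (n - k)`! * (M + k - n)`! * M`!)%N by rewrite !muln_gt0 !fact_gt0.
apply/eqP; rewrite -(eqn_pmul2r f0); apply/eqP.
transitivity (('C(M + k, k) * (k`! * M`!)) * ('C(M, n - k) * ((n - k)`! * (M + k - n)`!)))%N.
  by ring.
rewrite c1 c2 -c4 -c3; ring.
Qed.

Lemma Phi_neg_nat n M : Phi n (- (M.+1)%:R) M%:R = \sum_(k < n.+1) ('C(n, k) * 'C(M + k, n))%:R.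
Proof.
apply: eq_bigr => k _; have hk : (k <= n)%N by rewrite -ltnS.
by rewrite gbin_neg gbin_nat -binMC // natrM signrMK.
Qed.

Lemma bin_add_sym M k : ('C(M + k, k) = \sum_(j < k.+1) 'C(M, j) * 'C(k, j))%N.
Proof.
rewrite -binomial.Vandermonde; apply: eq_bigr => j _; congr (_ * _)%N.
by rewrite bin_sub // -ltnS.
Qed.

Lemma binC_trin n k j : (j <= k)%N -> (k <= n)%N ->
  ('C(n, k) * 'C(k, j) = 'C(n, j) * 'C(n - j, k - j))%N.
Proof.
move=> jk kn.
have c1 := bin_fact kn; have c2 := bin_fact jk; have c3 := bin_fact (leq_trans jk kn).
have c4 : ('C(n - j, k - j) * ((k - j)`! * (n - k)`!) = (n - j)`!)%N.
  have h : (k - j <= n - j)%N by lia.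
  by rewrite -(bin_fact h); congr (_ * (_ * _`!))%N; lia.
have f0 : (0 < k`! * (n - k)`! * (j`! * (k - j)`!))%N by rewrite !muln_gt0 !fact_gt0.
apply/eqP; rewrite -(eqn_pmul2r f0); apply/eqP.
transitivity (('C(n, k) * (k`! * (n - k)`!)) * ('C(k, j) * (j`! * (k - j)`!)))%N; first by ring.
rewrite c1 c2.
transitivity (k`! * ('C(n, j) * (j`! * ('C(n - j, k - j) * ((k - j)`! * (n - k)`!)))))%N; last by ring.
by rewrite c4 c3 mulnC.
Qed.

Lemma bin_weighted_sum (R : comNzRingType) n j (x : R) : (j <= n)%N ->
  \sum_(k < n.+1) ('C(n, k) * 'C(k, j))%:R * x ^+ k = 'C(n, j)%:R * x ^+ j * (1 + x) ^+ (n - j).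
Proof.
move=> jn; rewrite (_ : n.+1 = j + (n - j).+1)%N; last lia.
rewrite big_split_ord /= big1 ?add0r => [|i _]; last by rewrite (@bin_small i j) ?muln0 ?mul0r.
rewrite exprDn mulr_sumr; apply: eq_bigr => i _.
have hi : (i <= n - j)%N by rewrite -ltnS.
rewrite binC_trin; [|lia|lia].
by rewrite addKn natrM exprD expr1n mul1r -[_ *+ _]mulr_natr; ring.
Qed.

(** Vandermonde expands both sides over C(k,j), and [bin_weighted_sum] is applied at 1 and at -2.
    Since 1 + x is then 2 and -1, the exchange of j and n - j identifies the results up to the sign
    (-1)^n. *)
Lemma Phi_neg_small n M : Phi n (- (M.+1)%:R) n%:R =
  (-1) ^+ n * \sum_(k < n.+1) ('C(n, k) * 'C(M + k, n))%:R * (- 2%:R) ^+ k.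
Proof.
have sumE (F : nat -> nat) (x : rat) :
    \sum_(k < n.+1) ('C(n, k) * \sum_(j < n.+1) F j * 'C(k, j))%:R * x ^+ k =
    \sum_(j < n.+1) (F j)%:R * ('C(n, j)%:R * x ^+ j * (1 + x) ^+ (n - j)).
  under eq_bigr => k _ do rewrite natrM natr_sum mulr_sumr mulr_suml.
  rewrite exchange_big /=; apply: eq_bigr => j _.
  have jn : (j <= n)%N by rewrite -ltnS.
  rewrite -(bin_weighted_sum x jn) mulr_sumr; apply: eq_bigr => k _.
  by rewrite !natrM; ring.
have ext (F : nat -> nat -> nat) k : (k <= n)%N -> (forall j, (k < j)%N -> F k j = 0%N) ->
    (\sum_(j < k.+1) F k j = \sum_(j < n.+1) F k j)%N.
  move=> kn F0; rewrite (big_ord_widen n.+1 (F k)) ?ltnS // big_mkcond /=.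
  by apply: eq_bigr => j _; case: ltnP => // /F0 ->.
transitivity (\sum_(k < n.+1) ('C(n, k) * \sum_(j < n.+1) 'C(M, j) * 'C(k, j))%:R * 1 ^+ k : rat).
  apply: eq_bigr => k _; have hk : (k <= n)%N by rewrite -ltnS.
  rewrite gbin_neg gbin_nat signrMK expr1n mulr1 bin_sub // -natrM mulnC bin_add_sym.
  by rewrite (ext (fun k j => 'C(M, j) * 'C(k, j))%N) // => j kj; rewrite (@bin_small k) ?muln0.
have -> : \sum_(k < n.+1) ('C(n, k) * 'C(M + k, n))%:R * (- 2%:R) ^+ k =
  \sum_(k < n.+1) ('C(n, k) * \sum_(j < n.+1) 'C(M, n - j) * 'C(k, j))%:R * (- 2%:R) ^+ k :> rat.
  apply: eq_bigr => k _; congr (_ %:R * _); congr (_ * _)%N.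
  rewrite addnC -binomial.Vandermonde; apply: eq_bigr => j _; exact: mulnC.
rewrite !(sumE (fun j => 'C(M, j))) (sumE (fun j => 'C(M, n - j))).
rewrite [in RHS](reindex_inj rev_ord_inj) mulr_sumr; apply: eq_bigr => j _ /=.
have hj : (j <= n)%N by rewrite -ltnS.
rewrite subSS subKn // bin_sub // expr1n.
have -> : (1 - 2%:R : rat) = -1 by [].
have -> : (1 + 1 : rat) = 2%:R by [].
have -> : (- 2%:R : rat) ^+ (n - j) = (-1) ^+ n * (-1) ^+ j * 2%:R ^+ (n - j).
  by rewrite -mulN1r exprMn signrB.
transitivity ((-1) ^+ n * ((-1) ^+ n * ((-1) ^+ j * ((-1) ^+ j * ('C(M, j)%:R * ('C(n, j)%:R * 2%:R ^+ (n - j)))))) : rat).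
  by rewrite !signrMK; ring.
ring.
Qed.

Lemma coef_exp1cX (R : comNzRingType) (c : R) N k : ((1 + c *: 'X) ^+ N)`_k = c ^+ k * 'C(N, k)%:R.
Proof.
have co (i : nat) : ((1 : {poly R}) ^+ (N - i) * (c *: 'X) ^+ i *+ 'C(N, i))`_k
    = if k == i then c ^+ i * 'C(N, i)%:R else 0.
  rewrite expr1n mul1r exprZn coefMn coefZ coefXn.
  by case: eqP => _ /=; [rewrite mulr1 mulr_natr | rewrite mulr0n mulr0 mul0rn].
rewrite exprDn coef_sum; under eq_bigr do rewrite co.
have [kN|Nk] := leqP k N.
  have lt_k : (k < N.+1)%N by [].
  rewrite (bigD1 (Ordinal lt_k)) //= eqxx big1 ?addr0 // => i ni.
  by case: eqP => // e; case/eqP: ni; apply/val_inj.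
rewrite bin_small // mulr0 big1 // => i _.
by have := ltn_ord i; case: eqP => // <-; rewrite ltnNge Nk.
Qed.

Lemma Phi_nat n a b : Phi n a%:R b%:R = ((1 - 'X) ^+ a * (1 + 'X) ^+ b)`_n.
Proof.
rewrite -[- 'X]scaleN1r -[in X in (1 + X) ^+ b](scale1r 'X).
rewrite coefM; apply: eq_bigr => k _.
by rewrite !gbin_nat !coef_exp1cX expr1n mul1r.
Qed.

Lemma Phi_diag m N : Phi m.*2 N%:R N%:R = (-1) ^+ m * 'C(N, m)%:R.
Proof.
rewrite Phi_nat -exprMn.
have -> : (1 - 'X) * (1 + 'X) = 1 + (-1) *: 'X ^+ 2 :> {poly rat} by rewrite scaleN1r; ring.
have -> : (1 + (-1) *: 'X ^+ 2) ^+ N = ((1 + (-1) *: 'X) ^+ N) \Po 'X^2 :> {poly rat}.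
  by rewrite rmorphXn /= comp_polyD comp_polyZ comp_polyX comp_polyC.
by rewrite coef_comp_poly_Xn // dvdn2 odd_double /= -muln2 mulnK // coef_exp1cX.
Qed.

(** For odd a, the polynomial (1-t)^a (1+t)^b of degree 2n is antipalindromic, so its middle
    coefficient is zero. *)
Lemma Phi_anti m a b : (a + b = m.*2.*2)%N -> odd a -> Phi m.*2 a%:R b%:R = 0.
Proof.
set n := m.*2.
have key a' b' : (a' + b' = n.*2)%N -> odd a' -> (a' <= n)%N -> Phi n a'%:R b'%:R = 0.
  move=> e o an.
  have -> : Phi n a'%:R b'%:R = \sum_(k < a'.+1) (-1) ^+ k * ('C(a', k) * 'C(b', n - k))%:R.
    rewrite /Phi; under eq_bigr do rewrite !gbin_nat.
    rewrite (_ : n.+1 = a'.+1 + (n - a'))%N; last lia.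
    rewrite big_split_ord /= [X in _ + X]big1 ?addr0 => [|i _].
      by apply: eq_bigr => k _; rewrite natrM mulrA.
    by rewrite (@bin_small a') ?mulr0 ?mul0r //; lia.
  set S := \sum_(k < _) _; suff : S = - S by lra.
  rewrite {1}/S (reindex_inj rev_ord_inj) -sumrN; apply: eq_bigr => k _ /=.
  have ka : (k <= a')%N by rewrite -ltnS.
  rewrite subSS bin_sub //.
  have -> : 'C(b', n - (a' - k)) = 'C(b', n - k).
    by rewrite -bin_sub; [congr 'C(_, _); lia | lia].
  by rewrite signrB // -[(-1) ^+ a']signr_odd o; ring.
move=> e o; have [an|na] := leqP a n; first exact: key.
rewrite Phi_sym key ?mulr0 //; [lia | | lia].
by have := congr1 odd e; rewrite oddD o odd_double; case: (odd b).
Qed.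

Definition gpoly (c s : rat) (k : nat) : {poly rat} :=
  (k`!%:R)^-1 *: \prod_(j < k) ((c - j%:R)%:P + s *: 'X).

Lemma gpolyE c s k t : (gpoly c s k).[t] = gbin (c + s * t) k.
Proof.
rewrite /gpoly /gbin hornerZ mulrC horner_prod; congr (_ / _).
apply: eq_bigr => j _; rewrite hornerD hornerC hornerZ hornerX; ring.
Qed.

Lemma gpoly_top c s k : (size (gpoly c s k) <= k.+1)%N /\ (gpoly c s k)`_k = s ^+ k / k`!%:R.
Proof.
rewrite /gpoly; suff [h1 h2] : (size (\prod_(j < k) ((c - j%:R)%:P + s *: 'X))%R <= k.+1)%N /\
    (\prod_(j < k) ((c - j%:R)%:P + s *: 'X))`_k = s ^+ k.
  by split; [apply: leq_trans (size_scale_leq _ _) h1 | rewrite coefZ h2 mulrC].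
elim: k => [|k [ih1 ih2]]; first by rewrite big_ord0 size_poly1 coef1 expr0.
rewrite big_ord_recr /=; set r := \prod_(_ < k) _ in ih1 ih2 *.
split.
  apply: (leq_trans (size_polyMleq _ _)).
  have : (size ((c - k%:R)%:P + s *: 'X)%R <= 2)%N.
    apply: (leq_trans (size_polyD _ _)); rewrite geq_max.
    rewrite (leq_trans (size_polyC_leq1 _)) //=.
    by apply: (leq_trans (size_scale_leq _ _)); rewrite size_polyX.
  lia.
rewrite mulrDr coefD coefMC -scalerAr coefZ coefMX /= ih2 exprS.
by rewrite (nth_default 0 ih1) mul0r add0r.
Qed.

Lemma coefM_top (q r : {poly rat}) k l : (size q <= k.+1)%N -> (size r <= l.+1)%N ->
  (size (q * r)%R <= (k + l).+1)%N /\ (q * r)`_(k + l) = q`_k * r`_l.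
Proof.
move=> hq hr; split; first by apply: (leq_trans (size_polyMleq _ _)); lia.
have lt_k : (k < (k + l).+1)%N by rewrite ltnS leq_addr.
rewrite coefM (bigD1 (Ordinal lt_k)) //= addKn big1 ?addr0 // => i /eqP ni.
have [ik|ki] := ltnP k i; first by rewrite (nth_default 0 (leq_trans hq ik)) mul0r.
have {}ki : (i < k)%N by rewrite ltn_neqAle ki andbT; apply/eqP => e; apply: ni; apply/val_inj.
by rewrite [r`_ _]nth_default ?mulr0 //; apply: (leq_trans hr); lia.
Qed.

(* As a polynomial in [t], [Phi n (n - t) (n + t)] has degree [n] and, by [Phi_anti],
   the roots [n - 1, n - 3, ..., 1 - n]; the point needed is [t = 2n + 1]. *)
Lemma Phi_antidiag m : Phi m.*2 (- (m.*2.+1)%:R) (6 * m + 1)%:R = 16%:R ^+ m * 'C(3 * m, m)%:R.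
Proof.
set n := m.*2.
pose q : {poly rat} := \sum_(k < n.+1) (-1) ^+ k *: (gpoly n%:R (-1) k * gpoly n%:R 1 (n - k)).
have qE t : q.[t] = Phi n (n%:R - t) (n%:R + t).
  rewrite /q horner_sum; apply: eq_bigr => k _.
  by rewrite hornerZ hornerM !gpolyE mulN1r mul1r mulrA.
have top k : (k <= n)%N -> (size (gpoly n%:R (-1) k * gpoly n%:R 1 (n - k))%R <= n.+1)%N /\
    (gpoly n%:R (-1) k * gpoly n%:R 1 (n - k))`_n = (-1) ^+ k / k`!%:R / (n - k)`!%:R.
  move=> kn; have [h1 h2] := gpoly_top n%:R (-1) k.
  have [h3 h4] := gpoly_top n%:R 1 (n - k).
  have [] := coefM_top h1 h3; rewrite subnKC // h2 h4 expr1n => ? ->; split=> //.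
  by rewrite mul1r.
have sq : (size q <= n.+1)%N.
  apply: (leq_trans (size_sum _ _ _)); apply/bigmax_leqP => k _.
  by apply: (leq_trans (size_scale_leq _ _)); have [] := top k _; rewrite -ltnS.
have qn : q`_n = 2%:R ^+ n / n`!%:R.
  apply: (canRL (mulfK (fact_neq0 n))).
  have -> : (2%:R : rat) ^+ n = \sum_(k < n.+1) 'C(n, k)%:R.
    by rewrite -[2%:R]/(1 + 1) exprDn; apply: eq_bigr => k _; rewrite !expr1n mul1r.
  rewrite /q coef_sum mulr_suml; apply: eq_bigr => k _.
  have kn : (k <= n)%N by rewrite -ltnS.
  have [_ e] := top k kn; rewrite coefZ e -(bin_fact kn) !natrM.
  have := fact_neq0 k; have := fact_neq0 (n - k) => f1 f2.
  transitivity ((-1) ^+ k * ((-1) ^+ k * 'C(n, k)%:R) : rat); last exact: signrMK.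
  by field; rewrite f1 f2.
pose rs : seq rat := [seq n%:R - (j.*2.+1)%:R | j <- iota 0 n].
have q0 : q`_n != 0 by rewrite qn mulf_neq0 ?invr_eq0 ?fact_neq0 ?expf_neq0.
have szq : size q = n.+1.
  apply/eqP; rewrite eqn_leq sq ltnNge; apply: contraNN q0 => h.
  by rewrite nth_default.
have qP : q = lead_coef q *: \prod_(z <- rs) ('X - z%:P).
  apply: all_roots_prod_XsubC; first by rewrite szq size_map size_iota.
    apply/allP=> z /mapP [j]; rewrite mem_iota add0n /= => jn ->; rewrite /root qE.
    have -> : n%:R - (n%:R - (j.*2.+1)%:R) = (j.*2.+1)%:R :> rat by ring.
    have -> : n%:R + (n%:R - (j.*2.+1)%:R) = (n.*2 - j.*2.+1)%:R :> rat.
      by rewrite natrB; [rewrite -[n.*2]addnn natrD; ring | lia].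
    by rewrite Phi_anti //=; [rewrite /n; lia | rewrite odd_double].
  rewrite uniq_rootsE map_inj_uniq ?iota_uniq // => i j /addrI /oppr_inj /eqP.
  by rewrite eqr_nat => /eqP; lia.
have := qE (4 * m + 1)%:R.
have -> : n%:R - (4 * m + 1)%:R = - (n.+1)%:R :> rat.
  have -> : (4 * m + 1 = n + n.+1)%N by rewrite /n; lia.
  by rewrite natrD; ring.
have -> : n%:R + (4 * m + 1)%:R = (6 * m + 1)%:R :> rat by rewrite -natrD; congr _%:R; rewrite /n; lia.
move=> <-; rewrite qP lead_coefE szq /= qn hornerZ horner_prod big_map.
have -> : \prod_(j <- iota 0 n) ('X - (n%:R - (j.*2.+1)%:R)%:P).[(4 * m + 1)%:R]
    = \prod_(j <- iota 0 n) (2%:R * (m.+1 + j)%:R) :> rat.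
  apply: eq_big_seq => j; rewrite mem_iota => /andP [_ jn].
  rewrite hornerXsubC opprB addrA -natrD -natrM.
  apply: (canLR (addrK _)); rewrite -natrD; congr _%:R; rewrite /n; lia.
have pr N : \prod_(j <- iota 0 N) (2%:R * (m.+1 + j)%:R) = 2%:R ^+ N * ((m + N)`!%:R / m`!%:R) :> rat.
  elim: N => [|N ih]; first by rewrite big_nil addn0 divff ?fact_neq0 ?mulr1.
  rewrite -addn1 iotaD big_cat /= ih big_seq1 add0n addn1 addnS factS exprS natrM addSn; ring.
rewrite pr; have -> : (m + n = 3 * m)%N by rewrite /n; lia.
have h : (m <= 3 * m)%N by lia.
have := congr1 (fun t => t%:R : rat) (bin_fact h).
have -> : (3 * m - m = n)%N by rewrite /n; lia.
rewrite !natrM => <-.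
have -> : (16%:R : rat) ^+ m = 2%:R ^+ n * 2%:R ^+ n.
  have -> : (16%:R : rat) = 2%:R ^+ 4 by ring.
  by rewrite -exprD /n -addnn -exprM; congr (_ ^+ _); lia.
by field; rewrite !fact_neq0.
Qed.

(** * Interpolation modulo p^3 *)

Section QuadraticTaylor.
Variable p : nat.
Hypothesis p_pr : prime p.
Hypothesis p_odd : odd p.

Definition quad_val (a b c d e g : rat) (i j : int) : rat :=
  a + p%:R * (b * i%:~R + c * j%:~R)
    + p%:R ^+ 2 * (d * i%:~R ^+ 2 + e * i%:~R * j%:~R + g * j%:~R ^+ 2).

Definition quad (f : int -> int -> rat) : Prop :=
  exists a b c d e g, [/\ pint p a, pint p b, pint p c & [/\ pint p d, pint p e & pint p g]] /\
    forall i j, eqm p 3 (f i j) (quad_val a b c d e g i j).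

Lemma pint_quad_val a b c d e g i j : pint p a -> pint p b -> pint p c ->
  pint p d -> pint p e -> pint p g -> pint p (quad_val a b c d e g i j).
Proof. by move=> *; rewrite /quad_val; pint_tac. Qed.

Lemma quad_const x : pint p x -> quad (fun _ _ => x).
Proof.
move=> px; exists x, 0, 0, 0, 0, 0; split; first by split=> //; [exact: pint0 | exact: pint0 | split; exact: pint0].
by move=> i j; apply: eqm_eq; rewrite /quad_val; ring.
Qed.

Lemma quad_left x : pint p x -> quad (fun i _ => x + i%:~R * p%:R).
Proof.
move=> px; exists x, 1, 0, 0, 0, 0; split.
  by split=> //; [exact: pint1 | exact: pint0 | split; exact: pint0].
by move=> i j; apply: eqm_eq; rewrite /quad_val; ring.
Qed.

Lemma quad_right x : pint p x -> quad (fun _ j => x + j%:~R * p%:R).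
Proof.
move=> px; exists x, 0, 1, 0, 0, 0; split.
  by split=> //; [exact: pint0 | exact: pint1 | split; exact: pint0].
by move=> i j; apply: eqm_eq; rewrite /quad_val; ring.
Qed.

Lemma quadD f1 f2 : quad f1 -> quad f2 -> quad (fun i j => f1 i j + f2 i j).
Proof.
case=> a [b [c [d [e [g [[pa pb pc [pd pe pg]] h]]]]]].
case=> a' [b' [c' [d' [e' [g' [[pa' pb' pc' [pd' pe' pg']] h']]]]]].
exists (a + a'), (b + b'), (c + c'), (d + d'), (e + e'), (g + g'); split.
  by split; [| | | split]; apply: pintD.
move=> i j; apply: (eqm_trans (eqmD (h i j) (h' i j))).
by apply: eqm_eq; rewrite /quad_val; ring.
Qed.

Lemma quadM f1 f2 : quad f1 -> quad f2 -> quad (fun i j => f1 i j * f2 i j).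
Proof.
case=> a [b [c [d [e [g [[pa pb pc [pd pe pg]] h]]]]]].
case=> a' [b' [c' [d' [e' [g' [[pa' pb' pc' [pd' pe' pg']] h']]]]]].
exists (a * a'), (a * b' + a' * b), (a * c' + a' * c), (a * d' + a' * d + b * b'),
  (a * e' + a' * e + b * c' + b' * c), (a * g' + a' * g + c * c'); split.
  by split; [| | | split]; pint_tac.
move=> i j.
have pv := @pint_quad_val a b c d e g i j pa pb pc pd pe pg.
have pv' := @pint_quad_val a' b' c' d' e' g' i j pa' pb' pc' pd' pe' pg'.
apply: (eqm_trans (eqmM (h i j) (h' i j) (eqm_pint (h i j) pv) pv')).
set B := b * i%:~R + c * j%:~R; set B' := b' * i%:~R + c' * j%:~R.
set C := d * i%:~R ^+ 2 + e * i%:~R * j%:~R + g * j%:~R ^+ 2.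
set C' := d' * i%:~R ^+ 2 + e' * i%:~R * j%:~R + g' * j%:~R ^+ 2.
have pB : pint p B by rewrite /B; pint_tac.
have pB' : pint p B' by rewrite /B'; pint_tac.
have pC : pint p C by rewrite /C; pint_tac.
have pC' : pint p C' by rewrite /C'; pint_tac.
exists (B * C' + C * B' + p%:R * (C * C')); first by pint_tac.
by rewrite /quad_val /B /B' /C /C'; ring.
Qed.

Lemma quad_sum (I : Type) (r : seq I) (F : I -> int -> int -> rat) :
  (forall k, quad (F k)) -> quad (fun i j => \sum_(k <- r) F k i j).
Proof.
move=> h; elim: r => [|k r ih].
  have [a [b [c [d [e [g [pp hv]]]]]]] := quad_const (pint0 p).
  exists a, b, c, d, e, g; split=> // i j; rewrite big_nil; exact: hv.
have [a [b [c [d [e [g [pp hv]]]]]]] := quadD (h k) ih.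
exists a, b, c, d, e, g; split=> // i j; rewrite big_cons; exact: hv.
Qed.

Lemma quad_prod (I : Type) (r : seq I) (F : I -> int -> int -> rat) :
  (forall k, quad (F k)) -> quad (fun i j => \prod_(k <- r) F k i j).
Proof.
move=> h; elim: r => [|k r ih].
  have [a [b [c [d [e [g [pp hv]]]]]]] := quad_const (pint1 p).
  exists a, b, c, d, e, g; split=> // i j; rewrite big_nil; exact: hv.
have [a [b [c [d [e [g [pp hv]]]]]]] := quadM (h k) ih.
exists a, b, c, d, e, g; split=> // i j; rewrite big_cons; exact: hv.
Qed.

Lemma quad_ext f1 f2 : (forall i j, f1 i j = f2 i j) -> quad f1 -> quad f2.
Proof.
move=> e [a [b [c [d [e' [g [pp hv]]]]]]].
by exists a, b, c, d, e', g; split=> // i j; rewrite -e.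
Qed.

Lemma coprime_fact k : (k < p)%N -> coprime k`! p.
Proof.
elim: k => [|k ih] kp; first by rewrite coprime1n.
by rewrite factS coprimeMl ih ?(ltnW kp) // andbT coprime_lt.
Qed.

Lemma pint_factV k : (k < p)%N -> pint p (k`!%:R)^-1.
Proof. by move=> kp; apply: pintV => //; apply: coprime_fact. Qed.

Lemma quad_Phi n : (n < p)%N ->
  quad (fun i j => Phi n (n%:R + i%:~R * p%:R) (n%:R + j%:~R * p%:R)).
Proof.
move=> np; apply: quad_sum => k.
have kp : (k < p)%N by apply: leq_trans np; apply: ltn_ord.
have nkp : (n - k < p)%N by apply: leq_ltn_trans np; apply: leq_subr.
apply: quadM; first apply: quadM; first by apply/quad_const; apply/pintX/pintN/pint1.
  apply: quadM; last by apply/quad_const/pint_factV.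
  apply: quad_prod => r; apply: (@quad_ext (fun i _ => n%:R - r%:R + i%:~R * p%:R)).
    by move=> i j; ring.
  by apply: quad_left; pint_tac.
apply: quadM; last by apply/quad_const/pint_factV.
apply: quad_prod => r; apply: (@quad_ext (fun _ j => n%:R - r%:R + j%:~R * p%:R)).
  by move=> i j; ring.
by apply: quad_right; pint_tac.
Qed.

(** A symmetric quadratic expansion in i and j has four free coefficients: constant, i + j, i^2 +
    j^2 and i j. The diagonal points 0, 1, 2 and the point (-1, 1) determine them; the constants
    come from solving this linear system. *)
Lemma quad_sym_interp f : quad f -> (forall i j, f i j = f j i) ->
  [/\ eqm p 3 (8%:R * f (-1) 0) (13%:R * f 0 0 - 10%:R * f 1 1 + 3%:R * f 2 2 + 2%:R * f (-1) 1),
      eqm p 3 (8%:R * f (-3) 0) (17%:R * f 0 0 - 42%:R * f 1 1 + 15%:R * f 2 2 + 18%:R * f (-1) 1)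
    & eqm p 3 (8%:R * f (-3) 2) (- 35%:R * f 0 0 - 10%:R * f 1 1 + 3%:R * f 2 2 + 50%:R * f (-1) 1)].
Proof.
case=> a [b [c [d [e [g [[pa pb pc [pd pe pg]] h]]]]]] sym.
have c2 : coprime 2 p by rewrite coprime2n.
have main x y r s t v : let q := quad_val a b c d e g in
   8%:R * (q x y + q y x) = 2%:R * (r * q 0 0 + s * q 1 1 + t * q 2 2) + v * (q (-1) 1 + q 1 (-1)) ->
   pint p r -> pint p s -> pint p t -> pint p v ->
   eqm p 3 (8%:R * f x y) (r * f 0 0 + s * f 1 1 + t * f 2 2 + v * f (-1) 1).
  move=> q eq pr ps pt pv; apply: (eqm_cancel p_pr c2).
  apply: (@eqm_trans _ _ (8%:R * (f x y + f y x))); first by rewrite (sym y x); apply: eqm_eq; ring.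
  apply: (@eqm_trans _ _ (8%:R * (q x y + q y x))).
    by apply: eqm_mull; [exact: pint_nat | apply: eqmD].
  rewrite eq; apply: eqm_sym.
  have -> : 2%:R * (r * f 0 0 + s * f 1 1 + t * f 2 2 + v * f (-1) 1) =
    2%:R * (r * f 0 0 + s * f 1 1 + t * f 2 2) + v * (f (-1) 1 + f 1 (-1)).
    by rewrite (sym 1 (-1)); ring.
  apply: eqmD; last by apply: eqm_mull => //; apply: eqmD.
  by apply: eqm_mull; [exact: pint_nat | do 2?apply: eqmD; apply: eqm_mull].
split.
- have -> : 13%:R * f 0 0 - 10%:R * f 1 1 + 3%:R * f 2 2 + 2%:R * f (-1) 1 =
    13%:R * f 0 0 + (- 10%:R) * f 1 1 + 3%:R * f 2 2 + 2%:R * f (-1) 1 by ring.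
  by apply: main; [rewrite /quad_val; ring | pint_tac..].
- have -> : 17%:R * f 0 0 - 42%:R * f 1 1 + 15%:R * f 2 2 + 18%:R * f (-1) 1 =
    17%:R * f 0 0 + (- 42%:R) * f 1 1 + 15%:R * f 2 2 + 18%:R * f (-1) 1 by ring.
  by apply: main; [rewrite /quad_val; ring | pint_tac..].
have -> : - 35%:R * f 0 0 - 10%:R * f 1 1 + 3%:R * f 2 2 + 50%:R * f (-1) 1 =
    (- 35%:R) * f 0 0 + (- 10%:R) * f 1 1 + 3%:R * f 2 2 + 50%:R * f (-1) 1 by ring.
by apply: main; [rewrite /quad_val; ring | pint_tac..].
Qed.
End QuadraticTaylor.

(** * Shifted Legendre polynomials and interpolation of the coefficients [u k] *)

Definition acoef (N k : nat) : rat := (-1) ^+ k * ('C(N, k) * 'C(N + k, k))%:R.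

(** The Legendre polynomial of degree N at 1 - 2X. *)
Definition legp (N : nat) : {poly rat} := \sum_(k < N.+1) acoef N k *: 'X^k.

(** In this basis the exchange of X and 1 - X is a reversal of the sum, which proves [legp_flip]. *)
Lemma legp_bernstein N :
  legp N = \sum_(j < N.+1) ('C(N, j) * 'C(N, j))%:R * (- 'X) ^+ j * (1 - 'X) ^+ (N - j).
Proof.
have -> : legp N = \sum_(k < N.+1) \sum_(j < N.+1) ('C(N, j))%:R * (('C(N, k) * 'C(k, j))%:R * (- 'X) ^+ k).
  apply: eq_bigr => k _; have kN : (k <= N)%N by rewrite -ltnS.
  have cNk : 'C(N + k, k) = (\sum_(j < N.+1) 'C(N, j) * 'C(k, j))%N.
    rewrite bin_add_sym (big_ord_widen N.+1 (fun j => 'C(N, j) * 'C(k, j))%N) ?ltnS //.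
    rewrite big_mkcond /=; apply: eq_bigr => j _; case: ltnP => // kj.
    by rewrite (@bin_small k) ?muln0.
  rewrite /acoef cNk natrM natr_sum mulrA mulr_sumr scaler_suml; apply: eq_bigr => j _.
  rewrite [(- 'X) ^+ k]exprNn -mul_polyC -(rmorph_sign (@polyC rat)).
  by rewrite !natrM !polyCM !polyC_natr; ring.
rewrite exchange_big /=; apply: eq_bigr => j _.
have jN : (j <= N)%N by rewrite -ltnS.
by rewrite -mulr_sumr (bin_weighted_sum (- 'X) jN) natrM; ring.
Qed.

Lemma legp_flip N : legp N \Po (1 - 'X) = (-1) ^+ N *: legp N.
Proof.
rewrite !legp_bernstein raddf_sum scaler_sumr (reindex_inj rev_ord_inj) /=.
apply: eq_bigr => j _; have jN : (j <= N)%N by rewrite -ltnS.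
rewrite subSS bin_sub // subKn //.
rewrite !comp_polyM !rmorphXn /= comp_polyN !(comp_nat, comp_polyB, comp_polyX, comp_one).
have -> : (1 - (1 - 'X)) = 'X :> {poly rat} by ring.
have -> : (- (1 - 'X)) ^+ (N - j) = (-1) ^+ N * (-1) ^+ j * (1 - 'X) ^+ (N - j) :> {poly rat}.
  by rewrite exprNn -signr_odd oddB // signr_addb !signr_odd.
rewrite [(- 'X) ^+ j]exprNn -mul_polyC (rmorph_sign (@polyC rat)); ring.
Qed.

(* [t = 0] gives [u k], and [t = (2N + 1) ^ 2] gives [acoef N k]; here [t = p ^ 2] for
   [N = n] and [t = 9 p ^ 2] for [N = n + p], whence the interpolation [u_interp]. *)
Definition ecoef (t : rat) (k : nat) : rat :=
  (\prod_(j < k) ((j.*2.+1)%:R ^+ 2 - t)) / (4%:R ^+ k * k`!%:R ^+ 2).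

Lemma ecoef0 t : ecoef t 0 = 1.
Proof. by rewrite /ecoef big_ord0 fact0 expr0; field. Qed.

Lemma ecoefS t k : ecoef t k.+1 = ecoef t k * (((k.*2.+1)%:R ^+ 2 - t) / (4%:R * k.+1%:R ^+ 2)).
Proof.
rewrite /ecoef big_ord_recr /= factS natrM [4%:R ^+ k.+1]exprS.
have f4 : (4%:R : rat) ^+ k != 0 by rewrite expf_neq0.
have fk := fact_neq0 k; have k1 : k.+1%:R != 0 :> rat by rewrite pnatr_eq0.
by field; rewrite fk f4 addrC natr1 k1.
Qed.

Lemma u_ecoef k : u k = ecoef 0 k.
Proof.
elim: k => [|k ih]; first by rewrite u0 ecoef0.
rewrite ecoefS -ih subr0; have := uS k; rewrite natrM.
have k1 : k.+1%:R != 0 :> rat by rewrite pnatr_eq0.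
move=> e; apply: (@mulfI _ ((2%:R * k.+1%:R) ^+ 2)); first by rewrite expf_neq0 // mulf_neq0.
by rewrite e; field; rewrite addrC natr1.
Qed.

Lemma acoef_ecoef N k : acoef N k = ecoef ((N.*2.+1)%:R ^+ 2) k.
Proof.
elim: k => [|k ih]; first by rewrite /acoef ecoef0 !bin0 expr0 mulr1.
rewrite ecoefS -ih /acoef.
have k1 : k.+1%:R != 0 :> rat by rewrite pnatr_eq0.
have e1 : k.+1%:R * 'C(N, k.+1)%:R = (N%:R - k%:R) * 'C(N, k)%:R :> rat.
  have [kN|Nk] := leqP k N; last by rewrite !bin_small ?mulr0 //; lia.
  by rewrite -natrB // -!natrM mul_bin_left.
have e2 : k.+1%:R * 'C(N + k.+1, k.+1)%:R = (N + k).+1%:R * 'C(N + k, k)%:R :> rat.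
  by rewrite -!natrM addnS -mul_bin_diag.
apply: (@mulfI _ (k.+1%:R ^+ 2)); first by rewrite expf_neq0.
rewrite [(-1) ^+ k.+1]exprS !natrM.
transitivity (- (-1) ^+ k * (k.+1%:R * 'C(N, k.+1)%:R) * (k.+1%:R * 'C(N + k.+1, k.+1)%:R) : rat).
  ring.
rewrite e1 e2 -![_.+1%:R]natr1 natrD -!muln2 !natrM.
by field; rewrite natr1.
Qed.

Section Interpolation.
Variables p n : nat.
Hypothesis p_pr : prime p.
Hypothesis ep : p = n.*2.+1.

Let p_odd : odd p. Proof. by rewrite ep /= odd_double. Qed.
Let c2 : coprime 2 p. Proof. by rewrite coprime2n. Qed.

Lemma ecoef_taylor k : (k < p)%N -> exists a b, [/\ pint p a, pint p b &
  forall y, pint p y -> eqm p 3 (ecoef (p%:R ^+ 2 * y) k) (a + p%:R ^+ 2 * y * b)].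
Proof.
elim: k => [|k ih] kp.
  exists 1, 0; split; [exact: pint1 | exact: pint0 |].
  by move=> y _; rewrite ecoef0 mulr0 addr0; apply: eqm_refl.
have [a [b [pa pb h]]] := ih (ltnW kp).
pose s : rat := (4%:R * k.+1%:R ^+ 2)^-1.
have ps : pint p s.
  rewrite /s -natrX -natrM; apply: pintV => //.
  by rewrite coprimeMl coprimeXl ?(@coprimeXl 2 2) // coprime_lt.
pose c : rat := (k.*2.+1)%:R ^+ 2.
have pc : pint p c by rewrite /c; pint_tac.
exists (a * c * s), ((b * c - a) * s); split; [by pint_tac.. |].
move=> y py; rewrite ecoefS -/c -/s.
apply: (@eqm_trans _ _ ((a + p%:R ^+ 2 * y * b) * ((c - p%:R ^+ 2 * y) * s))).
  by apply: eqm_mulr; [pint_tac | exact: h].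
exists (- (p%:R * y ^+ 2 * b * s)); first by pint_tac.
ring.
Qed.

(** The weights are those of the linear extrapolation f(0) = (9 f(1) - f(9)) / 8 in the variable t /
    p^2. *)
Lemma u_interp k : (k < p)%N ->
  eqm p 3 (8%:R * u k) (9%:R * acoef n k - acoef (n + p) k).
Proof.
move=> kp; have [a [b [pa pb h]]] := ecoef_taylor kp.
have h0 := h 0 (pint0 p); have h1 := h 1 (pint1 p); have h9 := h 9%:R (pint_nat p 9).
rewrite !acoef_ecoef u_ecoef -ep.
have -> : ((n + p).*2.+1)%:R = 3%:R * p%:R :> rat by rewrite -natrM; congr _%:R; rewrite ep; lia.
rewrite mulr0 in h0; rewrite mulr1 in h1.
have -> : (3%:R * p%:R) ^+ 2 = p%:R ^+ 2 * 9%:R :> rat by ring.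
apply: (eqm_trans (eqm_mull (pint_nat p 8) h0)); apply: eqm_sym.
apply: (eqm_trans (eqmD (eqm_mull (pint_nat p 9) h1) (eqmN h9))).
by apply: eqm_eq; ring.
Qed.

Lemma u_acoef k : (k < p)%N -> eqm p 2 (u k) (acoef n k).
Proof.
move=> kp; have [a [b [pa pb h]]] := ecoef_taylor kp.
have h0 := eqm_leq (isT : 2 <= 3)%N (h 0 (pint0 p)); have h1 := eqm_leq (isT : 2 <= 3)%N (h 1 (pint1 p)).
rewrite acoef_ecoef u_ecoef -ep; rewrite mulr0 in h0; rewrite mulr1 in h1.
apply: (eqm_trans h0); apply: eqm_sym; apply: (eqm_trans h1).
by exists b => //; ring.
Qed.

Lemma pint_u k : pint p (u k).
Proof.
apply: pintX; rewrite -natrX; apply: (pint_div p_pr); last exact: pint_nat.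
by rewrite coprimeXl // (@coprimeXl 2 2).
Qed.
End Interpolation.


(** * Reduction of p-integral rationals to the prime field *)

Section Reduction.
Variable p : nat.
Hypothesis p_pr : prime p.

Definition red (x : rat) : 'F_p := (numq x)%:~R / (denq x)%:~R.

Lemma coprime_Fp d : coprime d p -> d%:R != 0 :> 'F_p.
Proof. by move=> cd; rewrite -(dvdn_pcharf (pchar_Fp p_pr)) -prime_coprime // coprime_sym. Qed.

Lemma redE x (d : nat) (a : int) : coprime d p -> x * d%:R = a%:~R -> red x = a%:~R / d%:R.
Proof.
move=> cd xd; have px : pint p x by exists d, a.
have d0 := coprime_Fp cd; have e0 := coprime_Fp (pint_denq px).
have eden : (denq x)%:~R = `|denq x|%:R :> 'F_p by rewrite -{1}(gez0_abs (denq_ge0 x)).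
rewrite /red eden; apply/eqP; rewrite eqr_div // -eden; apply/eqP.
have -> : d%:R = (d%:Z)%:~R :> 'F_p by [].
rewrite -!intrM; congr _%:~R; apply: (@intr_inj rat).
by rewrite !intrM numqE -xd; ring.
Qed.

Lemma red_int (a : int) : red a%:~R = a%:~R.
Proof. by rewrite (@redE _ 1 a) ?coprime1n ?mulr1 // divr1. Qed.

Lemma red_nat (a : nat) : red a%:R = a%:R.
Proof. by rewrite (red_int a). Qed.

Lemma redD x y : pint p x -> pint p y -> red (x + y) = red x + red y.
Proof.
case=> d [a [cd xd]] [e [b [ce ye]]].
rewrite (redE cd xd) (redE ce ye) (@redE _ (d * e) (a * e%:Z + b * d%:Z)).
- by rewrite natrM intrD !intrM; field; rewrite !coprime_Fp.
- by rewrite coprimeMl cd.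
by rewrite natrM intrD !intrM -xd -ye; ring.
Qed.

Lemma redM x y : pint p x -> pint p y -> red (x * y) = red x * red y.
Proof.
case=> d [a [cd xd]] [e [b [ce ye]]].
rewrite (redE cd xd) (redE ce ye) (@redE _ (d * e) (a * b)).
- by rewrite natrM intrM; field; rewrite !coprime_Fp.
- by rewrite coprimeMl cd.
by rewrite natrM intrM -xd -ye; ring.
Qed.

Lemma redN x : pint p x -> red (- x) = - red x.
Proof.
by move=> px; rewrite -mulN1r (redM (pintN (pint1 p)) px) (red_int (-1)) mulN1r.
Qed.

Lemma redX x k : pint p x -> red (x ^+ k) = red x ^+ k.
Proof.
move=> px; elim: k => [|k ih]; first by rewrite !expr0 (red_nat 1).
by rewrite !exprS redM ?ih //; apply: pintX.
Qed.

Lemma redV (d : nat) : coprime d p -> red d%:R^-1 = d%:R^-1.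
Proof.
by move=> cd; rewrite (@redE _ d 1) ?mul1r // mulVf // (coprime_neq0 p_pr).
Qed.

Lemma red_sum (I : Type) (r : seq I) (P : pred I) (F : I -> rat) :
  (forall i, P i -> pint p (F i)) -> red (\sum_(i <- r | P i) F i) = \sum_(i <- r | P i) red (F i).
Proof.
move=> h; suff [] : pint p (\sum_(i <- r | P i) F i) /\
  red (\sum_(i <- r | P i) F i) = \sum_(i <- r | P i) red (F i) by [].
elim/big_rec2: _ => [|i x y Pi [py e]]; first by split; [exact: pint0 | exact: (red_nat 0)].
split; first exact: pintD (h i Pi) py.
by rewrite redD ?e //; apply: h.
Qed.

Lemma eqm_red x y : pint p x -> pint p y -> red x = red y -> eqm p 1 x y.
Proof.
move=> px py e; have : red (x - y) = 0 by rewrite redD ?redN ?e ?subrr //; apply: pintN.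
case: (pintD px (pintN py)) => d [a [cd xd]].
rewrite (redE cd xd) => /eqP; rewrite mulf_eq0 invr_eq0 (negPf (coprime_Fp cd)) orbF.
rewrite intr_Fp_eq0 // => /dvdzP [k ek].
exists (k%:~R / d%:R); first by apply: pint_div => //; exact: pint_int.
have d0 := coprime_neq0 p_pr cd.
by rewrite expr1 mulrA; apply: (canRL (mulfK d0)); rewrite xd ek intrM mulrC.
Qed.

Lemma red_eqm x y : pint p y -> eqm p 1 x y -> red x = red y.
Proof.
move=> py [z pz e]; have -> : x = y + p%:R * z by rewrite -[p%:R * z]e; ring.
rewrite redD ?redM ?red_nat //; [|exact: pint_nat|by apply: pintM => //; exact: pint_nat].
by rewrite (pcharf0 (pchar_Fp p_pr)) mul0r addr0.
Qed.
End Reduction.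

(** * Harmonic sums *)

Definition H1 (n : nat) : rat := \sum_(k < n) k.+1%:R^-1.
Definition H2 (n : nat) : rat := \sum_(k < n) k.+1%:R^-1 ^+ 2.

Section ProductExpansions.
Variable p : nat.
Hypothesis p_pr : prime p.

(** The factor 2 avoids a division: the coefficient of second order is half of the square of the sum
    minus the sum of squares. *)
Lemma prod_taylor3 (I : Type) (r : seq I) (P : pred I) (F : I -> rat) x :
  (forall i, P i -> pint p (F i)) -> pint p x ->
  eqm p 3 (2%:R * \prod_(i <- r | P i) (1 + x * p%:R * F i))
    (2%:R + 2%:R * x * p%:R * (\sum_(i <- r | P i) F i)
      + x ^+ 2 * p%:R ^+ 2 * ((\sum_(i <- r | P i) F i) ^+ 2 - \sum_(i <- r | P i) F i ^+ 2)).
Proof.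
move=> hF px.
suff [] : [/\ pint p (\sum_(i <- r | P i) F i), pint p (\sum_(i <- r | P i) F i ^+ 2)
  & eqm p 3 (2%:R * \prod_(i <- r | P i) (1 + x * p%:R * F i))
    (2%:R + 2%:R * x * p%:R * (\sum_(i <- r | P i) F i)
      + x ^+ 2 * p%:R ^+ 2 * ((\sum_(i <- r | P i) F i) ^+ 2 - \sum_(i <- r | P i) F i ^+ 2))] by [].
elim/big_rec3: _ => [|i s2 s1 w Pi [p1 p2 e]].
  by split; [exact: pint0 | exact: pint0 | apply: eqm_eq; ring].
have pf := hF i Pi; split; [by pint_tac.. |].
have -> : 2%:R * ((1 + x * p%:R * F i) * w) = (1 + x * p%:R * F i) * (2%:R * w) by ring.
apply: (eqm_trans (eqm_mull _ e)); first by pint_tac.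
exists (x ^+ 3 * F i * (s1 ^+ 2 - s2)); first by pint_tac.
ring.
Qed.

Lemma prod_taylor2 (I : Type) (r : seq I) (P : pred I) (F : I -> rat) x :
  (forall i, P i -> pint p (F i)) -> pint p x ->
  eqm p 2 (\prod_(i <- r | P i) (1 + x * p%:R * F i)) (1 + x * p%:R * (\sum_(i <- r | P i) F i)).
Proof.
move=> hF px.
suff [] : pint p (\sum_(i <- r | P i) F i) /\
  eqm p 2 (\prod_(i <- r | P i) (1 + x * p%:R * F i)) (1 + x * p%:R * (\sum_(i <- r | P i) F i)) by [].
elim/big_rec2: _ => [|i s1 w Pi [p1 e]].
  by split; [exact: pint0 | apply: eqm_eq; ring].
have pf := hF i Pi; split; first by pint_tac.
apply: (eqm_trans (eqm_mull _ e)); first by pint_tac.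
exists (x ^+ 2 * F i * s1); first by pint_tac.
ring.
Qed.

Lemma prod_taylor1 (I : Type) (r : seq I) (P : pred I) (F : I -> rat) x :
  (forall i, P i -> pint p (F i)) -> pint p x ->
  eqm p 1 (\prod_(i <- r | P i) (1 + x * p%:R * F i)) 1.
Proof.
move=> hF px; apply: (eqm_trans (eqm_leq (isT : 1 <= 2)%N (prod_taylor2 r hF px))).
exists (x * (\sum_(i <- r | P i) F i)); last by ring.
by apply: pintM => //; apply: pint_sum.
Qed.

Lemma bin_pred_prod k : (k < p)%N ->
  'C(p.-1, k)%:R = (-1) ^+ k * \prod_(j < k) (1 + (-1) * p%:R * j.+1%:R^-1) :> rat.
Proof.
elim: k => [|k ih] kp; first by rewrite bin0 big_ord0 mulr1.
have k1 : k.+1%:R != 0 :> rat by rewrite pnatr_eq0.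
apply: (mulfI k1); rewrite -natrM mul_bin_left natrM ih ?(ltnW kp) // big_ord_recr /=.
have -> : (p.-1 - k)%:R = p%:R - k.+1%:R :> rat.
  by rewrite -natrB; [congr _%:R; lia | lia].
by rewrite [(-1) ^+ k.+1]exprS; field; rewrite addrC natr1.
Qed.

Lemma pint_invS k : (k.+1 < p)%N -> pint p k.+1%:R^-1.
Proof. by move=> kp; apply: pintV_lt. Qed.

Lemma bin_pred_modp k : (k < p)%N -> eqm p 1 'C(p.-1, k)%:R ((-1) ^+ k).
Proof.
move=> kp; rewrite bin_pred_prod //.
rewrite -[X in eqm _ _ _ X]mulr1; apply: eqm_mull; first by pint_tac.
apply: prod_taylor1; last by pint_tac.
by move=> i _; apply: pint_invS; apply: leq_ltn_trans kp.
Qed.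

Lemma natFp_bij : bijective (fun i : 'I_p => (i%:R : 'F_p)).
Proof.
apply: inj_card_bij; last by rewrite card_Fp // card_ord.
move=> i j /(congr1 val); rewrite /= !val_Fp_nat // !modn_small // => e.
exact/val_inj.
Qed.

Lemma sum_natFp (f : 'F_p -> 'F_p) : \sum_(k < p) f k%:R = \sum_a f a.
Proof. by rewrite (reindex _ (onW_bij _ natFp_bij)). Qed.
End ProductExpansions.

Section HarmonicSums.
Variables p n : nat.
Hypothesis p_pr : prime p.
Hypothesis p_gt3 : (3 < p)%N.
Hypothesis ep : p = n.*2.+1.

(** Modulo p this is the sum of a^-2 over the nonzero residues. Replacing a by 2a shows that four
    times it equals itself, and 3 is invertible. *)
Lemma H2_predp : eqm p 1 (H2 p.-1) 0.
Proof.
have pint_F (k : 'I_p.-1) : pint p k.+1%:R^-1.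
  by apply: pint_invS => //; have := ltn_ord k; lia.
apply: (eqm_red p_pr); [by apply: pint_sum => k _; apply: pintX | exact: pint0 |].
rewrite (red_nat p_pr 0) /H2 red_sum // => [|k _]; last exact: pintX.
have -> : \sum_(k < p.-1) red p (k.+1%:R^-1 ^+ 2) = \sum_(k < p) (k%:R^-1 : 'F_p) ^+ 2.
  have E N : N = p -> \sum_(k < N) (k%:R^-1 : 'F_p) ^+ 2 = \sum_(k < p) (k%:R^-1 : 'F_p) ^+ 2 by move=> ->.
  rewrite -(E p.-1.+1 (prednK (prime_gt0 p_pr))) big_ord_recl /= invr0 expr0n /= add0r.
  apply: eq_bigr => k _; rewrite redX // redV //.
  by apply: coprime_lt => //; have := ltn_ord k; lia.
rewrite (sum_natFp p_pr (fun a => a^-1 ^+ 2)); set S := \sum_a _.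
have nz d : (0 < d < p)%N -> d%:R != 0 :> 'F_p by move=> h; apply/coprime_Fp/coprime_lt.
have n2 : (2%:R : 'F_p) != 0 by apply: nz; lia.
have n3 : (3%:R : 'F_p) != 0 by apply: nz; lia.
have : 4%:R * S = S.
  rewrite {1}/S (reindex_inj (mulfI n2)) mulr_sumr /=; apply: eq_bigr => a _.
  by rewrite invfM exprMn mulrA (_ : 4%:R * 2%:R^-1 ^+ 2 = 1) ?mul1r //; field.
move=> e; apply: (mulfI n3); rewrite mulr0.
have -> : 3%:R * S = 4%:R * S - S by ring.
by rewrite e subrr.
Qed.

Lemma H2_half : eqm p 1 (H2 n) 0.
Proof.
have c2 : coprime 2 p by rewrite coprime2n ep /= odd_double.
apply: (eqm_cancel p_pr c2); rewrite mulr0.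
apply: eqm_trans H2_predp; apply: eqm_sym.
have e1 : p.-1 = (n + n)%N by lia.
rewrite /H2 e1 big_split_ord /= -/(H2 n) mulr_natl mulr2n; apply: eqmD; first exact: eqm_refl.
rewrite /H2 (reindex_inj rev_ord_inj) /=; apply: eqm_sum => k _.
have kn := ltn_ord k.
have h1 : pint p k.+1%:R^-1 by apply: pint_invS => //; lia.
have h2 : pint p (n + (n - k.+1)).+1%:R^-1 by apply: pint_invS => //; lia.
have e2 : (n + (n - k.+1)).+1%:R = p%:R - k.+1%:R :> rat.
  by rewrite -natrB; [congr _%:R; lia | lia].
have k0 : k.+1%:R != 0 :> rat by rewrite pnatr_eq0.
have k1 : (n + (n - k.+1)).+1%:R != 0 :> rat by rewrite pnatr_eq0.
rewrite e2 in h2 k1 *.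
exists ((2%:R * k.+1%:R - p%:R) * ((k.+1%:R)^-1 ^+ 2 * ((p%:R - k.+1%:R)^-1) ^+ 2)); first by pint_tac.
by move: k0 k1; move: (k.+1%:R : rat) => c k0 k1; field; rewrite k1 k0.
Qed.

Lemma bin_double q : 'C(q.+1.*2, q.+1)%:R = 2%:R + \sum_(i < q) ('C(q.+1, i.+1))%:R ^+ 2 :> rat.
Proof.
rewrite -addnn -binomial.Vandermonde natr_sum big_ord_recl big_ord_recr /=.
have b i : bump 0 i = i.+1 by [].
rewrite !b bin0 subn0 !binn subnn bin0 muln1 mulr1n addrCA addrC; congr (_ + _).
apply: eq_bigr => i _; rewrite b bin_sub ?natrM //.
by have := ltn_ord i; lia.
Qed.

(** In the sum of C(p,i)^2, the inner terms are p^2 / i^2 times the square of C(p-1,i-1), which is 1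
    modulo p; their total is p^2 [H2 p.-1]. *)
Lemma wolstenholme : eqm p 3 'C(p.*2, p)%:R 2%:R.
Proof.
have E q : q.+1 = p -> eqm p 3 'C(q.+1.*2, q.+1)%:R 2%:R; last first.
  by have := E p.-1; rewrite prednK ?prime_gt0 //; apply.
move=> eq; rewrite bin_double -[X in eqm _ _ _ X]addr0; apply: eqmD; first exact: eqm_refl.
have h := eqm_mulp 2 H2_predp; rewrite mulr0 in h; apply: eqm_trans h.
rewrite /H2 -eq /= eq mulr_sumr; apply: eqm_sum => i _.
have iq := ltn_ord i.
have iV : pint p i.+1%:R^-1 by apply: pint_invS => //; lia.
have i0 : i.+1%:R != 0 :> rat by rewrite pnatr_eq0.
have -> : 'C(p, i.+1)%:R = p%:R * ('C(p.-1, i)%:R * i.+1%:R^-1) :> rat.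
  apply: (mulfI i0); rewrite -natrM -mul_bin_diag natrM.
  by rewrite -eq /=; field; rewrite addrC natr1.
rewrite exprMn; apply: (@eqm_mulp p 2 1); rewrite exprMn -[X in eqm _ _ _ X]mul1r.
apply: eqm_mulr; first by pint_tac.
have b1 : eqm p 1 'C(p.-1, i)%:R ((-1) ^+ i) by apply: bin_pred_modp => //; lia.
apply: (eqm_trans (eqmX 2 b1 (pint_nat p _) _)); first by pint_tac.
by apply: eqm_eq; rewrite -exprM mulnC exprM sqrrN !expr1n.
Qed.
End HarmonicSums.

(** * The upper block of coefficients in degree n + p *)

Lemma horner_legp N x : (legp N).[x] = \sum_(k < N.+1) acoef N k * x ^+ k.
Proof. by rewrite /legp horner_sum; apply: eq_bigr => k _; rewrite hornerZ hornerXn. Qed.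

Lemma legp_at2 N : (legp N).[2%:R] = (-1) ^+ N * (legp N).[-1].
Proof.
have := congr1 (fun q : {poly rat} => q.[-1]) (legp_flip N).
by rewrite /= horner_comp hornerZ !(horner_one, hornerX, hornerD, hornerN) opprK => <-.
Qed.

Lemma horner_legpN1 n : (legp n).[-1] = Phi n (- n.+1%:R) n%:R.
Proof.
rewrite Phi_neg_nat horner_legp; apply: eq_bigr => k _.
have -> : 'C(n + k, n) = 'C(n + k, k) by rewrite -bin_sub ?leq_addr // addKn.
by rewrite /acoef mulrC signrMK.
Qed.

Section Block.
Variables p n : nat.
Hypothesis p_pr : prime p.
Hypothesis p_gt3 : (3 < p)%N.
Hypothesis ep : p = n.*2.+1.

Let p_odd : odd p. Proof. by rewrite ep /= odd_double. Qed.

Lemma eqm_gbin x y k : (k < p)%N -> pint p x -> eqm p 1 x y -> eqm p 1 (gbin x k) (gbin y k).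
Proof.
move=> kp px e; rewrite /gbin; apply: eqm_mulr; first exact: pint_factV.
have py : pint p y := eqm_pint (eqm_sym e) px.
suff [] : [/\ pint p (\prod_(j < k) (x - j%:R)), pint p (\prod_(j < k) (y - j%:R)) &
  eqm p 1 (\prod_(j < k) (x - j%:R)) (\prod_(j < k) (y - j%:R))] by [].
apply: (big_ind2 (fun a b => [/\ pint p a, pint p b & eqm p 1 a b])).
- by split; [exact: pint1 | exact: pint1 | exact: eqm_refl].
- move=> a a' b b' [pa pa' ea] [pb pb' eb].
  by split; [exact: pintM | exact: pintM | exact: eqmM].
move=> j _; split; [by pint_tac | by pint_tac |].
by apply: eqmD => //; apply: eqm_refl.
Qed.

(** These are the terms of [Phi n (- M.+1%:R) M%:R] for M = n + 2p in [Phi_neg_nat]. By [blockTE]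
    they also give, up to sign and [block_ratio], the coefficients of degree p + k of
    [legp (n + p)]. *)
Definition blockT (k : nat) : nat := 'C(n, k) * 'C(n + p.*2 + k, n).

Definition block_ratio (k : nat) : rat := k`!%:R * (p.*2 + k)`!%:R / (p + k)`!%:R ^+ 2.

Lemma blockT_modp k : (k <= n)%N -> eqm p 1 (blockT k)%:R ((-1) ^+ k * 'C(n, k)%:R ^+ 2).
Proof.
move=> kn; have np : (n < p)%N by lia.
have e1 : eqm p 1 'C(n + p.*2 + k, n)%:R 'C(n + k, n)%:R.
  rewrite -!gbin_nat; apply: eqm_gbin => //; first exact: pint_nat.
  exists 2%:R; first exact: pint_nat.
  by rewrite -muln2 !natrD natrM; ring.
have e2 : eqm p 1 'C(n + k, n)%:R ((-1) ^+ k * 'C(n, k)%:R).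
  rewrite -bin_sub ?leq_addr // addKn -(signrMK k 'C(n + k, k)%:R) -gbin_neg -(gbin_nat n k).
  apply: eqm_mull; first by pint_tac.
  apply: eqm_gbin; [lia | by pint_tac |].
  exists (-1); first by pint_tac.
  by rewrite ep -muln2 -!natr1 natrM; ring.
rewrite /blockT natrM (_ : _ * _ ^+ 2 = 'C(n, k)%:R * ((-1) ^+ k * 'C(n, k)%:R)); last by ring.
by apply: eqm_mull; [exact: pint_nat | exact: eqm_trans e2].
Qed.

Lemma blockTE k : (k <= n)%N ->
  acoef (n + p) (p + k) = - (-1) ^+ k * ((blockT k)%:R * block_ratio k).
Proof.
move=> kn; rewrite /acoef exprD -signr_odd p_odd expr1 mulN1r; congr (_ * _).
have h1 : (p + k <= n + p)%N by lia.
have h2 : (p + k <= n + p + (p + k))%N by lia.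
have h3 : (n <= n + p.*2 + k)%N by lia.
have c1 := bin_fact h1; have c2 := bin_fact h2; have c3 := bin_fact kn; have c4 := bin_fact h3.
have e1 : (n + p - (p + k) = n - k)%N by lia.
have e2 : (n + p + (p + k) - (p + k) = n + p)%N by lia.
have e3 : (n + p.*2 + k - n = p.*2 + k)%N by lia.
have e4 : (n + p + (p + k) = n + p.*2 + k)%N by lia.
rewrite e1 in c1; rewrite e2 e4 in c2; rewrite e3 in c4.
have := congr1 (fun t : nat => t%:R : rat) c1; have := congr1 (fun t : nat => t%:R : rat) c2.
have := congr1 (fun t : nat => t%:R : rat) c3; have := congr1 (fun t : nat => t%:R : rat) c4.
rewrite /blockT /block_ratio e4 !natrM.
have f1 := fact_neq0 (n - k); have f2 := fact_neq0 (p + k); have f3 := fact_neq0 (n + p).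
have f4 := fact_neq0 n; have f5 := fact_neq0 k; have f6 := fact_neq0 (p.*2 + k).
move: f1 f2 f3 f4 f5 f6.
move: ((n - k)`!%:R : rat) ((p + k)`!%:R : rat) ((n + p)`!%:R : rat) (n`!%:R : rat) (k`!%:R : rat)
  ((p.*2 + k)`!%:R : rat) ((n + p.*2 + k)`!%:R : rat) => a b c d e f g a0 b0 c0 d0 e0 f0.
move: ('C(n + p, p + k)%:R : rat) ('C(n + p.*2 + k, p + k)%:R : rat) ('C(n, k)%:R : rat)
  ('C(n + p.*2 + k, n)%:R : rat) => w x y z k1 k2 k3 k4.
have -> : w = c / (b * a) by rewrite -k4 mulfK // mulf_neq0.
have -> : x = g / (b * c) by rewrite -k3 mulfK // mulf_neq0.
have -> : y = d / (e * a) by rewrite -k2 mulfK // mulf_neq0.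
have -> : z = g / (d * f) by rewrite -k1 mulfK // mulf_neq0.
by field; rewrite a0 b0 c0 d0 e0 f0.
Qed.

(** The ratio starts at C(2p,p), and passing to k + 1 multiplies it by 1 - p^2 / (p+k+1)^2. *)
Lemma block_ratio_mod k : (k <= n)%N -> eqm p 3 (block_ratio k) (2%:R - 2%:R * p%:R ^+ 2 * H2 k).
Proof.
elim: k => [|k ih] kn.
  rewrite /H2 big_ord0 mulr0 subr0.
  have -> : block_ratio 0 = 'C(p.*2, p)%:R.
    have h : (p <= p.*2)%N by lia.
    have := congr1 (fun t : nat => t%:R : rat) (bin_fact h).
    have -> : (p.*2 - p = p)%N by lia.
    rewrite /block_ratio fact0 mul1r !addn0 natrM => <-.
    by rewrite natrM mulfK // mulf_neq0 // fact_neq0.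
  exact: wolstenholme p_pr p_gt3 ep.
have sp : (k.+1 < p)%N by lia.
have s0 : k.+1%:R != 0 :> rat by rewrite pnatr_eq0.
have ps := pint_invS p_pr sp.
have cps : coprime (p + k.+1) p by rewrite /coprime gcdnC gcdnDl -/(coprime _ _) coprime_sym coprime_lt.
have t0 := coprime_neq0 p_pr cps; have pt := pintV p_pr cps.
have -> : block_ratio k.+1 = block_ratio k * (1 - p%:R ^+ 2 * (p + k.+1)%:R^-1 ^+ 2).
  rewrite /block_ratio !addnS !factS !natrM -!addnS.
  rewrite natrD in t0 *.
  have e : (p.*2 + k.+1)%:R = 2%:R * p%:R + k.+1%:R :> rat by rewrite natrD -muln2 natrM mulrC.
  rewrite e; have fk := fact_neq0 (p + k).
  by move: t0; move: (k.+1%:R : rat) => s t0; field; rewrite fk t0.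
have ph : pint p (H2 k) by apply: pint_sum => i _; apply/pintX/pint_invS => //; have := ltn_ord i; lia.
apply: (eqm_trans (eqm_mulr _ (ih (ltnW kn)))); first by pint_tac.
rewrite /H2 big_ord_recr /= -/(H2 k) natrD; rewrite natrD in t0 pt.
have psn := pint_nat p k.+1.
move: s0 t0 ps pt psn; move: (k.+1%:R : rat) => s s0 t0 ps pt psn.
apply: (@eqm_trans _ _ (2%:R - 2%:R * p%:R ^+ 2 * (H2 k + (p%:R + s)^-1 ^+ 2))).
  exists (2%:R * p%:R * H2 k * (p%:R + s)^-1 ^+ 2); [by pint_tac | ring].
apply: eqmD; first exact: eqm_refl.
apply: eqmN; rewrite -![2%:R * _ * _]mulrA; apply: eqm_mull; first exact: pint_nat.
apply: (@eqm_mulp p 2 1); apply: eqmD; first exact: eqm_refl.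
exists (- (2%:R * s + p%:R) * (s^-1 ^+ 2 * (p%:R + s)^-1 ^+ 2)); first by pint_tac.
by field; rewrite t0 s0.
Qed.

Lemma acoef_small N k : (N < k)%N -> acoef N k = 0.
Proof. by move=> h; rewrite /acoef bin_small // mul0n mulr0. Qed.

Lemma sum_acoef_small x : \sum_(k < p) acoef n k * x ^+ k = (legp n).[x].
Proof.
rewrite horner_legp (_ : p = n.+1 + n)%N; last lia.
rewrite big_split_ord /= [X in _ + X]big1 ?addr0 // => i _.
by rewrite acoef_small ?mul0r // ltnS leq_addr.
Qed.

Lemma sum_acoef_block x : \sum_(k < p) acoef (n + p) k * x ^+ k =
  (legp (n + p)).[x] + x ^+ p * \sum_(k < n.+1) (blockT k)%:R * block_ratio k * (- x) ^+ k.
Proof.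
rewrite horner_legp (_ : (n + p).+1 = p + n.+1)%N; last lia.
rewrite [in RHS]big_split_ord /= -addrA mulr_sumr -big_split /= [X in _ = _ + X]big1 ?addr0 // => k _.
have kn : (k <= n)%N by rewrite -ltnS.
by rewrite blockTE // exprD [(- x) ^+ k]exprNn; ring.
Qed.

Lemma expn2_modp : eqm p 1 (2%:R ^+ p) 2%:R.
Proof.
rewrite -natrX; apply: eqm_natFp => //; rewrite natrX.
by have := expf_card (2%:R : 'F_p); rewrite card_Fp.
Qed.

Hypothesis n_even : ~~ odd n.

(** As n + p is odd, the values of [legp (n + p)] at 2 and -1 cancel and only the block terms
    remain. Their main parts are values of [Phi]; the [H2] corrections carry p^2, so they matter
    only modulo p, where 2^p is 2 and the hypothesis makes them cancel. *)
Lemma Kp_Km_block :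
  eqm p 1 (2%:R * \sum_(k < n.+1) 'C(n, k)%:R ^+ 2 * H2 k * 2%:R ^+ k)
          (\sum_(k < n.+1) 'C(n, k)%:R ^+ 2 * H2 k * (-1) ^+ k) ->
  let M := (n + p.*2)%N in
  eqm p 3 (8%:R * (Kp p + Km p))
    (18%:R * Phi n (- n.+1%:R) n%:R - 2%:R ^+ p.+1 * Phi n (- M.+1%:R) n%:R
     + 2%:R * Phi n (- M.+1%:R) M%:R).
Proof.
move=> landen M.
have pH k : (k <= n)%N -> pint p (H2 k).
  by move=> kn; apply: pint_sum => i _; apply/pintX/pint_invS => //; have := ltn_ord i; lia.
have sn : (-1) ^+ n = 1 :> rat by rewrite -signr_odd (negPf n_even).
have snp : (-1) ^+ (n + p) = -1 :> rat by rewrite -signr_odd oddD p_odd (negPf n_even).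
have eP := horner_legpN1 n.
have step1 : eqm p 3 (8%:R * (Kp p + Km p))
   (9%:R * (\sum_(k < p) acoef n k * 2%:R ^+ k + \sum_(k < p) acoef n k * (-1) ^+ k)
    - (\sum_(k < p) acoef (n + p) k * 2%:R ^+ k + \sum_(k < p) acoef (n + p) k * (-1) ^+ k)).
  rewrite /Kp /Km -!big_split /= !mulr_sumr -sumrB; apply: eqm_sum => k _.
  have h := u_interp p_pr ep (ltn_ord k).
  have -> : 8%:R * (u k * 2%:R ^+ k + u k * (-1) ^+ k) = (2%:R ^+ k + (-1) ^+ k) * (8%:R * u k) by ring.
  apply: (eqm_trans (eqm_mull _ h)); first by pint_tac.
  by apply: eqm_eq; ring.
apply: (eqm_trans step1).
rewrite !sum_acoef_small !sum_acoef_block !legp_at2 sn snp eP.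
rewrite -(signr_odd _ p) p_odd expr1 opprK.
pose S (x : rat) := \sum_(k < n.+1) (blockT k)%:R * x ^+ k.
pose Y (x : rat) := \sum_(k < n.+1) (blockT k)%:R * H2 k * x ^+ k.
have hS x : pint p x ->
    eqm p 3 (\sum_(k < n.+1) (blockT k)%:R * block_ratio k * x ^+ k)
      (2%:R * S x - 2%:R * p%:R ^+ 2 * Y x).
  move=> px; rewrite /S /Y !mulr_sumr -sumrB; apply: eqm_sum => k _.
  have kn : (k <= n)%N by rewrite -ltnS.
  apply: (@eqm_trans _ _ ((blockT k)%:R * (2%:R - 2%:R * p%:R ^+ 2 * H2 k) * x ^+ k)).
    apply: eqm_mulr; first by pint_tac.
    by apply: eqm_mull; [exact: pint_nat | exact: block_ratio_mod].
  by apply: eqm_eq; ring.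
have pY x : pint p x -> pint p (Y x).
  move=> px; apply: pint_sum => k _; have kn : (k <= n)%N by rewrite -ltnS.
  by have := pH _ kn => ?; pint_tac.
have eJ1 : Phi n (- M.+1%:R) M%:R = S 1.
  by rewrite Phi_neg_nat; apply: eq_bigr => k _; rewrite expr1n mulr1.
have eJ2 : Phi n (- M.+1%:R) n%:R = S (- 2%:R).
  by rewrite Phi_neg_small sn mul1r; apply: eq_bigr => k _.
rewrite eJ1 eJ2.
have h2 := hS (- 2%:R) (pintN (pint_nat p 2)); have h1 := hS 1 (pint1 p).
have hY : eqm p 1 (2%:R * Y (- 2%:R)) (Y 1).
  have hB x : pint p x ->
      eqm p 1 (Y (- x)) (\sum_(k < n.+1) 'C(n, k)%:R ^+ 2 * H2 k * x ^+ k).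
    move=> px; apply: eqm_sum => k _; have kn : (k <= n)%N by rewrite -ltnS.
    have := pH _ kn => ?.
    apply: (@eqm_trans _ _ ((-1) ^+ k * 'C(n, k)%:R ^+ 2 * (H2 k * (- x) ^+ k))).
      by rewrite -[_ * _ * (- x) ^+ k]mulrA; apply: eqm_mulr; [pint_tac | exact: blockT_modp].
    apply: eqm_eq; rewrite [(- x) ^+ k]exprNn -['C(n, k)%:R ^+ 2 in RHS](signrMK k); ring.
  apply: (eqm_trans (eqm_mull (pint_nat p 2) (hB _ (pint_nat p 2)))).
  apply: (eqm_trans landen); apply: eqm_sym.
  by have := hB (-1) (pintN (pint1 p)); rewrite opprK.
have pY1 := pY 1 (pint1 p); have pY2 := pY _ (pintN (pint_nat p 2)).
have [z pz ez] := hY; have [w pw ew] := expn2_modp.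
have e2p : 2%:R ^+ p = 2%:R + p%:R * w :> rat by rewrite -[p%:R * w]ew; ring.
apply: (@eqm_trans _ _ (18%:R * Phi n (- n.+1%:R) n%:R
   - 2%:R ^+ p * (2%:R * S (- 2%:R) - 2%:R * p%:R ^+ 2 * Y (- 2%:R))
   + (2%:R * S 1 - 2%:R * p%:R ^+ 2 * Y 1))).
  rewrite [X in eqm _ _ X _](_ : _ = 18%:R * Phi n (- n.+1%:R) n%:R
   - 2%:R ^+ p * (\sum_(k < n.+1) (blockT k)%:R * block_ratio k * (- 2%:R) ^+ k)
   + (\sum_(k < n.+1) (blockT k)%:R * block_ratio k * 1 ^+ k)); last by ring.
  apply: eqmD => //; apply: eqmD; first exact: eqm_refl.
  by apply: eqmN; apply: eqm_mull => //; pint_tac.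
exists (2%:R * (z + w * Y (- 2%:R))); first by pint_tac.
rewrite [2%:R ^+ p.+1]exprS e2p.
transitivity (2%:R * p%:R ^+ 2 * ((2%:R * Y (- 2%:R) - Y 1) + p%:R * w * Y (- 2%:R))); first by ring.
by rewrite ez; ring.
Qed.
End Block.

(** * Landen's transformation modulo p *)

Section Landen.
Variables p n : nat.
Hypothesis p_pr : prime p.
Hypothesis ep : p = n.*2.+1.

Local Notation F := 'F_p.

Let twon : 2%:R * n%:R + 1 = 0 :> F.
Proof. by rewrite -natrM natr1 mul2n -ep (pcharf0 (pchar_Fp p_pr)). Qed.

Let nz d : (0 < d < p)%N -> d%:R != 0 :> F.
Proof. by move=> h; apply/coprime_Fp/coprime_lt. Qed.

Let nz2 : 2%:R != 0 :> F.
Proof. by apply: nz; have := prime_gt1 p_pr; lia. Qed.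

(** The residue of [u k] modulo p for k <= n. *)
Definition beta (k : nat) : F := 'C(n, k)%:R ^+ 2.

Lemma half_shift k : (k <= n)%N -> 2%:R * (n - k)%:R = - (k.*2.+1)%:R :> F.
Proof.
move=> kn; rewrite natrB // -[k.*2.+1]addn1 natrD -[k.*2]mul2n natrM.
have -> : 2%:R * (n%:R - k%:R) = (2%:R * n%:R + 1) - (2%:R * k%:R + 1) :> F by ring.
by rewrite twon sub0r.
Qed.

Lemma betaS k : 4%:R * k.+1%:R ^+ 2 * beta k.+1 = (k.*2.+1)%:R ^+ 2 * beta k.
Proof.
have [kn|nk] := leqP k n; last by rewrite /beta !bin_small ?expr0n ?mulr0 //; lia.
have e : k.+1%:R * 'C(n, k.+1)%:R = (n - k)%:R * 'C(n, k)%:R :> F by rewrite -!natrM mul_bin_left.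
transitivity ((2%:R * (k.+1%:R * 'C(n, k.+1)%:R)) ^+ 2 : F); first by rewrite /beta; ring.
by rewrite e mulrA half_shift // /beta; ring.
Qed.

(* The [j]-th term of [(1 + 'X) ^+ n.*2 * \sum_j c j * t ^+ j] at Landen's argument
   [t = 4 'X / (1 + 'X) ^ 2]; the transformed series has argument ['X ^ 2]. *)
Definition lterm (j : nat) : {poly F} := (4%:R * 'X) ^+ j * (1 + 'X) ^+ (n - j).*2.

Lemma deriv_pow (q : {poly F}) k : q * (q ^+ k)^`() = k%:R * q ^+ k * q^`().
Proof.
by case: k => [|k]; rewrite ?expr0 ?derivE ?mulr0 ?mul0r // deriv_exp exprS -mulr_natr; ring.
Qed.

Lemma lterm_deriv j : (j <= n)%N ->
  'X * (1 + 'X) * (lterm j)^`() = (j%:R - j.+1%:R * 'X) * lterm j.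
Proof.
move=> jn; rewrite /lterm derivM.
have d1 : (1 + 'X : {poly F})^`() = 1 by rewrite derivD derivX derivC add0r.
have d4 : (4%:R * 'X : {poly F})^`() = 4%:R by rewrite derivM derivX -(polyC_natr _ 4) derivC; ring.
have e1 := deriv_pow (1 + 'X) (n - j).*2; have e2 := deriv_pow (4%:R * 'X) j.
rewrite d1 mulr1 in e1; rewrite d4 in e2.
have {}e2 : 'X * ((4%:R * 'X : {poly F}) ^+ j)^`() = j%:R * (4%:R * 'X) ^+ j.
  have n4 : (4%:R : F) != 0 by rewrite (natrM _ 2 2) mulf_neq0.
  by apply: (scalerI n4); rewrite -!mul_polyC polyC_natr mulrA e2; ring.
have e3 : (n - j).*2%:R = - (j.*2.+1)%:R :> {poly F}.
  by rewrite -mul2n natrM -!(polyC_natr F) -polyCM half_shift // polyCN.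
rewrite e3 -[j.*2.+1]addn1 natrD -[j.*2]mul2n natrM in e1.
transitivity ((1 + 'X) * ('X * ((4%:R * 'X) ^+ j)^`()) * (1 + 'X) ^+ (n - j).*2
  + 'X * (4%:R * 'X) ^+ j * ((1 + 'X) * ((1 + 'X) ^+ (n - j).*2)^`()) : {poly F}); first by ring.
by rewrite e1 e2 -[j.+1]addn1 natrD; ring.
Qed.

(** The Legendre operator in the variable X^2, normalized so that its coefficients ([coef_lopS])
    give the recurrence of [beta] on even indices. *)
Definition lop (y : {poly F}) : {poly F} :=
  ('X * y^`())^`() - 'X * ('X * ('X * y)^`())^`().

Lemma lopE y : lop y = 'X * (1 - 'X ^+ 2) * y^`()^`() + (1 - 3%:R * 'X ^+ 2) * y^`() - 'X * y.
Proof. by rewrite /lop !(derivM, derivX, derivD, derivC); ring. Qed.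

Lemma coef_lop0 y : (lop y)`_0 = y`_1.
Proof. by rewrite coefB !(coefXM, coef_deriv) /= subr0. Qed.

Lemma coef_lopS y i : (lop y)`_i.+1 = i.+2%:R ^+ 2 * y`_i.+2 - i.+1%:R ^+ 2 * y`_i.
Proof.
have cXS (q : {poly F}) k : ('X * q)`_k.+1 = q`_k by rewrite coefXM.
have nn (a : F) k : a *+ k *+ k = k%:R ^+ 2 * a by rewrite -[a *+ k *+ k]mulr_natl -[a *+ k]mulr_natl mulrA.
by rewrite coefB coef_deriv cXS coef_deriv cXS coef_deriv cXS coef_deriv cXS !nn.
Qed.

Lemma lop_lterm j : (j <= n)%N ->
  'X * (1 + 'X) ^+ 2 * lop (lterm j) =
  (1 - 'X ^+ 2) * (j%:R ^+ 2 * (1 + 'X) ^+ 2 - (j.*2.+1)%:R ^+ 2 * 'X) * lterm j.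
Proof.
move=> /lterm_deriv; move: (lterm j) => y e1.
have dn k : (k%:R : {poly F})^`() = 0 by rewrite -polyC_natr derivC.
have e2 := congr1 (fun q : {poly F} => q^`()) e1.
have o1 : j.+1%:R = j%:R + 1 :> {poly F} by rewrite natr1.
have o2 : (j.*2.+1)%:R = 2%:R * j%:R + 1 :> {poly F} by rewrite -natr1 -mul2n natrM.
rewrite /= !(derivM, derivD, derivX, derivN, dn, derivC) in e2.
apply/eqP; rewrite -subr_eq0 lopE o2.
move/eqP: e1; rewrite -subr_eq0 => /eqP e1; move/eqP: e2; rewrite -subr_eq0 => /eqP e2.
rewrite o1 in e1 e2.
apply/eqP.
(* [a] and [b] are the multipliers with which the first order equation [e1] and its derivative [e2]
   add up to the claim. *)
set a := (1 - 'X ^+ 2) * (j%:R - 1 - (j%:R + 3%:R) * 'X) + (1 + 'X) * (1 - 3%:R * 'X ^+ 2) : {poly F}.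
set b := 'X * (1 + 'X) * (1 - 'X ^+ 2) : {poly F}.
transitivity (a * 0 + b * 0); last by rewrite !mulr0 addr0.
rewrite -[in a * _]e1 -[in b * _]e2 /a /b. ring.
Qed.

Definition landen (c : nat -> F) : {poly F} := \sum_(j < n.+1) c j *: lterm j.

Lemma lopD y z : lop (y + z) = lop y + lop z.
Proof. by rewrite !lopE !derivD; ring. Qed.

Lemma lopZ c y : lop (c *: y) = c *: lop y.
Proof. by rewrite !lopE !derivZ -!mul_polyC; ring. Qed.

Lemma lop_sum (I : Type) (r : seq I) (P : pred I) (f : I -> {poly F}) :
  lop (\sum_(i <- r | P i) f i) = \sum_(i <- r | P i) lop (f i).
Proof. by apply: (big_morph _ lopD); rewrite lopE !deriv0; ring. Qed.

(* The middle terms telescope because [beta] satisfies the hypergeometric recurrence. *)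
Lemma lop_landen (e : nat -> F) :
  'X * lop (landen (fun j => beta j * e j)) =
  (1 - 'X ^+ 2) * \sum_(j < n) (j.+1%:R ^+ 2 * beta j.+1 * (e j.+1 - e j)) *: lterm j.+1.
Proof.
have nz1 : (1 + 'X) ^+ 2 != 0 :> {poly F}.
  by rewrite expf_neq0 // addrC -[1]opprK -polyCN polyXsubC_eq0.
apply: (mulIf nz1).
have lS j : (j < n)%N -> (1 + 'X) ^+ 2 * lterm j.+1 = 4%:R * 'X * lterm j.
  move=> jn; rewrite /lterm (_ : (n - j).*2 = (n - j.+1).*2 + 2)%N; last lia.
  by rewrite exprD [(4%:R * 'X) ^+ j.+1]exprS; ring.
pose a (j : nat) : {poly F} := (j%:R ^+ 2 * beta j * e j) *: ((1 + 'X) ^+ 2 * lterm j).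
pose b (j : nat) : {poly F} := ((j.*2.+1)%:R ^+ 2 * beta j * e j) *: ('X * lterm j).
transitivity ((1 - 'X ^+ 2) * (\sum_(j < n.+1) a j - \sum_(j < n.+1) b j)).
  rewrite -sumrB lop_sum mulr_sumr mulr_suml mulr_sumr; apply: eq_bigr => j _.
  have jn : (j <= n)%N by rewrite -ltnS.
  rewrite lopZ; transitivity ((beta j * e j) *: ('X * (1 + 'X) ^+ 2 * lop (lterm j))).
    by rewrite -!mul_polyC; ring.
  by rewrite lop_lterm // /a /b -!mul_polyC !(polyCM, polyC_natr); ring.
rewrite -mulrA; congr (_ * _).
rewrite big_ord_recl big_ord_recr /= /a /b.
have -> : (n.*2.+1)%:R = 0 :> F by rewrite -ep (pcharf0 (pchar_Fp p_pr)).
rewrite !expr0n /= !mul0r !scale0r add0r addr0 -sumrB mulr_suml; apply: eq_bigr => j _.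
rewrite -betaS /bump /= add1n -!scalerAl [lterm j.+1 * _]mulrC lS //.
rewrite -!mul_polyC !(polyCM, polyCB, polyC_natr); ring.
Qed.

Lemma coef_one_plusX k : (k < p)%N -> ((1 + 'X) ^+ n.*2 : {poly F})`_k = (-1) ^+ k.
Proof.
rewrite -['X]scale1r coef_exp1cX expr1n mul1r.
elim: k => [|k ih] kp; first by rewrite bin0.
apply: (mulfI (nz (d := k.+1) _)); first by lia.
rewrite -natrM mul_bin_left natrM ih ?(ltnW kp) //.
have -> : (n.*2 - k)%:R = - k.+1%:R :> F.
  rewrite natrB; last lia.
  by rewrite -mul2n natrM -natr1; apply/eqP; rewrite -subr_eq0; apply/eqP; rewrite -[RHS]twon; ring.
by rewrite [(-1) ^+ k.+1]exprS; ring.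
Qed.

Lemma lterm0 : lterm 0 = (1 + 'X) ^+ n.*2.
Proof. by rewrite /lterm expr0 mul1r subn0. Qed.

Lemma size_lterm j : (j <= n)%N -> (size (lterm j) <= n.*2.+1)%N.
Proof.
move=> jn; apply: (leq_trans (size_polyMleq _ _)).
have s1 : (size (4%:R * 'X : {poly F})%R <= 2)%N.
  by rewrite -polyC_natr mul_polyC (leq_trans (size_scale_leq _ _)) // size_polyX.
have s2 : (size (1 + 'X : {poly F})%R <= 2)%N.
  by rewrite (leq_trans (size_polyD _ _)) // size_poly1 size_polyX.
have sz (q : {poly F}) k : (size q <= 2)%N -> (size (q ^+ k)%R <= k.+1)%N.
  move=> sq; apply: (leq_trans (size_poly_exp_leq _ _)).
  by rewrite ltnS -[leqRHS]mul1n leq_mul2r -ltnS (leq_trans (leqSpred _)) ?orbT //; case: (size q) sq.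
have := sz _ j s1; have := sz _ (n - j).*2 s2; lia.
Qed.

Lemma size_landen c : (size (landen c) <= n.*2.+1)%N.
Proof.
apply: (leq_trans (size_sum _ _ _)); apply/bigmax_leqP => j _.
by apply: (leq_trans (size_scale_leq _ _)); apply: size_lterm; rewrite -ltnS.
Qed.

Lemma landen_coef0 c : (landen c)`_0 = c 0%N.
Proof.
rewrite -horner_coef0 horner_sum big_ord_recl big1 ?addr0 => [|j _]; rewrite hornerZ /lterm hornerM !horner_exp.
  by rewrite expr0 mul1r hornerD hornerX addr0 -polyC1 hornerC expr1n mulr1.
by rewrite hornerM hornerX mulr0 expr0n /= mul0r mulr0.
Qed.

Lemma beta0 : beta 0 = 1. Proof. by rewrite /beta bin0 expr1n. Qed.

Lemma lop_landen_beta : lop (landen beta) = 0.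
Proof.
have := lop_landen (fun _ => 1).
rewrite [X in _ = _ * X]big1 => [|j _]; last by rewrite subrr mulr0 scale0r.
have -> : landen (fun j => beta j * 1) = landen beta by apply: eq_bigr => j _; rewrite mulr1.
by rewrite mulr0 => /eqP; rewrite mulf_eq0 polyX_eq0 => /eqP.
Qed.

(** Together with [landen_odd] this is Landen's transformation modulo p: a polynomial killed by
    [lop] is determined by its first two coefficients as long as the index stays below p. The
    exponent p - 1 of 1 + X replaces the classical -1. *)
Lemma landen_even s : (s <= n)%N -> (landen beta)`_(s.*2) = beta s.
Proof.
elim: s => [|s ih] sn; first by rewrite landen_coef0.
have n1 : s.*2.+2%:R != 0 :> F by apply: nz; lia.
apply: (mulfI n1); apply: (mulfI n1).
have := coef_lopS (landen beta) s.*2; rewrite lop_landen_beta coef0 ih ?(ltnW sn) //.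
have := betaS s.
have -> : s.*2.+2%:R = 2%:R * s.+1%:R :> F by rewrite -natrM mul2n.
move=> e1 e2; rewrite doubleS; apply/eqP; rewrite -subr_eq0; apply/eqP.
transitivity ((2%:R * s.+1%:R) ^+ 2 * (landen beta)`_s.*2.+2 - (s.*2.+1)%:R ^+ 2 * beta s
  + ((s.*2.+1)%:R ^+ 2 * beta s - 4%:R * s.+1%:R ^+ 2 * beta s.+1)); first by ring.
by rewrite -e2 e1 subrr addr0.
Qed.

Lemma landen_odd s : (s < n)%N -> (landen beta)`_(s.*2.+1) = 0.
Proof.
elim: s => [|s ih] sn; first by rewrite -coef_lop0 lop_landen_beta coef0.
have n1 : s.*2.+3%:R != 0 :> F by apply: nz; lia.
apply: (mulfI n1); apply: (mulfI n1).
have := coef_lopS (landen beta) s.*2.+1; rewrite lop_landen_beta coef0 ih ?(ltnW sn) //.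
by rewrite mulr0 subr0 doubleS !mulr0 mulrA -expr2 => <-.
Qed.

(** The terms with j > 0. They form the right-hand side of the differential equations for both
    weightings used below, by [eta] and by 1/j. *)
Definition landen_tail : {poly F} := \sum_(j < n) beta j.+1 *: lterm j.+1.

Lemma landen_tailE : landen_tail = landen beta - (1 + 'X) ^+ n.*2.
Proof.
rewrite /landen big_ord_recl beta0 scale1r lterm0 addrC addKr.
by apply: eq_bigr.
Qed.

Lemma tail_even s : (s <= n)%N -> landen_tail`_(s.*2) = beta s - 1.
Proof.
move=> sn; rewrite landen_tailE coefB landen_even // coef_one_plusX; last by lia.
by rewrite -mul2n exprM sqrrN !expr1n.
Qed.

Lemma tail_odd s : (s < n)%N -> landen_tail`_(s.*2.+1) = 1.
Proof.
move=> sn; rewrite landen_tailE coefB landen_odd // coef_one_plusX; last by lia.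
by rewrite exprS -mul2n exprM sqrrN !expr1n mulr1 opprK add0r.
Qed.

Lemma horner_even_part (q : {poly F}) x : (size q <= n.*2.+2)%N ->
  q.[x] + q.[- x] = 2%:R * \sum_(s < n.+1) q`_(s.*2) * (x ^+ 2) ^+ s.
Proof.
move=> sq; have se : (size (even_poly q) <= n.+1)%N.
  by apply: (leq_trans (size_poly _ _)); lia.
have -> : \sum_(s < n.+1) q`_(s.*2) * (x ^+ 2) ^+ s = (even_poly q).[x ^+ 2].
  by rewrite (horner_coef_wide _ se); apply: eq_bigr => s _; rewrite coef_even_poly.
have ev y : q.[y] = (even_poly q).[y ^+ 2] + (odd_poly q).[y ^+ 2] * y.
  by rewrite -{1}(poly_even_odd q) hornerD hornerM hornerX !horner_comp !hornerXn.
by rewrite !ev sqrrN; ring.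
Qed.

Lemma horner_lterm_at1 j : (j <= n)%N -> (lterm j).[1] = 1.
Proof.
move=> jn; rewrite /lterm hornerM !horner_exp hornerD hornerM hornerX -polyC1 -polyC_natr !hornerC mulr1.
have -> : (n - j).*2 = (2 * (n - j))%N by rewrite mul2n.
rewrite exprM (_ : (1 + 1) ^+ 2 = 4%:R :> F); last by ring.
rewrite -exprD subnKC // (_ : 4%:R = 2%:R ^+ 2 :> F); last by ring.
rewrite -exprM mul2n; apply: (mulfI nz2).
by rewrite -exprS -ep mulr1; have := expf_card (2%:R : F); rewrite card_Fp.
Qed.

(** Since 4i = 2 (1+i)^2, each term is 2^j times (1+i)^(p-1) = 1. *)
Lemma horner_lterm_sqrtN1 j (i : F) : i ^+ 2 = -1 -> (j <= n)%N -> (lterm j).[i] = 2%:R ^+ j.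
Proof.
move=> i2 jn; rewrite /lterm hornerM !horner_exp hornerD hornerM hornerX -polyC1 -polyC_natr !hornerC.
have -> : (n - j).*2 = (2 * (n - j))%N by rewrite mul2n.
rewrite exprM (_ : (1 + i) ^+ 2 = 2%:R * i); last by rewrite sqrrD i2; ring.
transitivity (2%:R ^+ j * (2%:R * i) ^+ n).
  by rewrite -{2}(subnKC jn) exprD mulrA -exprMn; congr (_ ^+ _ * _); ring.
rewrite (_ : 2%:R * i = (1 + i) ^+ 2); last by rewrite sqrrD i2; ring.
have n1 : 1 + i != 0.
  apply/eqP=> e; have := i2; have -> : i = -1 by apply/eqP; rewrite -subr_eq0 opprK addrC e.
  by rewrite sqrrN expr1n => /eqP; rewrite -subr_eq0 opprK -[1 + 1]/(2%:R) (negPf nz2).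
rewrite -exprM mul2n (_ : _ ^+ n.*2 = 1) ?mulr1 //; apply: (mulfI n1).
by rewrite -exprS -ep mulr1; have := expf_card (1 + i); rewrite card_Fp.
Qed.

Lemma horner_landen c x y : (forall j, (j <= n)%N -> (lterm j).[x] = y ^+ j) ->
  (landen c).[x] = \sum_(j < n.+1) c j * y ^+ j.
Proof.
move=> h; rewrite horner_sum; apply: eq_bigr => j _.
by rewrite hornerZ h // -ltnS.
Qed.

Variable i : F.
Hypothesis i2 : i ^+ 2 = -1.

Let i2N : (- i) ^+ 2 = -1. Proof. by rewrite sqrrN. Qed.

Section Weighted.
Variable eta : nat -> F.
Hypothesis eta0 : eta 0 = 0.
Hypothesis etaS : forall j, (j < n)%N -> j.+1%:R ^+ 2 * (eta j.+1 - eta j) = 1.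
Hypothesis etan : eta n = 0.

(** Both sides obey the same recurrence. The reflected term appears because 2(n-s) = -(2s+1) modulo
    p, so the increment of [eta] from n-s-1 to n-s is 4 / (2s+1)^2; the start uses eta 0 = eta n =
    0. *)
Lemma landen_eta_even s : (s <= n)%N ->
  4%:R * (landen (fun j => beta j * eta j))`_(s.*2) = beta s * (eta s + eta (n - s)).
Proof.
set Z := landen _.
have eZ : 'X * lop Z = (1 - 'X ^+ 2) * landen_tail.
  rewrite lop_landen; congr (_ * _); apply: eq_bigr => j _; congr (_ *: _).
  by rewrite mulrAC etaS ?mul1r.
elim: s => [|s ih] sn; first by rewrite landen_coef0 eta0 subn0 etan addr0 !mulr0.
have n1 : s.*2.+2%:R != 0 :> F by apply: nz; lia.
have h1 : (lop Z)`_s.*2.+1 = beta s.+1 - beta s.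
  have := congr1 (fun q : {poly F} => q`_s.*2.+2) eZ.
  have -> : (1 - 'X ^+ 2) * landen_tail = landen_tail - 'X * ('X * landen_tail) by ring.
  rewrite /= coefB !coefXM /= => ->; rewrite -doubleS !tail_even //; last exact: ltnW.
  ring.
apply: (mulfI n1); apply: (mulfI n1).
have := coef_lopS Z s.*2; rewrite h1 => h2.
have e1 := betaS s; have e2 := etaS sn.
have sn' : (n - s.+1 < n)%N by lia.
have e3 := etaS sn'; rewrite (_ : (n - s.+1).+1 = n - s)%N in e3; last lia.
have e4 := half_shift (ltnW sn); have {}ih := ih (ltnW sn).
have es : s.*2.+2%:R = 2%:R * s.+1%:R :> F by rewrite -natrM mul2n.
rewrite doubleS es in h2 *.
move: (s.*2.+1%:R : F) (s.+1%:R : F) ((n - s)%:R : F) Z`_s.*2 Z`_s.*2.+2 (beta s) (beta s.+1)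
  (eta s) (eta s.+1) (eta (n - s)) (eta (n - s.+1)) e1 e2 e3 e4 ih h2 => c a b z z' x x' e e' g g' e1 e2 e3 e4 ih h2.
have k1 : c ^+ 2 * x * (e' - e) = 4%:R * x'.
  by rewrite -e1; transitivity (4%:R * x' * (a ^+ 2 * (e' - e))); [ring | rewrite e2 mulr1].
have k2 : c ^+ 2 * x * (g - g') = 4%:R * x.
  have -> : c = - (2%:R * b) by rewrite e4 opprK.
  by transitivity (4%:R * x * (b ^+ 2 * (g - g'))); [ring | rewrite e3 mulr1].
have h3 : (2%:R * a) ^+ 2 * z' = x' - x + c ^+ 2 * z by rewrite h2; ring.
transitivity (4%:R * ((2%:R * a) ^+ 2 * z')); first by ring.
rewrite h3; transitivity (4%:R * x' - 4%:R * x + c ^+ 2 * (4%:R * z)); first by ring.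
rewrite ih -k1 -k2; transitivity (4%:R * a ^+ 2 * x' * (e' + g')); last by ring.
by rewrite e1; ring.
Qed.

Hypothesis n_even : ~~ odd n.

(* At ['X = i] Landen's argument is [2], while ['X ^ 2 = -1]. *)
Lemma landen_weighted :
  2%:R * \sum_(s < n.+1) beta s * eta s * 2%:R ^+ s = \sum_(s < n.+1) beta s * eta s * (-1) ^+ s.
Proof.
set Z := landen (fun j => beta j * eta j).
have sZ : (size Z <= n.*2.+2)%N by apply: leq_trans (size_landen _) _.
have := horner_even_part i sZ.
rewrite !(@horner_landen _ _ 2%:R); try by move=> j; apply: horner_lterm_sqrtN1.
set S := \sum_(s < n.+1) _ * 2%:R ^+ s; rewrite i2 => h.
have {}h : S = \sum_(s < n.+1) Z`_s.*2 * (-1) ^+ s.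
  by apply: (mulfI nz2); rewrite -h; ring.
have h4 : 4%:R * S = \sum_(s < n.+1) beta s * eta s * (-1) ^+ s + \sum_(s < n.+1) beta s * eta (n - s) * (-1) ^+ s.
  rewrite h mulr_sumr -big_split /=; apply: eq_bigr => s _.
  by rewrite mulrA landen_eta_even -1?ltnS //; ring.
apply: (mulfI nz2); rewrite mulrA (_ : 2%:R * 2%:R = 4%:R :> F); last by ring.
rewrite h4 mulr_natl mulr2n; congr (_ + _).
rewrite (reindex_inj rev_ord_inj); apply: eq_bigr => s _ /=.
have sn : (s <= n)%N by rewrite -ltnS.
rewrite subSS subKn // /beta bin_sub //; congr (_ * _).
by rewrite -signr_odd oddB // (negPf n_even) /= signr_odd.
Qed.
End Weighted.

Let lam (x : F) : F := \sum_(s < n.+1) beta s / s%:R * x ^+ s.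
(** The factor 1 + X is chosen so that X times the derivative of (1 + X) [lterm j] is j (1 - X)
    [lterm j]; differentiation then removes the weights 1/j. The term j = 0 vanishes because 0 has
    inverse 0. *)
Let N : {poly F} := (1 + 'X) * landen (fun j => beta j / j%:R).

Lemma N_even s : (0 < s <= n)%N -> s.*2%:R * N`_(s.*2) = beta s - 2%:R.
Proof.
case: s => // s /andP [_ sn].
have eN : 'X * N^`() = (1 - 'X) * landen_tail.
  transitivity ((1 - 'X) * \sum_(j < n.+1) (j%:R * (beta j / j%:R)) *: lterm j); last first.
    congr (_ * _); rewrite big_ord_recl mul0r scale0r add0r.
    apply: eq_bigr => j _; rewrite lift0; congr (_ *: _).
    by rewrite mulrC divfK //; apply: nz; have := ltn_ord j; lia.
  rewrite /N mulr_sumr deriv_sum !mulr_sumr; apply: eq_bigr => j _.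
  have jn : (j <= n)%N by rewrite -ltnS.
  have e1 := lterm_deriv jn.
  have d1 : (1 + 'X : {poly F})^`() = 1 by rewrite derivD derivX derivC add0r.
  rewrite -!mul_polyC mulrCA derivM derivC mul0r add0r derivM d1 [(j%:R * _)%:P]polyCM polyC_natr.
  transitivity ((beta j / j%:R)%:P * ('X * lterm j + 'X * (1 + 'X) * (lterm j)^`())); first by ring.
  by rewrite e1 -natr1; ring.
have := congr1 (fun q : {poly F} => q`_s.*2.+2) eN.
have -> : (1 - 'X) * landen_tail = landen_tail - 'X * landen_tail by ring.
rewrite /= coefB !coefXM coef_deriv /= -doubleS tail_even // tail_odd //.
by rewrite doubleS mulr_natl => ->; ring.
Qed.

Lemma size_N : (size N <= n.*2.+2)%N.
Proof.
apply: (leq_trans (size_polyMleq _ _)).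
have s2 : (size (1 + 'X : {poly F})%R <= 2)%N.
  by rewrite (leq_trans (size_polyD _ _)) // size_poly1 size_polyX.
have := size_landen (fun j => beta j / j%:R); lia.
Qed.

Lemma even_part_N x :
  2%:R * \sum_(s < n.+1) N`_(s.*2) * x ^+ s = lam x - 2%:R * \sum_(s < n.+1) s%:R^-1 * x ^+ s.
Proof.
rewrite /lam !mulr_sumr -sumrB; apply: eq_bigr => s _.
have [->|s0] := posnP s.
  have -> : N`_(0.*2) = 0.
    by rewrite -horner_coef0 /N hornerM horner_coef0 coefD coefX addr0 horner_coef0 landen_coef0 invr0 !mulr0.
  by rewrite invr0; ring.
have sn : (s <= n)%N by rewrite -ltnS.
have s1 : (0 < s <= n)%N by rewrite s0.
have := N_even s1; rewrite -mul2n natrM => h.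
have ns : s%:R != 0 :> F by apply: nz; lia.
apply: (mulfI ns); transitivity (2%:R * s%:R * N`_(2 * s) * x ^+ s); first by rewrite mul2n; ring.
by rewrite h; field.
Qed.

(** The even part of [N] is evaluated at X = i, where the factors 1 + i and 1 - i add up to 2. *)
Lemma landen_log : 2%:R * lam 2%:R = lam (-1) - 2%:R * \sum_(s < n.+1) s%:R^-1 * (-1) ^+ s.
Proof.
rewrite -even_part_N -i2 -(horner_even_part i size_N) /N !hornerM.
rewrite !(@horner_landen _ _ 2%:R); try by move=> j; apply: horner_lterm_sqrtN1.
by rewrite -/(lam 2%:R) !hornerD !hornerX -polyC1 !hornerC; ring.
Qed.

(** The even part is evaluated at X = 1; the factor 1 + X removes the contribution of -1. *)
Lemma landen_log1 : lam 1 = - (2%:R * \sum_(s < n.+1) s%:R^-1).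
Proof.
have := even_part_N 1; have := horner_even_part 1 size_N.
rewrite expr1n => <-; rewrite /N !hornerM (@horner_landen _ _ 1); last first.
  by move=> j; rewrite expr1n; apply: horner_lterm_at1.
rewrite -/(lam 1) !hornerD !hornerX -polyC1 !hornerC subrr mul0r addr0 => h.
apply/eqP; rewrite -subr_eq0 opprK; apply/eqP.
have e : \sum_(s < n.+1) s%:R^-1 = \sum_(s < n.+1) s%:R^-1 * 1 ^+ s :> F.
  by apply: eq_bigr => s _; rewrite expr1n mulr1.
by rewrite e; transitivity ((1 + 1) * lam 1 - (lam 1 - 2%:R * \sum_(s < n.+1) s%:R^-1 * 1 ^+ s)); [ring | rewrite h subrr].
Qed.
End Landen.

(** * Harmonic sums and the Fermat quotient of 2 *)

Lemma H1_split a b : H1 (a + b) = H1 a + \sum_(k < b) (a + k).+1%:R^-1.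
Proof. by rewrite /H1 big_split_ord. Qed.

Lemma alt_harmonic N : \sum_(k < N.*2) (-1) ^+ k / k.+1%:R = H1 N.*2 - H1 N.
Proof.
elim: N => [|N ih]; first by rewrite /H1 !big_ord0 subrr.
rewrite doubleS /H1 !big_ord_recr /= -/(H1 N) -/(H1 N.*2) ih.
have n1 : N.+1%:R != 0 :> rat by rewrite pnatr_eq0.
rewrite exprS -signr_odd odd_double expr0.
have -> : N.*2.+2%:R = 2%:R * N.+1%:R :> rat by rewrite -natrM mul2n.
have -> : (2%:R * N.+1%:R)^-1 = 2%:R^-1 * N.+1%:R^-1 :> rat by rewrite invfM.
by move: (N.*2.+1%:R^-1 : rat) (N.+1%:R^-1 : rat) => a b; field.
Qed.

(** With p = 4m + 1, the factor 1 - p / (2(m+k+1)) has an odd numerator below 2m, up to sign; the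
    odd numbers are collected into (2m)! / (2^m m!). *)
Lemma half_prod m : \prod_(k < m) (1 + - 2%:R^-1 * (4 * m).+1%:R * (m + k).+1%:R^-1) = (-1) ^+ m / 4%:R ^+ m :> rat.
Proof.
have e1 : \prod_(k < m) (1 + - 2%:R^-1 * (4 * m).+1%:R * (m + k).+1%:R^-1)
    = \prod_(k < m) ((- 2%:R^-1) * (m - k.+1).*2.+1%:R * (m + k).+1%:R^-1) :> rat.
  apply: eq_bigr => k _; have km := ltn_ord k.
  have n1 : (m + k).+1%:R != 0 :> rat by rewrite pnatr_eq0.
  have -> : (m - k.+1).*2.+1%:R = (4 * m).+1%:R - 2%:R * (m + k).+1%:R :> rat.
    by rewrite -natrM -natrB; [congr _%:R; lia | lia].
  by move: n1; move: ((m + k).+1%:R : rat) => b n1; field.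
rewrite e1 !big_split /= prodr_const card_ord.
have e2 : \prod_(k < m) (m - k.+1).*2.+1%:R = (m.*2)`!%:R / (2%:R ^+ m * m`!%:R) :> rat.
  rewrite (reindex_inj rev_ord_inj) /=.
  have -> : \prod_(j < m) (m - (m - j.+1).+1).*2.+1%:R = \prod_(j < m) (j.*2).+1%:R :> rat.
    by apply: eq_bigr => j _; congr (_.*2.+1%:R); have := ltn_ord j; lia.
  elim: (m) => [|k ih]; first by rewrite big_ord0 fact0 mul1r divr1.
  have fk := fact_neq0 k; have n2 : (2%:R : rat) ^+ k != 0 by rewrite expf_neq0.
  have k1 : k.+1%:R != 0 :> rat by rewrite pnatr_eq0.
  rewrite big_ord_recr /= ih doubleS !factS !natrM exprS.
  have -> : k.*2.+2%:R = 2%:R * k.+1%:R :> rat by rewrite -natrM mul2n.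
  by move: k1; move: (k.+1%:R : rat) => b k1; field; rewrite fk n2 k1.
have e3 N : \prod_(k < N) (m + k).+1%:R^-1 = m`!%:R / (m + N)`!%:R :> rat.
  elim: N => [|k ih]; first by rewrite big_ord0 addn0 divff // fact_neq0.
  by rewrite big_ord_recr /= ih addnS factS natrM invfM; ring.
have f1 := fact_neq0 m; have f2 := fact_neq0 m.*2; have n2 : (2%:R : rat) ^+ m != 0 by rewrite expf_neq0.
rewrite e2 e3 addnn [(- 2%:R^-1) ^+ m]exprNn exprVn (_ : 4%:R = 2%:R * 2%:R :> rat); last by ring.
by rewrite exprMn; field; rewrite f1 f2 n2.
Qed.

Lemma bin_row_sum q : 2%:R ^+ q.+1 = 2%:R + \sum_(k < q) 'C(q.+1, k.+1)%:R :> rat.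
Proof.
have b i : bump 0 i = i.+1 by [].
rewrite -[2%:R in LHS]/(1 + 1) exprDn big_ord_recl big_ord_recr /= !b.
rewrite !expr1n !mul1r bin0 binn mulr1n addrCA addrC; congr (_ + _).
by apply: eq_bigr => k _; rewrite b !expr1n mul1r.
Qed.

Section FermatQuotients.
Variables p m : nat.
Hypothesis p_pr : prime p.
Hypothesis ep : p = (4 * m).+1.

Local Notation n := m.*2.

Let en : p = n.*2.+1. Proof. by rewrite ep; lia. Qed.
Let m_gt0 : (0 < m)%N. Proof. by move: p_pr; rewrite ep; case: m. Qed.
Let p_gt3 : (3 < p)%N. Proof. lia. Qed.
Let n_even : ~~ odd n. Proof. by rewrite odd_double. Qed.
Let c2 : coprime 2 p. Proof. by rewrite coprime2n en /= odd_double. Qed.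
Let p0 : p%:R != 0 :> rat := p_neq0 p_pr.

Lemma eqm_divp k x y : eqm p k.+1 (p%:R * x) (p%:R * y) -> eqm p k x y.
Proof.
case=> z pz; rewrite -mulrBr exprS -mulrA => e; exists z => //.
by apply: (mulfI p0).
Qed.

Definition fq : rat := (2%:R ^+ p.-1 - 1) / p%:R.

Lemma fqE : 2%:R ^+ p.-1 = 1 + p%:R * fq.
Proof. by rewrite /fq mulrC divfK //; ring. Qed.

Lemma pint_fq : pint p fq.
Proof.
have : eqm p 1 (2%:R ^+ p.-1) 1.
  apply: (eqm_cancel p_pr c2); rewrite mulr1 -exprS prednK ?prime_gt0 //.
  exact: expn2_modp.
by case=> z pz e; rewrite /fq e expr1 mulrC mulKf.
Qed.

Lemma pint_H1 k : (k < p)%N -> pint p (H1 k).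
Proof.
by move=> kp; apply: pint_sum => i _; apply: pint_invS => //; have := ltn_ord i; lia.
Qed.

Lemma H1_predp : eqm p 1 (H1 p.-1) 0.
Proof.
apply: (eqm_cancel p_pr c2); rewrite mulr0.
have -> : 2%:R * H1 p.-1 = \sum_(k < p.-1) p%:R * (k.+1%:R^-1 * (p.-1 - k)%:R^-1).
  rewrite mulr_natl mulr2n {2}/H1 (reindex_inj rev_ord_inj) /= /H1 -big_split /=.
  apply: eq_bigr => k _; have kp := ltn_ord k.
  have -> : (p.-1 - k.+1).+1 = (p.-1 - k)%N by lia.
  have k0 : k.+1%:R != 0 :> rat by rewrite pnatr_eq0.
  have k1 : (p.-1 - k)%:R != 0 :> rat by rewrite pnatr_eq0; lia.
  have -> : p%:R = k.+1%:R + (p.-1 - k)%:R :> rat by rewrite -natrD; congr _%:R; lia.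
  by move: k0 k1; move: (k.+1%:R : rat) ((p.-1 - k)%:R : rat) => a b a0 b0; field; rewrite a0 b0.
rewrite -mulr_sumr; eexists; last by rewrite subr0 expr1.
apply: pint_sum => k _; have kp := ltn_ord k.
by apply: pintM; apply: pintV_lt => //; lia.
Qed.

(** Expanding 2^p = (1+1)^p and dividing by p gives 2 [fq] as a sum of C(p-1,k) / (k+1). Modulo p
    this is the alternating harmonic sum, [H1 p.-1] - [H1 n], and [H1 p.-1] vanishes. *)
Lemma H1_half : eqm p 1 (H1 n) (- (2%:R * fq)).
Proof.
have e : p%:R * (2%:R * fq) = \sum_(k < p.-1) 'C(p, k.+1)%:R.
  have := bin_row_sum p.-1; rewrite exprS fqE prednK ?prime_gt0 // => e.
  by apply: (addrI 2%:R); rewrite -e; ring.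
have e2 : 2%:R * fq = \sum_(k < p.-1) 'C(p.-1, k)%:R / k.+1%:R.
  apply: (mulfI p0); rewrite e mulr_sumr; apply: eq_bigr => k _.
  have k1 : k.+1%:R != 0 :> rat by rewrite pnatr_eq0.
  apply: (mulfI k1); rewrite -natrM -mul_bin_diag natrM.
  by field; rewrite addrC natr1.
apply: (@eqm_trans _ _ (H1 n - H1 p.-1)).
  rewrite -[X in eqm _ _ X _](subr0 (H1 n)); apply: eqmD; first exact: eqm_refl.
  exact/eqmN/eqm_sym/H1_predp.
rewrite -[_ - _]opprK; apply: eqmN.
have -> : - (H1 n - H1 p.-1) = \sum_(k < p.-1) (-1) ^+ k / k.+1%:R.
  by rewrite opprB en /= alt_harmonic.
rewrite e2; apply: eqm_sum => k _; have kp := ltn_ord k.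
apply: eqm_mulr; first by apply: pint_invS => //; lia.
by apply: eqm_sym; apply: bin_pred_modp => //; lia.
Qed.

Definition sigma1 : rat := \sum_(k < m) (m + k).+1%:R^-1.

Lemma sigE : sigma1 = H1 n - H1 m.
Proof. by rewrite -addnn H1_split addrC addKr. Qed.

Lemma pint_quarter k : (k < m)%N -> pint p (m + k).+1%:R^-1.
Proof. by move=> km; apply: pint_invS => //; lia. Qed.

Lemma pint_sig : pint p sigma1.
Proof. by apply: pint_sum => k _; apply: pint_quarter. Qed.

(** The common source of all expansions: natural arguments give binomials ([bin_Dprod]), -1 gives
    C(3m,m) ([bin3_Dprod]), and -1/2 gives 2^(p-1) ([Dprod_half]). *)
Definition Dprod (x : rat) : rat := \prod_(k < m) (1 + x * p%:R * (m + k).+1%:R^-1).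

Lemma Dprod_half : 2%:R ^+ p.-1 * Dprod (- 2%:R^-1) ^+ 2 = 1.
Proof.
rewrite /Dprod ep half_prod /= exprMn sqrr_sign mul1r exprM.
have n4 : (4%:R : rat) ^+ m != 0 by rewrite expf_neq0.
have -> : (2%:R ^+ 4) ^+ m = (4%:R ^+ m) ^+ 2 :> rat.
  by rewrite -[RHS]exprM mulnC exprM; congr (_ ^+ _); ring.
by field.
Qed.

Lemma pint_half : pint p 2%:R^-1. Proof. exact: pintV. Qed.

Lemma fq_sig : eqm p 1 fq sigma1.
Proof.
apply: eqm_divp; have ps := pint_sig; have pq := pint_fq; have ph := pint_half.
have d2 : eqm p 2 (Dprod (- 2%:R^-1)) (1 + - 2%:R^-1 * p%:R * sigma1).
  by apply: prod_taylor2 => [k _|]; [apply: pint_quarter | apply: pintN].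
have [z pz e] := d2; have := Dprod_half; rewrite fqE.
have -> : Dprod (- 2%:R^-1) = 1 + - 2%:R^-1 * p%:R * sigma1 + p%:R ^+ 2 * z by rewrite -e; ring.
set w := (_ + p%:R ^+ 2 * z) ^+ 2.
have [t pt et] : eqm p 2 ((1 + p%:R * fq) * w) (1 + p%:R * fq - p%:R * sigma1).
  exists (fq * (- sigma1) + (1 + p%:R * fq) * (2%:R^-1 ^+ 2 * sigma1 ^+ 2 + 2%:R * z + (- (p%:R * sigma1 * z)) + p%:R ^+ 2 * z ^+ 2)).
    by pint_tac.
  by rewrite /w; field.
move=> e1; rewrite e1 in et; exists (- t); first exact: pintN.
by rewrite mulrN -et; ring.
Qed.

Lemma acoef_binsq k : (k <= n)%N -> eqm p 1 (acoef n k) ('C(n, k)%:R ^+ 2).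
Proof.
move=> kn; rewrite /acoef natrM.
have -> : (-1) ^+ k * ('C(n, k)%:R * 'C(n + k, k)%:R) = 'C(n, k)%:R * ((-1) ^+ k * 'C(n + k, k)%:R) :> rat by ring.
rewrite expr2; apply: eqm_mull; first exact: pint_nat.
rewrite -gbin_neg -gbin_nat; apply: eqm_gbin => //; first by lia.
  by pint_tac.
exists (-1); first by pint_tac.
by rewrite en -!mul2n -!natr1 !natrM; ring.
Qed.

Lemma pint_uk k : pint p (u k).
Proof. exact: pint_u p_pr en k. Qed.

Lemma u_binsq k : (k <= n)%N -> eqm p 1 (u k) ('C(n, k)%:R ^+ 2).
Proof.
move=> kn; apply: eqm_trans (acoef_binsq kn).
by apply: (@eqm_leq p 1 2) => //; apply: (u_acoef p_pr en); lia.
Qed.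

(** The truncated integral of (F(x) - 1) / x, with F the series of the [u k]; the term k = 0 is zero
    because 0 has inverse 0. *)
Definition ulog (x : rat) : rat := \sum_(k < n.+1) u k / k%:R * x ^+ k.

Let pint_invk k : (k <= n)%N -> pint p k%:R^-1.
Proof.
case: k => [|k] kn; first by rewrite invr0; exact: pint0.
by apply: pint_invS => //; lia.
Qed.

Lemma pint_lam x : pint p x -> pint p (ulog x).
Proof.
move=> px; apply: pint_sum => k _; have kn : (k <= n)%N by rewrite -ltnS.
by have := pint_uk k; have := pint_invk kn => ? ?; pint_tac.
Qed.

Lemma sqrtN1_Fp : exists i : 'F_p, i ^+ 2 = -1.
Proof.
have cF : #|{: 'F_p}| = (n.*2).+1 by rewrite card_Fp.
have n0 : (0 < n)%N by rewrite double_gt0.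
have [z pz] := prim_rootF cF n0; exists (z ^+ m).
have e1 : (z ^+ n) ^+ 2 = 1 by rewrite -exprM muln2 prim_expr_order.
have e2 : z ^+ n != 1.
  rewrite -(prim_order_dvd pz); apply/negP => /dvdn_leq; lia.
rewrite -exprM muln2; move/eqP: e1; rewrite sqrf_eq1 (negPf e2) /= => /eqP //.
Qed.

Lemma red_lam (x : int) : red p (ulog x%:~R) = \sum_(s < n.+1) beta p n s / s%:R * (x%:~R) ^+ s.
Proof.
rewrite /ulog red_sum // => [|k _]; last first.
  have kn : (k <= n)%N by rewrite -ltnS.
  by have := pint_uk k; have := pint_invk kn => ? ?; pint_tac.
apply: eq_bigr => k _; have kn : (k <= n)%N by rewrite -ltnS.
have pu := pint_uk k; have pk := pint_invk kn.
rewrite redM //; [|by pint_tac|by pint_tac].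
rewrite redX //; last by pint_tac.
rewrite red_int // redM // (red_eqm p_pr _ (u_binsq kn)); last by pint_tac.
rewrite redX //; last by pint_tac.
rewrite red_nat //; congr (_ * _ * _).
have [->|k0] := posnP k; first by rewrite !invr0 (red_nat p_pr 0).
by rewrite redV // coprime_lt //; lia.
Qed.

Lemma red_invk k : (k <= n)%N -> red p k%:R^-1 = k%:R^-1.
Proof.
move=> kn; have [->|k0] := posnP k; first by rewrite !invr0 (red_nat p_pr 0).
by rewrite redV // coprime_lt //; lia.
Qed.

Lemma lam_2 : eqm p 1 (2%:R * ulog 2%:R) (ulog (-1) + 2%:R * sigma1).
Proof.
have [i i2] := sqrtN1_Fp; have := landen_log p_pr en i2.
have p1 := pint_lam (pintN (pint1 p)); have p2 := pint_lam (pint_nat p 2).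
have ps := pint_sig.
have r2 := red_lam 2; have r1 := red_lam (-1).
rewrite -(rmorphN1 (@intmul 'F_p 1)) -r1 -[2%:R]/((2%:Z)%:~R : 'F_p) -r2 => e.
have pS : pint p (\sum_(s < n.+1) s%:R^-1 * (-1) ^+ s).
  by apply: pint_sum => k _; have := @pint_invk k (ltn_ord k) => ?; pint_tac.
have eS : \sum_(s < n.+1) s%:R^-1 * (-1) ^+ s = - sigma1.
  rewrite sigE -alt_harmonic big_ord_recl invr0 mul0r add0r -sumrN; apply: eq_bigr => k _.
  by rewrite lift0 [(-1) ^+ k.+1]exprS; ring.
apply: (eqm_red p_pr); [by pint_tac | by pint_tac |].
rewrite (redM p_pr (pint_nat p 2) p2) (redD p_pr p1 (pintM (pint_nat p 2) ps)).
rewrite (redM p_pr (pint_nat p 2) ps) (red_nat p_pr 2).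
have rS : \sum_(s < n.+1) s%:R^-1 * (-1)%:~R ^+ s = - red p sigma1.
  rewrite -redN // -eS red_sum // => [|k _]; last first.
    by have := @pint_invk k (ltn_ord k) => ?; pint_tac.
  apply: eq_bigr => k _; have kn : (k <= n)%N by rewrite -ltnS.
  have := pint_invk kn => pk.
  rewrite redM //; last by pint_tac.
  by rewrite redX ?red_invk ?(red_int p_pr (-1)) //; pint_tac.
by rewrite -[LHS]/(2%Z%:~R * red p (ulog 2%:~R)) e rS mulrN opprK.
Qed.

Lemma lam_1 : eqm p 1 (ulog 1) (- (2%:R * H1 n)).
Proof.
have := landen_log1 p_pr en.
have p1 := pint_lam (pint1 p); have r1 := red_lam 1.
have np : (n < p)%N by lia.
have pH := pint_H1 np.
rewrite -[1 in LHS]/(1%Z%:~R : 'F_p) -r1 => e.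
apply: (eqm_red p_pr); [by [] | by pint_tac |].
rewrite redN //; last by pint_tac.
rewrite redM //; last by pint_tac.
rewrite (red_nat p_pr 2) -[LHS]/(red p (ulog 1%:~R)) e; congr (- (_ * _)).
rewrite big_ord_recl invr0 add0r /H1 red_sum // => [|k _]; last first.
  by apply: pint_invS => //; have := ltn_ord k; lia.
apply: eq_bigr => k _; rewrite lift0 redV // coprime_lt //; have := ltn_ord k; lia.
Qed.

(** This combination is the residue modulo p of the sum in [wr_flip] for N = p - 1; its vanishing
    rests on Landen's transformation at a square root of -1 and at 1. *)
Lemma lam_relation : eqm p 1 (2%:R * fq + 2%:R * ulog 2%:R - ulog (-1) - ulog 1) 0.
Proof.
apply: (@eqm_trans _ _ (2%:R * sigma1 + (ulog (-1) + 2%:R * sigma1) - ulog (-1) - - (2%:R * - (2%:R * fq)))).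
  apply: eqmD; last first.
    apply: eqmN; apply: (eqm_trans lam_1); apply: eqmN; apply: eqm_mull; first exact: pint_nat.
    exact: H1_half.
  apply: eqmD; last exact: eqm_refl.
  apply: eqmD; last exact: lam_2.
  by apply: eqm_mull; [exact: pint_nat | exact: fq_sig].
apply: (@eqm_trans _ _ (4%:R * sigma1 - 4%:R * fq)); first by apply: eqm_eq; ring.
rewrite -[X in eqm _ _ _ X](subrr (4%:R * fq)); apply: eqmD; last exact: eqm_refl.
by apply: eqm_mull; [exact: pint_nat | exact/eqm_sym/fq_sig].
Qed.

Lemma landen_H2 : eqm p 1 (2%:R * \sum_(k < n.+1) 'C(n, k)%:R ^+ 2 * H2 k * 2%:R ^+ k)
          (\sum_(k < n.+1) 'C(n, k)%:R ^+ 2 * H2 k * (-1) ^+ k).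
Proof.
have pH k : (k <= n)%N -> pint p (H2 k).
  by move=> kn; apply: pint_sum => j _; apply/pintX/pint_invS => //; have := ltn_ord j; lia.
have [i i2] := sqrtN1_Fp.
have := @landen_weighted p n p_pr en i i2 (fun k => red p (H2 k)).
have -> : red p (H2 0) = 0 by rewrite /H2 big_ord0 (red_nat p_pr 0).
have -> : red p (H2 n) = 0.
  rewrite (red_eqm p_pr _ (H2_half p_pr p_gt3 en)); [exact: (red_nat p_pr 0) | exact: pint0].
move/(_ erefl).
have hS j : (j < n)%N -> j.+1%:R ^+ 2 * (red p (H2 j.+1) - red p (H2 j)) = 1 :> 'F_p.
  move=> jn; have pj : pint p j.+1%:R^-1 by apply: pint_invS => //; lia.
  have := pH _ (ltnW jn) => pHj.
  rewrite /H2 big_ord_recr /= -/(H2 j) redD //; last by pint_tac.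
  rewrite addrAC subrr add0r redX // redV //; last by apply: coprime_lt => //; lia.
  by rewrite -exprMn divff ?expr1n //; apply/coprime_Fp/coprime_lt => //; lia.
move/(_ hS erefl n_even) => e.
have pF x k : pint p x -> (k <= n)%N -> pint p ('C(n, k)%:R ^+ 2 * H2 k * x ^+ k).
  by move=> px kn; have := pH k kn => ?; pint_tac.
have rF (x : int) : red p (\sum_(k < n.+1) 'C(n, k)%:R ^+ 2 * H2 k * x%:~R ^+ k) =
   \sum_(s < n.+1) beta p n s * red p (H2 s) * x%:~R ^+ s.
  rewrite red_sum // => [|k _]; last by apply: pF; [exact: pint_int | rewrite -ltnS].
  apply: eq_bigr => k _; have kn : (k <= n)%N by rewrite -ltnS.
  have := pH k kn => pHk.
  rewrite redM //; [|by pint_tac|by pint_tac].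
  rewrite redM //; last by pint_tac.
  rewrite !redX //; [|by pint_tac|by pint_tac].
  by rewrite red_int // red_nat.
have pF2 (x : int) : pint p (\sum_(k < n.+1) 'C(n, k)%:R ^+ 2 * H2 k * x%:~R ^+ k).
  by apply: pint_sum => k _; apply: pF; [exact: pint_int | rewrite -ltnS].
have := rF 2; have := rF (-1); have := pF2 2; have := pF2 (-1) => pa pb ra rb.
apply: (eqm_red p_pr); [by apply: pintM => //; exact: pint_nat | by [] |].
by rewrite redM // ?(red_nat p_pr 2) ?rb ?ra //; exact: pint_nat.
Qed.

Lemma Kp_Km_interp :
  let M := (n + p.*2)%N in
  eqm p 3 (8%:R * (Kp p + Km p))
    (18%:R * Phi n (- n.+1%:R) n%:R - 2%:R ^+ p.+1 * Phi n (- M.+1%:R) n%:R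
     + 2%:R * Phi n (- M.+1%:R) M%:R).
Proof. exact: (Kp_Km_block p_pr p_gt3 en n_even landen_H2). Qed.
End FermatQuotients.

(** * Values of the Wronskians *)

Lemma coef_poly_flip N (a : nat -> rat) j :
  ((\sum_(k < N) a k *: 'X^k) \Po (1 - 'X))`_j = \sum_(k < N) a k * ((-1) ^+ j * 'C(k, j)%:R).
Proof.
rewrite raddf_sum coef_sum; apply: eq_bigr => k _ /=.
by rewrite linearZ /= rmorphXn /= comp_polyX coefZ -[- 'X]scaleN1r coef_exp1cX.
Qed.

Section WronskianValues.
Variables p m : nat.
Hypothesis p_pr : prime p.
Hypothesis ep : p = (4 * m).+1.

Local Notation n := m.*2.
Local Notation q := (fq p).

Let en : p = n.*2.+1. Proof. by rewrite ep; lia. Qed.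
Let m_gt0 : (0 < m)%N. Proof. by move: p_pr; rewrite ep; case: m. Qed.
Let p_gt3 : (3 < p)%N. Proof. lia. Qed.
Let n_even : ~~ odd n. Proof. by rewrite odd_double. Qed.
Let c2 : coprime 2 p. Proof. by rewrite coprime2n en /= odd_double. Qed.
Let p0 : p%:R != 0 :> rat := p_neq0 p_pr.
Let pu k : pint p (u k) := pint_uk p_pr ep k.
Let pq : pint p q := pint_fq p_pr ep.

Lemma eqm_0 x y : pint p x -> pint p y -> eqm p 0 x y.
Proof. by move=> px py; exists (x - y); [pint_tac | rewrite expr0 mul1r]. Qed.

(** [v] inverts [x] only modulo p; an induction on k gains one factor p at a time. *)
Lemma eqm_cancel_unit k v x y z : pint p v -> eqm p 1 (v * x) 1 -> pint p y -> pint p z ->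
  eqm p k (x * y) (x * z) -> eqm p k y z.
Proof.
move=> pv [t pt et] py pz; elim: k => [|k ih] e; first exact: eqm_0.
have [w pw ew] := ih (eqm_leq (leqnSn k) e); case: e => s ps es.
exists (v * s - t * w); first by pint_tac.
transitivity (v * (x * y - x * z) - (v * x - 1) * (y - z)); first by ring.
by rewrite es et ew exprS; ring.
Qed.

Lemma u_small k : (n < k < p)%N -> eqm p 2 (u k) 0.
Proof. by case/andP=> nk kp; rewrite -(acoef_small nk); apply: (u_acoef p_pr en). Qed.

Lemma u_refl k : (k <= n)%N -> eqm p 1 (u (n - k)) (u k).
Proof.
move=> kn; apply: (eqm_trans (u_binsq p_pr ep (leq_subr k n))).
by rewrite bin_sub //; apply/eqm_sym/(u_binsq p_pr ep).
Qed.

Lemma Q_inv : pint p (2%:R ^+ p.-1)^-1 /\ eqm p 2 (2%:R ^+ p.-1)^-1 (1 - p%:R * q).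
Proof.
have pv : pint p (2%:R ^+ p.-1)^-1 by apply: pintVX.
split=> //; exists ((2%:R ^+ p.-1)^-1 * q ^+ 2); first by pint_tac.
have Q0 : 2%:R ^+ p.-1 != 0 :> rat by rewrite expf_neq0.
rewrite fqE // in Q0 *; by field.
Qed.

(** [u n] is the square of C(p-1,n) / 2^(p-1). To first order the binomial is 1 - p [H1 n], that is
    1 + 2pq, and the power of 2 is 1 + pq. *)
Lemma u_half : eqm p 2 (u n) (1 + 2%:R * p%:R * q).
Proof.
have [pv [t pt et]] := Q_inv.
have e1 : u n = ('C(p.-1, n)%:R * (2%:R ^+ p.-1)^-1) ^+ 2.
  have -> : p.-1 = n.*2 by lia.
  rewrite /u; congr ((_ * _^-1) ^+ 2).
  by rewrite -(mul2n n) exprM; congr (_ ^+ _); ring.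
have np : (n < p)%N by lia.
have [h ph eh] : eqm p 2 'C(p.-1, n)%:R (1 + 2%:R * p%:R * q).
  rewrite bin_pred_prod // -signr_odd (negPf n_even) mul1r.
  apply: (@eqm_trans _ _ (1 + (-1) * p%:R * H1 n)).
    apply: prod_taylor2 => [k _|]; last by pint_tac.
    by apply: pint_invS => //; have := ltn_ord k; lia.
  have := eqm_mulp 1 (H1_half p_pr ep); rewrite expr1 => [[z pz ez]].
  exists (- z); first exact: pintN.
  transitivity (- (p%:R * H1 n - p%:R * - (2%:R * q))); first by ring.
  by rewrite ez mulrN.
have e2 : 'C(p.-1, n)%:R = 1 + 2%:R * p%:R * q + p%:R ^+ 2 * h by rewrite -eh; ring.
have e3 : (2%:R ^+ p.-1)^-1 = 1 - p%:R * q + p%:R ^+ 2 * t by rewrite -et; ring.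
rewrite e1 e2 e3.
set x := (1 + _ + _); set y := (1 - _ + _).
have [s ps es] : eqm p 2 (x * y) (1 + p%:R * q).
  exists (h * y + (1 + 2%:R * p%:R * q) * t - 2%:R * q ^+ 2); first by rewrite /y; pint_tac.
  by rewrite /x /y; ring.
have -> : x * y = 1 + p%:R * q + p%:R ^+ 2 * s by rewrite -es; ring.
exists (q ^+ 2 + 2%:R * (1 + p%:R * q) * s + p%:R ^+ 2 * s ^+ 2); first by pint_tac.
ring.
Qed.

(** By [bin_centralS], (2p-1) C(2p-2,p-1) is half of p C(2p,p), so [A_ p.-1] is p^2 times an
    explicit square, which Wolstenholme's congruence evaluates. *)
Lemma A_predp : exists a, [/\ A_ p.-1 = p%:R ^+ 2 * a, pint p a & eqm p 2 a (1 - 4%:R * p%:R * q)].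
Proof.
have [pv [t pt et]] := Q_inv; have [w pw ew] := wolstenholme p_pr p_gt3 en.
have ph := pint_half p_pr ep.
pose b : rat := 'C(p.*2, p)%:R / 2%:R.
have eb : b = 1 + p%:R ^+ 3 * (w / 2%:R).
  rewrite /b (_ : 'C(p.*2, p)%:R = 2%:R + p%:R ^+ 3 * w); last by rewrite -ew; ring.
  by field.
have pb : pint p b by rewrite /b; pint_tac.
exists ((b * (2%:R ^+ p.-1)^-1 ^+ 2) ^+ 2); split; first last.
- have e3 : (2%:R ^+ p.-1)^-1 = 1 - p%:R * q + p%:R ^+ 2 * t by rewrite -et; ring.
  rewrite e3; set y := (1 - _ + _).
  have py : pint p y by rewrite /y; pint_tac.
  have [s ps es] : eqm p 2 (y ^+ 2) (1 - 2%:R * p%:R * q).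
    exists (q ^+ 2 + 2%:R * (1 - p%:R * q) * t + p%:R ^+ 2 * t ^+ 2); first by pint_tac.
    by rewrite /y; ring.
  have [s' ps' es'] : eqm p 2 (b * y ^+ 2) (1 - 2%:R * p%:R * q).
    exists (p%:R * (w / 2%:R) * y ^+ 2 + s); first by pint_tac.
    by rewrite mulrDr -es eb; ring.
  have -> : b * y ^+ 2 = 1 - 2%:R * p%:R * q + p%:R ^+ 2 * s' by rewrite -es'; ring.
  exists (4%:R * q ^+ 2 + 2%:R * (1 - 2%:R * p%:R * q) * s' + p%:R ^+ 2 * s' ^+ 2); first by pint_tac.
  ring.
- by pint_tac.
rewrite /A_ /u -exprMn -[RHS]exprMn; congr (_ ^+ 2).
have -> : 4%:R ^+ p.-1 = (2%:R ^+ p.-1) ^+ 2 :> rat.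
  by rewrite -exprM mulnC exprM; congr (_ ^+ _); ring.
rewrite [_^-1 ^+ 2]exprVn !mulrA; congr (_ * _); rewrite /b.
have h := bin_centralS p.-1; rewrite prednK ?prime_gt0 // in h.
have := congr1 (fun t : nat => t%:R : rat) h; rewrite !natrM => {}h.
by apply: (mulfI (_ : 2%:R != 0 :> rat)) => //; rewrite mulrA -h; field.
Qed.

(* Modulo [p], the recurrences for [u] upwards from [n + 1] and downwards from [p - 1]
   coincide. *)
Lemma u_tail j : (j < n)%N -> exists w,
  [/\ pint p w, eqm p 3 (u (n + j).+1) (p%:R ^+ 2 * w) & eqm p 3 (u (p.-1 - j)) (p%:R ^+ 2 * w)].
Proof.
elim: j => [|j ih] jn.
  exists 1; split; first exact: pint1.
  - rewrite mulr1; rewrite addn0; have c1 : coprime (n.+1 * 2 ^ 1) p.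
      by rewrite coprimeMl coprimeXl // andbT; apply: coprime_lt => //; lia.
    have c4 : coprime ((n.+1 * 2) ^ 2) p by apply: coprimeXl; rewrite expn1 in c1.
    apply: (eqm_cancel p_pr c4).
    have := uS n; rewrite -en mulnC natrX => ->.
    have [t pt et] := u_half; have -> : u n = 1 + 2%:R * p%:R * q + p%:R ^+ 2 * t by rewrite -et; ring.
    have -> : (n.+1 * 2)%:R = p%:R + 1 :> rat by rewrite en natr1; congr _%:R; lia.
    exists (2%:R * q + p%:R * t - p%:R - 2%:R); first by pint_tac.
    ring.
  rewrite subn0 mulr1.
  have [a [ea pa [t pt et]]] := A_predp.
  have c1 : coprime ((p.-1.*2.+1) ^ 2) p.
    apply: coprimeXl; rewrite coprime_sym prime_coprime //.
    have -> : (p.-1.*2.+1 = p + p.-1)%N by lia.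
    by rewrite dvdn_addr ?dvdnn //; apply/negP => /dvdn_leq; lia.
  apply: (eqm_cancel p_pr c1); rewrite natrX -/(A_ p.-1) ea.
  have -> : (p.-1.*2.+1)%:R = 2%:R * p%:R - 1 :> rat.
    by rewrite -natrM -[1]/(1%:R) -natrB; [congr _%:R; lia | lia].
  have -> : a = 1 - 4%:R * p%:R * q + p%:R ^+ 2 * t by rewrite -et; ring.
  exists (- 4%:R * q + p%:R * t - 4%:R * p%:R + 4%:R); first by pint_tac.
  ring.
have [w [pw e1 e2]] := ih (ltnW jn).
have c3 : coprime ((j.*2.+3) ^ 2) p by apply/coprimeXl/coprime_lt => //; lia.
have pV : pint p j.*2.+3%:R^-1 by apply: pintV_lt => //; lia.
have j3 : j.*2.+3%:R != 0 :> rat by rewrite pnatr_eq0.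
exists (w * (j.*2.+2%:R / j.*2.+3%:R) ^+ 2); split; first by pint_tac.
- apply: (eqm_cancel p_pr (_ : coprime ((2 * (n + j).+2) ^ 2) p)).
    apply: coprimeXl; rewrite coprime_sym prime_coprime //.
    have -> : (2 * (n + j).+2 = p + j.*2.+3)%N by lia.
    by rewrite dvdn_addr ?dvdnn //; apply/negP => /dvdn_leq; lia.
  have h := uS (n + j).+1; rewrite -addnS in h; rewrite natrX -addnS h addnS.
  have -> : ((n + j).+1.*2.+1)%:R = p%:R + j.*2.+2%:R :> rat by rewrite -natrD; congr _%:R; lia.
  have -> : (2 * (n + j).+2)%:R = p%:R + j.*2.+3%:R :> rat by rewrite -natrD; congr _%:R; lia.
  case: e1 => z pz ez; have -> : u (n + j).+1 = p%:R ^+ 2 * w + p%:R ^+ 3 * z by rewrite -ez; ring.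
  move: pV j3 (pint_nat p j.*2.+2) (pint_nat p j.*2.+3); move: (j.*2.+2%:R : rat) (j.*2.+3%:R : rat) => a b pV j3 pa pb.
  exists ((p%:R + a) ^+ 2 * z + w * (p%:R + 2%:R * a) - w * (a / b) ^+ 2 * (p%:R + 2%:R * b)); first by pint_tac.
  by field.
have c4 : coprime ((p.-1 - j.+1).*2.+1 ^ 2) p.
  apply: coprimeXl; rewrite coprime_sym prime_coprime //; apply/negP => d.
  have : (p %| (p.-1 - j.+1).*2.+1 + j.*2.+3)%N.
    by apply/dvdnP; exists 2; lia.
  by rewrite dvdn_addr // => /dvdn_leq; lia.
apply: (eqm_cancel p_pr c4); rewrite natrX -uS.
have -> : (p.-1 - j.+1).+1 = (p.-1 - j)%N by lia.
have -> : (2 * (p.-1 - j))%:R = 2%:R * p%:R - j.*2.+2%:R :> rat by rewrite -natrM -natrB; [congr _%:R; lia | lia].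
have -> : ((p.-1 - j.+1).*2.+1)%:R = 2%:R * p%:R - j.*2.+3%:R :> rat by rewrite -natrM -natrB; [congr _%:R; lia | lia].
case: e2 => z pz ez; have -> : u (p.-1 - j) = p%:R ^+ 2 * w + p%:R ^+ 3 * z by rewrite -ez; ring.
move: pV j3 (pint_nat p j.*2.+2) (pint_nat p j.*2.+3); move: (j.*2.+2%:R : rat) (j.*2.+3%:R : rat) => a b pV j3 pa pb.
exists ((2%:R * p%:R - a) ^+ 2 * z + w * (4%:R * p%:R - 4%:R * a) - w * (a / b) ^+ 2 * (4%:R * p%:R - 4%:R * b)); first by pint_tac.
by field.
Qed.

(** By [u_tail], [u] is symmetric modulo p^3 under k -> n + p - k on n < k < p. As n + p is odd, the
    alternating signs are opposite and the tail cancels against its reversal. *)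
Lemma Km_tail : eqm p 3 (Km p) (Km n.+1).
Proof.
apply: (eqm_cancel p_pr c2).
have -> : Km p = Km n.+1 + \sum_(j < n) u (n + j).+1 * (-1) ^+ j.+1.
  rewrite /Km (_ : p = n.+1 + n)%N; last lia.
  rewrite big_split_ord /=; congr (_ + _); apply: eq_bigr => j _.
  by rewrite addSn -[in RHS]addnS -addnS exprD -[(-1) ^+ n]signr_odd (negPf n_even) mul1r.
rewrite -[X in eqm _ _ _ X]addr0 mulrDr; apply: eqmD; first exact: eqm_refl.
rewrite mulr_natl mulr2n {2}(reindex_inj rev_ord_inj) /= -big_split /=.
have z0 : \sum_(j < n) 0 = 0 :> rat by rewrite big1.
rewrite -[X in eqm _ _ _ X]z0.
apply: eqm_sum => j _; have jn := ltn_ord j.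
have [w [pw [a pa ea] [b pb eb]]] := u_tail jn.
have -> : (n + (n - j.+1)).+1 = (p.-1 - j)%N by lia.
have -> : (n - j.+1).+1 = (n - j)%N by lia.
have -> : (-1) ^+ (n - j) = (-1) ^+ j :> rat.
  by rewrite -signr_odd oddB ?(ltnW jn) // (negPf n_even) signr_odd.
exists ((b - a) * (-1) ^+ j); first by pint_tac.
rewrite [(-1) ^+ j.+1]exprS.
transitivity (((u (p.-1 - j) - p%:R ^+ 2 * w) - (u (n + j).+1 - p%:R ^+ 2 * w)) * (-1) ^+ j); first by ring.
by rewrite ea eb; ring.
Qed.

Lemma legp_wide : legp n = \sum_(k < p) acoef n k *: 'X^k.
Proof.
rewrite (_ : p = n.+1 + n)%N; last lia.
rewrite big_split_ord /= [X in _ + X]big1 ?addr0 // => i _.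
by rewrite acoef_small ?scale0r // ltnS leq_addr.
Qed.

(** Modulo p^2, [U p] is the Legendre polynomial of even degree n, which is invariant under X -> 1 -
    X. *)
Lemma coef_U_flip k : (k < p)%N -> eqm p 2 ((U p \Po (1 - 'X))`_k) (u k).
Proof.
move=> kp; apply: (@eqm_trans _ _ (acoef n k)); last exact/eqm_sym/(u_acoef p_pr en).
have -> : acoef n k = (legp n \Po (1 - 'X))`_k.
  rewrite legp_flip -signr_odd (negPf n_even) scale1r legp_wide coef_sum.
  rewrite (bigD1 (Ordinal kp)) //= coefZ coefXn eqxx mulr1 big1 ?addr0 // => i ik.
  rewrite coefZ coefXn; case: eqP => [e|_]; last by rewrite mulr0.
  by case/eqP: ik; apply/val_inj.
rewrite legp_wide /U !coef_poly_flip; apply: eqm_sum => i _.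
by apply: eqm_mulr; [pint_tac | exact: (u_acoef p_pr en)].
Qed.

Local Notation lam := (ulog m).
Let plam x : pint p x -> pint p (lam x) := @pint_lam p m p_pr ep x.

Lemma lamE x : lam x = \sum_(k < n) u k.+1 / k.+1%:R * x ^+ k.+1.
Proof. by rewrite /ulog big_ord_recl invr0 mulr0 mul0r add0r. Qed.

Lemma big_three (F : nat -> rat) : \sum_(k < p) F k = F 0%N + \sum_(k < n) F k.+1 + \sum_(k < n) F (n + k).+1.
Proof. by rewrite en -addnn -addSn big_split_ord big_ord_recl. Qed.

Lemma pintV_shift k : (0 < k < p)%N -> pint p (p%:R + k%:R)^-1.
Proof.
move=> h; rewrite -natrD; apply: pintV => //; rewrite coprime_sym prime_coprime //.
by rewrite dvdn_addr ?dvdnn //; apply/negP => /dvdn_leq; lia.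
Qed.

(** [A_ p.-1] supplies p^2, so the sum in [wr_flip] matters only modulo p. Its term k = 0 gives 2q,
    the range up to n gives the three [ulog] values, the rest vanishes, and [lam_relation]
    applies. *)
Lemma wr_flip_mod : eqm p 3 (Wp p * Km p) (Kp p * Wm p).
Proof.
apply: (eqm_cancel p_pr c2).
have ev : ~~ odd p.-1 by rewrite en /= odd_double.
have := wr_flip ev; rewrite prednK ?prime_gt0 // => h.
have [a [ea pa _]] := A_predp.
pose c k := (U p \Po (1 - 'X))`_k.
have pc k : (k < p)%N -> pint p (c k) by move=> kp; apply: eqm_pint (coef_U_flip kp) (pu k).
have hs : eqm p 1 (\sum_(k < p) c k * (2%:R ^+ (p.-1 + k).+1 - (-1) ^+ k - 1) / (p.-1 + k).+1%:R) 0.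
  rewrite (big_three (fun k => c k * (2%:R ^+ (p.-1 + k).+1 - (-1) ^+ k - 1) / (p.-1 + k).+1%:R)).
  apply: eqm_trans (lam_relation p_pr ep).
  have -> : 2%:R * q + 2%:R * lam 2%:R - lam (-1) - lam 1 =
      2%:R * q + \sum_(k < n) u k.+1 * (2%:R ^+ k.+2 - (-1) ^+ k.+1 - 1) / k.+1%:R + \sum_(k < n) 0.
    rewrite [X in _ = _ + X]big1 // addr0 !lamE mulr_sumr -!addrA; congr (_ + _).
    rewrite -!sumrN -!big_split; apply: eq_bigr => k _ /=.
    by rewrite expr1n [2%:R ^+ k.+2]exprS; ring.
  have pn : (0 < p)%N by lia.
  have e2p : 2%:R ^+ p = 2%:R * (1 + p%:R * q) :> rat by rewrite -fqE // -exprS prednK.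
  apply: eqmD; first apply: eqmD.
  - rewrite addn0 prednK // expr0 e2p.
    have -> : c 0%N * (2%:R * (1 + p%:R * q) - 1 - 1) / p%:R = c 0%N * (2%:R * q) by field.
    rewrite -[X in eqm _ _ _ X]mul1r; apply: eqm_mulr; first by pint_tac.
    by rewrite -u0; apply: eqm_leq (coef_U_flip pn).
  - apply: eqm_sum => k _; have kn := ltn_ord k.
    have kp : (k.+1 < p)%N by lia.
    have e1 : (p.-1 + k.+1).+1 = (p + k.+1)%N by lia.
    rewrite e1 exprD e2p natrD.
    have ps : pint p (p%:R + k.+1%:R)^-1 by apply: pintV_shift; lia.
    have pk : pint p k.+1%:R^-1 by apply: pintV_lt => //; lia.
    have sn : p%:R + k.+1%:R != 0 :> rat by rewrite -natrD pnatr_eq0; lia.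
    have k0 : k.+1%:R != 0 :> rat by rewrite pnatr_eq0.
    have [z pz ez] := eqm_leq (isT : 1 <= 2)%N (coef_U_flip kp); rewrite -/(c _) in ez.
    have -> : c k.+1 = u k.+1 + p%:R ^+ 1 * z by rewrite -ez; ring.
    rewrite [2%:R ^+ k.+2]exprS; have := pu k.+1.
    move: (2%:R ^+ k.+1 : rat) ((-1) ^+ k.+1 : rat) (pintX k.+1 (pint_nat p 2)) (pintX k.+1 (pintN (pint1 p))) => x s px ps1 pu1.
    exists (z * (2%:R * (1 + p%:R * q) * x - s - 1) * (p%:R + k.+1%:R)^-1
       + u k.+1 * (2%:R * q * x) * (p%:R + k.+1%:R)^-1
       - u k.+1 * (2%:R * x - s - 1) * ((p%:R + k.+1%:R)^-1 * k.+1%:R^-1)); first by pint_tac.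
    by move: sn k0; move: (k.+1%:R : rat) => b sn k0; field; rewrite sn k0.
  apply: eqm_sum => k _; have kn := ltn_ord k.
  have kp : ((n + k).+1 < p)%N by lia.
  rewrite -mulrA -[X in eqm _ _ _ X](mul0r ((2%:R ^+ (p.-1 + (n + k).+1).+1 - (-1) ^+ (n + k).+1 - 1) / (p.-1 + (n + k).+1).+1%:R)).
  have e1 : (p.-1 + (n + k).+1).+1 = (p + (n + k).+1)%N by lia.
  apply: eqm_mulr.
    rewrite e1 natrD; have := @pintV_shift (n + k).+1; rewrite kp => /(_ isT) ?.
    by pint_tac.
  apply: (@eqm_leq p 1 2) => //; apply: (eqm_trans (coef_U_flip kp)); apply: u_small; lia.
case: hs => z pz; rewrite subr0 => ez.
rewrite ez ea in h; exists (a * z); first by pint_tac.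
by rewrite -mulrBr h; ring.
Qed.
(** In this sum and in the next two exactly one denominator is divisible by p. That term is kept
    apart, as it is not p-integral, and the others reduce to [ulog] at -1. *)
Lemma head_sum : exists t, pint p t /\
  Km n.+1 * Wm n.+1 = p%:R * u n + p%:R ^+ 2 * u n * (- (lam (-1) / 2%:R) + p%:R * t).
Proof.
have h := head_product n; rewrite -signr_odd (negPf n_even) mul1r in h.
have [t pt et] : eqm p 1 (\sum_(i < n) (-1) ^+ i.+1 * u i.+1 / (p%:R - 2%:R * i.+1%:R)) (- (lam (-1) / 2%:R)).
  rewrite lamE mulr_suml -sumrN; apply: eqm_sum => i _; have := ltn_ord i => hi.
  have e : p%:R - 2%:R * i.+1%:R = (p - i.+1.*2)%:R :> rat.
    by rewrite -natrM -natrB; [congr _%:R; lia | lia].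
  have pV : pint p (p%:R - 2%:R * i.+1%:R)^-1 by rewrite e; apply: pintV_lt => //; lia.
  have e0 : p%:R - 2%:R * i.+1%:R != 0 :> rat by rewrite e pnatr_eq0; lia.
  have pi : pint p i.+1%:R^-1 by apply: pintV_lt => //; lia.
  have i0 : i.+1%:R != 0 :> rat by rewrite pnatr_eq0.
  have ph := pint_half p_pr ep; have pui := pu i.+1.
  exists ((-1) ^+ i.+1 * u i.+1 * (2%:R^-1 * i.+1%:R^-1 * (p%:R - 2%:R * i.+1%:R)^-1)); first by pint_tac.
  by move: ((-1) ^+ i.+1 : rat) i0 e0; move: (i.+1%:R : rat) => a s a0 e0; field; rewrite a0 e0.
exists t; split=> //; rewrite h /A_ -en big_ord_recl /= u0 expr0 mulr0 subr0.
have -> : \sum_(i < n) (-1) ^+ bump 0 i * u (bump 0 i) / (p%:R - 2%:R * (bump 0 i)%:R)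
  = - (lam (-1) / 2%:R) + p%:R * t by rewrite -[p%:R * t]et; ring.
by field.
Qed.

Lemma tail_head_sum : exists t, pint p t /\
  \sum_(k < p) u k * (-1) ^+ (n + k).+1 / (n + k).+1%:R = - (u n / p%:R) + (lam (-1) + p%:R * t).
Proof.
have p_split (F : nat -> rat) : \sum_(k < p) F k = F n + (\sum_(k < n) F k + \sum_(k < n) F (n + k).+1).
  rewrite (_ : p = n + n.+1)%N; last lia.
  rewrite big_split_ord /= big_ord_recl addn0 addrCA; congr (_ + (_ + _)).
  by apply: eq_bigr => k _; rewrite lift0 addnS.
rewrite (p_split (fun k => u k * (-1) ^+ (n + k).+1 / (n + k).+1%:R)).
have sgn k : (-1) ^+ (n + k).+1 = - (-1) ^+ k :> rat.
  by rewrite exprS exprD -[(-1) ^+ n]signr_odd (negPf n_even); ring.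
have [t pt et] : eqm p 1 (\sum_(k < n) u k * (-1) ^+ (n + k).+1 / (n + k).+1%:R
    + \sum_(k < n) u (n + k).+1 * (-1) ^+ (n + (n + k).+1).+1 / (n + (n + k).+1).+1%:R) (lam (-1)).
  rewrite -[X in eqm _ _ _ X]addr0; apply: eqmD.
    rewrite lamE (reindex_inj rev_ord_inj) /=; apply: eqm_sum => k _; have := ltn_ord k => kn.
    rewrite sgn (_ : (-1) ^+ (n - k.+1) = (-1) ^+ k.+1 :> rat); last first.
      by rewrite -signr_odd oddB // (negPf n_even) signr_odd.
    have e1 : (n + (n - k.+1)).+1%:R = p%:R - k.+1%:R :> rat.
      by rewrite -natrB; [congr _%:R; lia | lia].
    have pV : pint p (p%:R - k.+1%:R)^-1 by rewrite -e1; apply: pintV_lt => //; lia.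
    have e0 : p%:R - k.+1%:R != 0 :> rat by rewrite -e1 pnatr_eq0.
    have pk : pint p k.+1%:R^-1 by apply: pintV_lt => //; lia.
    have k0 : k.+1%:R != 0 :> rat by rewrite pnatr_eq0.
    have [z pz ez] := u_refl kn; have -> : u (n - k.+1) = u k.+1 + p%:R ^+ 1 * z by rewrite -ez; ring.
    have puk := pu k.+1; rewrite e1.
    exists (- (-1) ^+ k.+1 * (z * (p%:R - k.+1%:R)^-1 + u k.+1 * ((p%:R - k.+1%:R)^-1 * k.+1%:R^-1))).
      by pint_tac.
    by move: ((-1) ^+ k.+1 : rat) k0 e0; move: (k.+1%:R : rat) => a s a0 e0; field; rewrite a0 e0.
  have z0 : \sum_(j < n) 0 = 0 :> rat by rewrite big1.
  rewrite -[X in eqm _ _ _ X]z0; apply: eqm_sum => k _; have := ltn_ord k => kn.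
  rewrite -mulrA -[X in eqm _ _ _ X](mul0r ((-1) ^+ (n + (n + k).+1).+1 / (n + (n + k).+1).+1%:R)).
  apply: eqm_mulr; last by apply: (@eqm_leq p 1 2) => //; apply: u_small; lia.
  have -> : (n + (n + k).+1).+1 = (p + k.+1)%N by lia.
  have kp : (0 < k.+1 < p)%N by lia.
  by rewrite natrD; have := pintV_shift kp => ?; pint_tac.
exists t; split=> //; rewrite sgn -[(-1) ^+ n]signr_odd (negPf n_even) expr0.
have -> : (n + n).+1%:R = p%:R :> rat by rewrite en addnn.
rewrite mulrN1 mulNr; congr (_ + _).
by rewrite -[p%:R * t]et; ring.
Qed.

Lemma head_tail_sum : exists t, pint p t /\
  \sum_(k < n.+1) u k * (-1) ^+ (p.-1 + k).+1 / (p.-1 + k).+1%:R = - (1 / p%:R) + (- lam (-1) + p%:R * t).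
Proof.
have sgn k : (-1) ^+ (p.-1 + k).+1 = - (-1) ^+ k :> rat.
  by rewrite exprS exprD -[(-1) ^+ p.-1]signr_odd en /= odd_double; ring.
have [t pt et] : eqm p 1 (\sum_(k < n) u k.+1 * (-1) ^+ (p.-1 + k.+1).+1 / (p.-1 + k.+1).+1%:R) (- lam (-1)).
  rewrite lamE -sumrN; apply: eqm_sum => k _; have := ltn_ord k => kn.
  rewrite sgn; have -> : (p.-1 + k.+1).+1 = (p + k.+1)%N by lia.
  have kp : (0 < k.+1 < p)%N by lia.
  have pV := pintV_shift kp; have pk := pintV_lt p_pr kp; have puk := pu k.+1.
  have e0 : p%:R + k.+1%:R != 0 :> rat by rewrite -natrD pnatr_eq0 addnS.
  have k0 : k.+1%:R != 0 :> rat by rewrite pnatr_eq0.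
  rewrite natrD; exists ((-1) ^+ k.+1 * u k.+1 * ((p%:R + k.+1%:R)^-1 * k.+1%:R^-1)); first by pint_tac.
  by move: ((-1) ^+ k.+1 : rat) k0 e0; move: (k.+1%:R : rat) => a s a0 e0; field; rewrite a0 e0.
exists t; split=> //; rewrite big_ord_recl /= sgn u0 expr0 addn0 prednK ?prime_gt0 //.
rewrite mul1r mulNr; congr (_ + _).
by rewrite -[p%:R * t]et /bump /=; ring.
Qed.

(** The values of [ulog] at -1 cancel, and so do the Fermat quotients: with u_n = 1 + 2pq and a = 1
    - 4pq to first order, 4 u_n - u_n^2 + a is 4. *)
Lemma wr_heads_mod :
  eqm p 3 (4%:R * (Km n.+1 * Wm n.+1) + 2%:R * (Km n.+1 * Wm p - Wm n.+1 * Km p)) (4%:R * p%:R).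
Proof.
have [t1 [p1 e1]] := head_sum; have [t2 [p2 e2]] := tail_head_sum; have [t3 [p3 e3]] := head_tail_sum.
have h := wr_heads n p.-1; rewrite prednK ?prime_gt0 // e2 e3 in h.
have [a [ea pa [t4 p4 e4]]] := A_predp; have [t0 pt0 e0] := u_half.
rewrite e1 h ea /A_ -en; have pl := plam (pintN (pint1 p)); have pun := pu n.
have eu : u n = 1 + 2%:R * p%:R * q + p%:R ^+ 2 * t0 by rewrite -e0; ring.
have ea' : a = 1 - 4%:R * p%:R * q + p%:R ^+ 2 * t4 by rewrite -e4; ring.
exists ((2%:R * t0 + t4 - (2%:R * q + p%:R * t0) ^+ 2)
  + (lam (-1) * (- 6%:R * q + p%:R * t4 - p%:R * t0) + u n * (4%:R * t1 + t2) - a * t3)).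
  by pint_tac.
by rewrite ea' eu; field.
Qed.
(** The value at -1 of [legp n]; since p = 2n + 1, it is [Phi n] at (n - p, n). *)
Definition Pc : rat := Phi n (- n.+1%:R) n%:R.

Let pPhi k x y : (k < p)%N -> pint p x -> pint p y -> pint p (Phi k x y).
Proof.
have pg z j : (j < p)%N -> pint p z -> pint p (gbin z j).
  move=> jp pz; apply: pintM; last exact: pint_factV.
  by apply: pint_prod => i _; pint_tac.
move=> kp px py; apply: pint_sum => j _; have jk : (j <= k)%N by rewrite -ltnS.
have h1 := pg x j (leq_ltn_trans jk kp) px.
have h2 := pg y (k - j)%N (leq_ltn_trans (leq_subr _ _) kp) py.
by pint_tac.
Qed.

Lemma pint_Pc : pint p Pc.
Proof. by apply: pPhi; [lia | pint_tac | pint_tac]. Qed.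

Lemma coprime_bin k j : (k < p)%N -> (j <= k)%N -> coprime 'C(k, j) p.
Proof.
move=> kp jk; apply: (@coprime_dvdl _ k`!); last exact: coprime_fact.
by rewrite -(bin_fact jk) dvdn_mulr.
Qed.

Lemma Pc_modp : eqm p 1 Pc ((-1) ^+ m * 'C(n, m)%:R).
Proof.
rewrite -Phi_diag; apply: eqm_sum => k _; have kn : (k <= n)%N by rewrite -ltnS.
have pg z j : (j < p)%N -> pint p z -> pint p (gbin z j).
  move=> jp pz; apply: pintM; last exact: pint_factV.
  by apply: pint_prod => i _; pint_tac.
apply: eqm_mulr; first by apply: pg; [lia | pint_tac].
apply: eqm_mull; first by pint_tac.
apply: eqm_gbin => //; [lia | by pint_tac |].
exists (-1); first by pint_tac.
by rewrite en -natr1 -!mul2n -natr1 !natrM; ring.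
Qed.

Lemma Pc_unit : exists2 v, pint p v & eqm p 1 (v * Pc) 1.
Proof.
have np : (n < p)%N by lia.
have mn : (m <= n)%N by lia.
have cb := coprime_bin np mn; have b0 := coprime_neq0 p_pr cb.
have pb := pintV p_pr cb.
exists ((-1) ^+ m / 'C(n, m)%:R); first by pint_tac.
apply: (@eqm_trans _ _ ((-1) ^+ m / 'C(n, m)%:R * ((-1) ^+ m * 'C(n, m)%:R))).
  by apply: eqm_mull; [pint_tac | exact: Pc_modp].
apply: eqm_eq; rewrite mulrA mulrAC divfK //.
by rewrite -expr2 sqrr_sign.
Qed.

Lemma U_horner_modp2 x : pint p x -> eqm p 2 ((U p).[x]) (legp n).[x].
Proof.
move=> px; rewrite hornerU -(@sum_acoef_small p n) //; apply: eqm_sum => k _.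
by apply: eqm_mulr; [pint_tac | exact: (u_acoef p_pr en)].
Qed.

Lemma Km_Pc : eqm p 2 (Km p) Pc.
Proof. by rewrite -KmE /Pc -horner_legpN1; apply: U_horner_modp2; pint_tac. Qed.

Lemma Kp_Pc : eqm p 2 (Kp p) Pc.
Proof.
have e := legp_at2 n; rewrite -[(-1) ^+ n]signr_odd (negPf n_even) mul1r in e.
by rewrite -KpE /Pc -horner_legpN1 -e; apply: U_horner_modp2; pint_tac.
Qed.

(** The K's equal [Pc] modulo p^2, and the W's are divisible by p because the unit [Pc] times each
    of them is. So every K may be replaced by [Pc] modulo p^3, and [Wm p] is eliminated between
    [wr_flip_mod] and [wr_heads_mod]. *)
Lemma Pc_W : eqm p 3 (Pc * (Wp p + Wm n.+1)) (2%:R * p%:R).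
Proof.
have pKm k : pint p (Km k) by apply: pint_sum => j _; have := pu j => ?; pint_tac.
have pWm k : pint p (Wm k) by apply: pint_sum => j _; have := pu j => ?; pint_tac.
have pKp : pint p (Kp p) by apply: pint_sum => j _; have := pu j => ?; pint_tac.
have pWp : pint p (Wp p) by apply: pint_sum => j _; have := pu j => ?; pint_tac.
have pP := pint_Pc; have [v pv ev] := Pc_unit.
have [s ps es] : eqm p 2 (Km n.+1) Pc.
  exact: eqm_trans (eqm_leq (isT : 2 <= 3)%N (eqm_sym Km_tail)) Km_Pc.
have [s1 ps1 es1] := Kp_Pc; have [r pr er] := Km_tail.
have eK1 : Kp p = Pc + p%:R ^+ 2 * s1 by rewrite -es1; ring.
have eK2 : Km n.+1 = Pc + p%:R ^+ 2 * s by rewrite -es; ring.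
have eK2' : Km p = Pc + p%:R ^+ 2 * s + p%:R ^+ 3 * r by rewrite -er -eK2; ring.
have small x : pint p x -> eqm p 1 (Pc * x) 0 -> exists2 w, pint p w & x = p%:R * w.
  move=> px e; have [w pw ew] : eqm p 1 x 0.
    by apply: (eqm_cancel_unit pv ev px (pint0 p)); rewrite mulr0.
  by exists w => //; rewrite -[p%:R * w]ew subr0.
have [w2 pw2 ew2] : exists2 w, pint p w & Wm n.+1 = p%:R * w.
  apply: small => //; have [t [pt et]] := head_sum; rewrite eK2 in et.
  have pl := plam (pintN (pint1 p)); have pun := pu n; have ph := pint_half p_pr ep.
  exists (u n + p%:R * u n * (- (lam (-1) / 2%:R) + p%:R * t) - p%:R * s * Wm n.+1); first by pint_tac.
  rewrite subr0; transitivity ((Pc + p%:R ^+ 2 * s) * Wm n.+1 - p%:R ^+ 2 * s * Wm n.+1); first by ring.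
  by rewrite et; ring.
have [t pt et] : eqm p 3 (Pc * (Wm n.+1 + Wm p)) (2%:R * p%:R - p%:R ^+ 2 * s * (Wm n.+1 + Wm p)).
  apply: (eqm_cancel p_pr c2); have [t pt et] := wr_heads_mod.
  rewrite eK2 eK2' in et; exists (t + 2%:R * Wm n.+1 * r); first by pint_tac.
  by rewrite [RHS]mulrDr -et; ring.
have [w3 pw3 ew3] : exists2 w, pint p w & Wm p = p%:R * w.
  apply: small => //.
  exists (2%:R - p%:R * s * (Wm n.+1 + Wm p) + p%:R ^+ 2 * t - Pc * w2); first by pint_tac.
  rewrite subr0; transitivity (Pc * (Wm n.+1 + Wm p) - Pc * Wm n.+1); first by ring.
  have -> : Pc * (Wm n.+1 + Wm p) = 2%:R * p%:R - p%:R ^+ 2 * s * (Wm n.+1 + Wm p) + p%:R ^+ 3 * t.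
    by rewrite -et; ring.
  by rewrite {2}ew2; ring.
have [z pz ez] := wr_flip_mod.
rewrite eK1 eK2' in ez.
have [w1 pw1 ew1] : exists2 w, pint p w & Wp p = p%:R * w.
  apply: small => //.
  exists (p%:R ^+ 2 * z + (Pc + p%:R ^+ 2 * s1) * w3 - p%:R * (s + p%:R * r) * Wp p); first by pint_tac.
  rewrite subr0.
  transitivity (Wp p * (Pc + p%:R ^+ 2 * s + p%:R ^+ 3 * r) - (Pc + p%:R ^+ 2 * s1) * Wm p + (Pc + p%:R ^+ 2 * s1) * Wm p
     - p%:R ^+ 2 * (s + p%:R * r) * Wp p); first by ring.
  by rewrite ez {1}ew3; ring.
exists (z + s1 * w3 - s * w1 - r * Wp p + t - s * (w2 + w3)); first by pint_tac.
transitivity ((Wp p * (Pc + p%:R ^+ 2 * s + p%:R ^+ 3 * r) - (Pc + p%:R ^+ 2 * s1) * Wm p)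
  + (Pc * (Wm n.+1 + Wm p) - (2%:R * p%:R - p%:R ^+ 2 * s * (Wm n.+1 + Wm p)))
  + p%:R ^+ 2 * (s1 * Wm p - s * Wp p - s * (Wm n.+1 + Wm p)) - p%:R ^+ 3 * r * Wp p); first by ring.
by rewrite ez et ew1 ew2 ew3; ring.
Qed.
End WronskianValues.

(** * Closed forms *)

Section ClosedForms.
Variables p m : nat.
Hypothesis p_pr : prime p.
Hypothesis ep : p = (4 * m).+1.

Local Notation n := m.*2.
Local Notation D := (Dprod p m).

Let en : p = n.*2.+1. Proof. by rewrite ep; lia. Qed.
Let m_gt0 : (0 < m)%N. Proof. by move: p_pr; rewrite ep; case: m. Qed.
Let n_even : ~~ odd n. Proof. by rewrite odd_double. Qed.
Let pE : p%:R = 2%:R * n%:R + 1 :> rat.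
Proof. by rewrite -natrM natr1 mul2n -en. Qed.

(** For x = j this compares (jp+N)! with (jp)! N!; for x = -j it does the same counting downwards
    from jp - 1. *)
Definition Gprod (x : rat) (N : nat) : rat := \prod_(k < N) (1 + x * p%:R * k.+1%:R^-1).

Lemma Gprod_S x N : Gprod x N.+1 * N.+1%:R = Gprod x N * (N.+1%:R + x * p%:R).
Proof.
have h : N.+1%:R != 0 :> rat by rewrite pnatr_eq0.
rewrite /Gprod big_ord_recr /=.
by move: h; move: (N.+1%:R : rat) => a h; field.
Qed.

Lemma Gprod_D x : Gprod x n = Gprod x m * D x.
Proof. by rewrite /Gprod -addnn big_split_ord. Qed.

Lemma fact_add_mulp j N : (j * p + N)`!%:R = (j * p)`!%:R * (N`!%:R * Gprod j%:R N) :> rat.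
Proof.
elim: N => [|N ih]; first by rewrite addn0 fact0 /Gprod big_ord0 !mulr1.
rewrite addnS !factS !natrM ih.
transitivity ((j * p)`!%:R * N`!%:R * (Gprod j%:R N.+1 * N.+1%:R) : rat); last by ring.
rewrite Gprod_S -addnS natrD natrM; ring.
Qed.

Lemma fact_mulp_sub j N : (N < j * p)%N ->
  (j * p).-1`!%:R = ((j * p).-1 - N)`!%:R * ((-1) ^+ N * N`!%:R * Gprod (- j%:R) N) :> rat.
Proof.
elim: N => [|N ih] hN; first by rewrite subn0 fact0 /Gprod big_ord0 !mulr1.
rewrite (ih (ltnW hN)).
have -> : ((j * p).-1 - N = ((j * p).-1 - N.+1).+1)%N by lia.
rewrite !factS !natrM [(-1) ^+ N.+1]exprS.
have -> : ((j * p).-1 - N.+1).+1%:R = j%:R * p%:R - N.+1%:R :> rat.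
  by rewrite -natrM -natrB; [congr _%:R; lia | lia].
transitivity (((j * p).-1 - N.+1)`!%:R * (- (-1) ^+ N * N`!%:R * (Gprod (- j%:R) N * (N.+1%:R + - j%:R * p%:R))) : rat).
  by ring.
by rewrite -Gprod_S; ring.
Qed.

Local Notation b := ('C(n, m)%:R : rat).

Lemma bE : b * m`!%:R ^+ 2 = n`!%:R.
Proof.
have mn : (m <= n)%N by lia.
by rewrite -(bin_fact mn) !natrM (_ : (n - m = m)%N); [ring | lia].
Qed.

Lemma bin_Dprod j : 'C(n + j * p, m)%:R = b * D j%:R.
Proof.
have h : (m <= n + j * p)%N by lia.
have e := congr1 (fun t : nat => t%:R : rat) (bin_fact h).
have e1 : (n + j * p - m = j * p + m)%N by lia.
rewrite /= e1 addnC !natrM !fact_add_mulp Gprod_D -bE in e; rewrite addnC.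
have f1 := fact_neq0 m; have f2 := fact_neq0 (j * p).
have g0 : Gprod j%:R m != 0.
  apply/eqP => g0; have := fact_add_mulp j m; rewrite g0 !mulr0 => /eqP.
  by rewrite (negPf (fact_neq0 _)).
move: e f1 f2 g0; move: (m`!%:R : rat) ((j * p)`!%:R : rat) (Gprod _ _) ('C(j * p + n, m)%:R : rat) (D _) b => a c g d x w e f1 f2 g0.
apply: (mulfI f1); apply: (mulfI f2); apply: (mulfI f1); apply: (mulfI g0).
transitivity (d * (a * (c * (a * g)))); [ring | rewrite e; ring].
Qed.

Lemma bin3_Dprod : 'C(3 * m, m)%:R = (-1) ^+ m * b * D (-1).
Proof.
have h : (m <= 3 * m)%N by lia.
have := congr1 (fun t : nat => t%:R : rat) (bin_fact h).
have -> : (3 * m - m = n)%N by lia.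
rewrite !natrM.
have m1 : (m < 1 * p)%N by lia.
have n1 : (n < 1 * p)%N by lia.
have e1 := fact_mulp_sub m1; have e2 := fact_mulp_sub n1.
rewrite e1 Gprod_D in e2.
have h1 : ((1 * p).-1 - m = 3 * m)%N by lia.
have h2 : ((1 * p).-1 - n = n)%N by lia.
rewrite h1 h2 -[(-1) ^+ n]signr_odd (negPf n_even) mul1r in e2.
have g0 : Gprod (- 1%:R) m != 0.
  by apply/eqP => g0; have := fact_neq0 (1 * p).-1; rewrite e1 g0 !mulr0 eqxx.
have f1 := fact_neq0 m; have f2 := fact_neq0 n; have bE' := bE.
have l2 := sqrr_sign rat m.
move: e2 f1 f2 g0 bE' l2.
move: ((3 * m)`!%:R : rat) (m`!%:R : rat) (n`!%:R : rat) (Gprod _ _) (D _) b ('C(3 * m, m)%:R : rat) ((-1) ^+ m : rat) => t a c g d w x l e2 f1 f2 g0 bE' l2 e.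
apply: (mulfI f1); apply: (mulfI f1); apply: (mulfI f2); apply: (mulfI g0).
transitivity (l ^+ 2 * (x * (a * c)) * a * g); first by rewrite l2; ring.
rewrite e; transitivity (l * (t * (l * a * g))); first by ring.
by rewrite e2; transitivity (l * c * (w * a ^+ 2) * (g * d)); [rewrite bE'; ring | ring].
Qed.

Definition phi0 : rat := (-1) ^+ m * b.

(** Coordinates around (n, n) in steps of p, where [quad_Phi] applies. As -n-1 = n - p, the negative
    arguments of [Phi] above become i = -1 and i = -3. *)
Definition Phij (i j : int) : rat := Phi n (n%:R + i%:~R * p%:R) (n%:R + j%:~R * p%:R).

Lemma Phij_diag (j : nat) : Phij j j = phi0 * D j%:R.
Proof.
rewrite /Phij -[(Posz j)%:~R]/(j%:R : rat) -natrM -natrD Phi_diag bin_Dprod /phi0; ring.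
Qed.

Lemma Phij_anti : Phij (-1) 1 = phi0 * (D (-1) * 2%:R ^+ p.-1).
Proof.
rewrite /Phij (_ : n%:R + (-1)%:~R * p%:R = - n.+1%:R); last first.
  by rewrite en -!natr1 -!mul2n !natrM; ring.
rewrite (_ : n%:R + 1%:~R * p%:R = (6 * m + 1)%:R).
  rewrite Phi_antidiag bin3_Dprod /phi0 ep /= [2%:R ^+ (4 * m)]exprM.
  by rewrite (_ : 2%:R ^+ 4 = 16%:R :> rat); ring.
by rewrite mul1r -natrD; congr _%:R; lia.
Qed.

Lemma Phij_sym i j : Phij i j = Phij j i.
Proof. by rewrite /Phij Phi_sym -signr_odd (negPf n_even) mul1r. Qed.

Lemma Phij_interp :
  [/\ eqm p 3 (8%:R * Phij (-1) 0) (13%:R * Phij 0 0 - 10%:R * Phij 1 1 + 3%:R * Phij 2 2 + 2%:R * Phij (-1) 1),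
      eqm p 3 (8%:R * Phij (-3) 0) (17%:R * Phij 0 0 - 42%:R * Phij 1 1 + 15%:R * Phij 2 2 + 18%:R * Phij (-1) 1)
    & eqm p 3 (8%:R * Phij (-3) 2) (- 35%:R * Phij 0 0 - 10%:R * Phij 1 1 + 3%:R * Phij 2 2 + 50%:R * Phij (-1) 1)].
Proof.
apply: quad_sym_interp => //; last exact: Phij_sym.
  by rewrite en /= odd_double.
by apply: quad_Phi => //; lia.
Qed.

Lemma Phij_Pc : Phij (-1) 0 = Pc m.
Proof.
rewrite /Phij /Pc; congr (Phi _ _ _); last by ring.
by rewrite -[n.+1%:R]natr1 pE; ring.
Qed.

Lemma Phij_J2 : Phij (-3) 0 = Phi n (- (n + p.*2).+1%:R) n%:R.
Proof.
rewrite /Phij; congr (Phi _ _ _); last by ring.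
by rewrite -[(n + p.*2).+1%:R]natr1 -(mul2n p) natrD natrM pE; ring.
Qed.

Lemma Phij_J1 : Phij (-3) 2 = Phi n (- (n + p.*2).+1%:R) (n + p.*2)%:R.
Proof.
rewrite /Phij; congr (Phi _ _ _); last by rewrite -(mul2n p) natrD natrM; ring.
by rewrite -[(n + p.*2).+1%:R]natr1 -(mul2n p) natrD natrM pE; ring.
Qed.
Let mE : p%:R = 4%:R * m%:R + 1 :> rat.
Proof. by rewrite -natrM natr1 -ep. Qed.

(** Here 6m + 1 = n + p, so C(6m,m) lies one step below [bin_Dprod] for j = 1; the linear factors in
    p come from m = (p-1)/4. In [bin10_1], 10m + 2 = n + 2p requires two steps. *)
Lemma bin6_1 : 2%:R * (1 - 3%:R * p%:R) * 'C(6 * m, m)%:R = (1 - 5%:R * p%:R) * (b * D 1) :> rat.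
Proof.
have := congr1 (fun t : nat => t%:R : rat) (mul_bin_down (6 * m).+1 m).
rewrite /= -[D 1]/(D 1%:R) -bin_Dprod (_ : n + 1 * p = (6 * m).+1)%N; last lia.
rewrite (_ : (6 * m).+1 - m = (5 * m).+1)%N; last lia.
rewrite !natrM -[(6 * m).+1%:R]natr1 -[(5 * m).+1%:R]natr1 !natrM => e.
transitivity (- 4%:R * ((6%:R * m%:R + 1) * 'C(6 * m, m)%:R) : rat); first by rewrite mE; ring.
by rewrite e mE; ring.
Qed.

Lemma bin10_1 : 4%:R * (1 - 5%:R * p%:R) * (3%:R - 5%:R * p%:R) * 'C(10 * m, m)%:R =
  (1 - 9%:R * p%:R) * (5%:R - 9%:R * p%:R) * (b * D 2%:R) :> rat.
Proof.
have := congr1 (fun t : nat => t%:R : rat) (mul_bin_down (10 * m).+2 m).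
have := congr1 (fun t : nat => t%:R : rat) (mul_bin_down (10 * m).+1 m).
rewrite /= -bin_Dprod (_ : n + 2 * p = (10 * m).+2)%N; last lia.
rewrite (_ : (10 * m).+1 - m = (9 * m).+1)%N; last lia.
rewrite (_ : (10 * m).+2 - m = (9 * m).+2)%N; last lia.
have o1 k : k.+1%:R = k%:R + 1 :> rat by rewrite natr1.
rewrite !natrM !o1 !natrM => e1 e2.
transitivity (16%:R * (10%:R * m%:R + 1 + 1) * ((10%:R * m%:R + 1) * 'C(10 * m, m)%:R) : rat).
  by rewrite mE; ring.
rewrite e1; transitivity (16%:R * (9%:R * m%:R + 1) * ((10%:R * m%:R + 1 + 1) * 'C((10 * m).+1, m)%:R) : rat); first by ring.
by rewrite e2 mE; ring.
Qed.

Lemma fact_predp : [/\ p.-1`!%:R = (3 * m)`!%:R * ((-1) ^+ m * m`!%:R * Gprod (-1) m) :> rat,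
   p.-1`!%:R = n`!%:R * (n`!%:R * Gprod (-1) n) :> rat & (1 * p)`!%:R = p%:R * p.-1`!%:R :> rat].
Proof.
have m1 : (m < 1 * p)%N by lia.
have n1 : (n < 1 * p)%N by lia.
have := fact_mulp_sub m1; have := fact_mulp_sub n1.
rewrite mul1n (_ : p.-1 - m = 3 * m)%N; last lia.
rewrite (_ : p.-1 - n = n)%N; last lia.
rewrite -[(-1) ^+ n]signr_odd (negPf n_even) mul1r => e1 e2; split=> //.
by rewrite -{1}[p]prednK ?prime_gt0 // factS natrM prednK ?prime_gt0.
Qed.

(** (6m+1)! = (p+n)! contains one factor p and (3m)! none. Because b m!^2 = n!, multiplying by b
    leaves only [Gprod] factors. *)
Lemma bin6_3 : (3%:R * p%:R - 1) * (b * 'C(6 * m, 3 * m)%:R) * Gprod (-1) n =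
  2%:R * p%:R * (Gprod 1 n * Gprod (-1) m ^+ 2).
Proof.
have [f1 f2 f3] := fact_predp; have f4 := fact_add_mulp 1 n; rewrite f3 in f4.
have h : (3 * m <= 6 * m)%N by lia.
have := congr1 (fun t : nat => t%:R : rat) (bin_fact h).
rewrite (_ : 6 * m - 3 * m = 3 * m)%N; last lia.
rewrite (_ : 1 * p + n = (6 * m).+1)%N in f4; last lia.
rewrite factS natrM -[(6 * m).+1%:R]natr1 !natrM in f4; rewrite !natrM => f5.
have c0 := fact_neq0 n; have t0 := fact_neq0 (3 * m); have l2 := sqrr_sign rat m; have a0 := fact_neq0 m.
move: bE f1 f2 f4 f5 c0 t0 l2 a0; move: (p.-1`!%:R : rat) ((3 * m)`!%:R : rat) (m`!%:R : rat) (n`!%:R : rat)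
  ((6 * m)`!%:R : rat) ((-1) ^+ m : rat) b ('C(6 * m, 3 * m)%:R : rat) (Gprod (-1) n) (Gprod (-1) m) (Gprod 1 n)
  => f t a c s l w x h1 g G eb f1 f2 f4 f5 c0 t0 l2 a0.
apply: (mulfI t0); apply: (mulfI t0); apply: (mulfI c0); apply: (mulfI c0); apply: (mulfI a0); apply: (mulfI a0).
transitivity (2%:R * ((6%:R * m%:R + 1) * (x * (t * t))) * (w * a ^+ 2) * (c * (c * h1))); first by rewrite mE; ring.
rewrite f5 f4 eb -f2; transitivity (2%:R * p%:R * G * c ^+ 2 * f ^+ 2); first by ring.
by rewrite f1 !exprMn l2; ring.
Qed.

Lemma bin10_3 : (5%:R * p%:R - 1) * (5%:R * p%:R - 3%:R) * (b * 'C(10 * m, 3 * m)%:R) * Gprod (-1) n =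
  - 2%:R * p%:R * (3%:R - 7%:R * p%:R) * (Gprod 2%:R n * Gprod (-1) m * Gprod (- 2%:R) m).
Proof.
have [f1 f2 f3] := fact_predp; have f4 := fact_add_mulp 2 n.
have m2 : (m < 2 * p)%N by lia.
have f6 := fact_mulp_sub m2.
have f7 : (2 * p)`!%:R = 2%:R * p%:R * (2 * p).-1`!%:R :> rat.
  by rewrite -{1}[(2 * p)%N]prednK; [rewrite factS !natrM prednK ?natrM //; lia | lia].
have h : (3 * m <= 10 * m)%N by lia.
have := congr1 (fun t : nat => t%:R : rat) (bin_fact h).
rewrite (_ : 10 * m - 3 * m = 7 * m)%N; last lia.
rewrite (_ : 2 * p + n = (10 * m).+2)%N in f4; last lia.
rewrite (_ : (2 * p).-1 - m = (7 * m).+1)%N in f6; last lia.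
have o1 k : k.+1%:R = k%:R + 1 :> rat by rewrite natr1.
rewrite f7 !factS !natrM !o1 !natrM in f4; rewrite factS !natrM !o1 !natrM in f6; rewrite !natrM => f5.
have c0 := fact_neq0 n; have t0 := fact_neq0 (3 * m); have t7 := fact_neq0 (7 * m); have l2 := sqrr_sign rat m; have a0 := fact_neq0 m.
move: bE f1 f2 f4 f5 f6 c0 t0 t7 l2 a0; move: (p.-1`!%:R : rat) ((3 * m)`!%:R : rat) ((7 * m)`!%:R : rat) ((2 * p).-1`!%:R : rat)
  (m`!%:R : rat) (n`!%:R : rat)
  ((10 * m)`!%:R : rat) ((-1) ^+ m : rat) b ('C(10 * m, 3 * m)%:R : rat) (Gprod (-1) n) (Gprod (-1) m) (Gprod 2%:R n) (Gprod (- 2%:R) m)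
  => f t t' F a c s l w x h1 g G g2 eb f1 f2 f4 f5 f6 c0 t0 t7 l2 a0.
apply: (mulfI t0); apply: (mulfI t7); apply: (mulfI c0); apply: (mulfI c0); apply: (mulfI a0); apply: (mulfI a0).
transitivity (4%:R * ((10%:R * m%:R + 1 + 1) * ((10%:R * m%:R + 1) * (x * (t * t')))) * (w * a ^+ 2) * (c * (c * h1))).
  by rewrite mE; ring.
rewrite f5 f4 eb -f2; transitivity (8%:R * p%:R * G * c ^+ 2 * F * f); first by ring.
transitivity (8%:R * p%:R * G * c ^+ 2 * (7%:R * m%:R + 1) * (l ^+ 2) * (t' * a * g2 * t * a * g)).
  by rewrite f1 f6; ring.
by rewrite l2 mE; ring.
Qed.

Lemma bin10_5 : 4%:R * (3%:R - 5%:R * p%:R) * 'C(10 * m, 5 * m)%:R * Gprod 1 m ^+ 2 =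
  'C(p.*2, p)%:R * b * (1 - 5%:R * p%:R) * Gprod 2%:R n.
Proof.
have f4 := fact_add_mulp 2 n; have f6 := fact_add_mulp 1 m.
have h : (5 * m <= 10 * m)%N by lia.
have := congr1 (fun t : nat => t%:R : rat) (bin_fact h).
have h2 : (p <= p.*2)%N by lia.
have := congr1 (fun t : nat => t%:R : rat) (bin_fact h2).
rewrite (_ : 10 * m - 5 * m = 5 * m)%N; last lia.
rewrite (_ : p.*2 - p = p)%N; last lia.
rewrite (_ : 2 * p + n = (10 * m).+2)%N in f4; last lia.
rewrite (_ : 1 * p + m = (5 * m).+1)%N in f6; last lia.
have o1 k : k.+1%:R = k%:R + 1 :> rat by rewrite natr1.
rewrite mul2n !factS !natrM !o1 !natrM in f4; rewrite mul1n factS !natrM !o1 !natrM in f6; rewrite !natrM => f7 f5.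
have q0 := fact_neq0 p; have t0 := fact_neq0 (5 * m); have a0 := fact_neq0 m.
have k0 : 5%:R * m%:R + 1 != 0 :> rat by rewrite -natrM natr1 pnatr_eq0.
move: bE f4 f5 f6 f7 q0 t0 a0; move: (p`!%:R : rat) (p.*2`!%:R : rat) ((5 * m)`!%:R : rat) (m`!%:R : rat) (n`!%:R : rat)
  ((10 * m)`!%:R : rat) b ('C(10 * m, 5 * m)%:R : rat) (Gprod 1 m) (Gprod 2%:R n) ('C(p.*2, p)%:R : rat)
  => f F t a c s w x g G v eb f4 f5 f6 f7 q0 t0 a0.
apply: (mulfI q0); apply: (mulfI q0); apply: (mulfI a0); apply: (mulfI a0); apply: (mulfI k0).
transitivity (- 8%:R * (5%:R * m%:R + 1) * (10%:R * m%:R + 1) * x * (f * (a * g)) ^+ 2).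
  by rewrite mE; ring.
rewrite -f6; transitivity (- 4%:R * (5%:R * m%:R + 1) ^+ 2 * ((10%:R * m%:R + 1 + 1) * ((10%:R * m%:R + 1) * (x * (t * t))))).
  ring.
rewrite f5 f4 -f7 -eb mE; ring.
Qed.
End ClosedForms.

(** * Comparison modulo p^3 *)

(** A second order expansion in p with p-integral coefficients, which are not unique. The rules
    below compute them by unification, so a congruence becomes at most three identities for
    [field]. *)
Definition taylor (p k : nat) (x a b c : rat) : Prop :=
  [/\ pint p a, pint p b & pint p c] /\ eqm p k x (a + p%:R * b + p%:R ^+ 2 * c).

Section Taylor.
Variables p k : nat.
Hypothesis p_pr : prime p.
Hypothesis k3 : (k <= 3)%N.

Lemma taylor_pint x a b c : taylor p k x a b c -> pint p x.
Proof. by case=> [[pa pb pc] e]; apply: eqm_pint e _; pint_tac. Qed.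

Lemma taylor_const x : pint p x -> taylor p k x x 0 0.
Proof.
move=> px; split; first by split; [ | exact: pint0 | exact: pint0].
by apply: eqm_eq; ring.
Qed.

Lemma taylor_p : taylor p k p%:R 0 1 0.
Proof.
split; first by split; [exact: pint0 | exact: pint1 | exact: pint0].
by apply: eqm_eq; ring.
Qed.

Lemma taylorD x a b c x' a' b' c' : taylor p k x a b c -> taylor p k x' a' b' c' ->
  taylor p k (x + x') (a + a') (b + b') (c + c').
Proof.
case=> [[pa pb pc] e] [[pa' pb' pc'] e']; split; first by split; pint_tac.
by apply: (eqm_trans (eqmD e e')); apply: eqm_eq; ring.
Qed.

Lemma taylorN x a b c : taylor p k x a b c -> taylor p k (- x) (- a) (- b) (- c).
Proof.
case=> [[pa pb pc] e]; split; first by split; pint_tac.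
by apply: (eqm_trans (eqmN e)); apply: eqm_eq; ring.
Qed.

Lemma taylorM x a b c x' a' b' c' : taylor p k x a b c -> taylor p k x' a' b' c' ->
  taylor p k (x * x') (a * a') (a * b' + b * a') (a * c' + b * b' + c * a').
Proof.
move=> t t'; have px := taylor_pint t; case: t t' => [[pa pb pc] e] [[pa' pb' pc'] e'].
split; first by split; pint_tac.
apply: (eqm_trans (eqmM e e' px _)); first by pint_tac.
apply: (eqm_leq k3); exists (b * c' + c * b' + p%:R * c * c'); first by pint_tac.
ring.
Qed.

Lemma taylor_sqr x a b c : taylor p k x a b c ->
  taylor p k (x ^+ 2) (a * a) (a * b + b * a) (a * c + b * b + c * a).
Proof. by move=> t; rewrite expr2; apply: taylorM. Qed.

End Taylor.

Lemma taylor_eqm3 p x y a b c a' b' c' : taylor p 3 x a b c -> taylor p 3 y a' b' c' ->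
  a = a' -> b = b' -> c = c' -> eqm p 3 x y.
Proof. by move=> [_ e] [_ e'] ea eb ec; rewrite -ea -eb -ec in e'; apply: eqm_trans e (eqm_sym e'). Qed.

Lemma taylor_eqm2 p x y a b c a' b' c' : taylor p 2 x a b c -> taylor p 2 y a' b' c' ->
  a = a' -> b = b' -> eqm p 2 x y.
Proof.
move=> [[_ _ pc] e] [[_ _ pc'] e'] ea eb; rewrite -{}ea -{}eb in e'.
apply: (eqm_trans e); apply: eqm_sym; apply: (eqm_trans e').
by exists (c' - c); [pint_tac | ring].
Qed.

Lemma taylor_eqm1 p k x y a b c : (0 < k)%N -> taylor p k x a b c -> a = y -> eqm p 1 x y.
Proof.
move=> k0 [[_ pb pc] e] <-; apply: (eqm_trans (eqm_leq k0 e)).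
by exists (b + p%:R * c); [pint_tac | ring].
Qed.

Ltac taylor_tac :=
  first [ match goal with H : taylor _ _ ?x _ _ _ |- taylor _ _ ?y _ _ _ => constr_eq x y; exact H end
  | lazymatch goal with
    | |- taylor ?p _ (_ + _) _ _ _ => eapply taylorD; taylor_tac
    | |- taylor ?p _ (- _) _ _ _ => eapply taylorN; taylor_tac
    | |- taylor ?p _ (_ * _) _ _ _ => eapply taylorM; [exact isT | taylor_tac | taylor_tac]
    | |- taylor ?p _ (_ ^+ 2) _ _ _ => eapply taylor_sqr; [exact isT | taylor_tac]
    | |- taylor ?p _ (GRing.natmul 1 ?p) _ _ _ => eapply taylor_p
    | |- _ => eapply taylor_const; pint_tac
    end].

(** * Expansions in p of the values of Phi and of the binomials *)

Section FinalCongruence.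
Variables p m : nat.
Hypothesis p_pr : prime p.
Hypothesis ep : p = (4 * m).+1.

Local Notation n := m.*2.
Local Notation D := (Dprod p m).
Local Notation Q := (2%:R ^+ p.-1 : rat).
Local Notation b := ('C(n, m)%:R : rat).
Local Notation s := (sigma1 m).
Local Notation G := (Gprod p).

Let en : p = n.*2.+1. Proof. by rewrite ep; lia. Qed.
Let m_gt0 : (0 < m)%N. Proof. by move: p_pr; rewrite ep; case: m. Qed.
Let p_gt3 : (3 < p)%N. Proof. lia. Qed.
Let c2 : coprime 2 p. Proof. by rewrite coprime2n en /= odd_double. Qed.
Let c3 : coprime 3 p. Proof. by apply: coprime_lt => //; lia. Qed.
Let ph2 : pint p 2%:R^-1 := pintV p_pr c2.
Let ph3 : pint p 3%:R^-1 := pintV p_pr c3.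
Let ps : pint p s := pint_sig p_pr ep.

Definition sigma2 : rat := \sum_(k < m) (m + k).+1%:R^-1 ^+ 2.
(** The second elementary symmetric function of the reciprocals of m+1, ..., 2m. *)
Definition e2 : rat := (s ^+ 2 - sigma2) / 2%:R.

Lemma pint_sig2 : pint p sigma2.
Proof. by apply: pint_sum => k _; apply/pintX/(pint_quarter p_pr ep). Qed.

Lemma pint_e2 : pint p e2.
Proof. by have := pint_sig2 => ?; rewrite /e2; pint_tac. Qed.
Let pe := pint_e2.

Lemma Dprod_taylor x : pint p x -> taylor p 3 (D x) 1 (x * s) (x ^+ 2 * e2).
Proof.
move=> px; split; first by split; pint_tac.
apply: (eqm_cancel p_pr c2).
have h := @prod_taylor3 p _ (index_enum 'I_m) xpredT (fun k => (m + k).+1%:R^-1) x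
  (fun k _ => pint_quarter p_pr ep (ltn_ord k)) px.
apply: (eqm_trans h); apply: eqm_eq; rewrite -/(sigma1 m) -/sigma2 /e2.
by field.
Qed.

(** Obtained by inverting the square of the expansion of [D] at -1/2, through [Dprod_half]. *)
Lemma Q_taylor : taylor p 3 Q 1 s (3%:R * 2%:R^-1 * 2%:R^-1 * s ^+ 2 - e2 * 2%:R^-1).
Proof.
set q2 := (3%:R * _ * _ * _ - _).
have pq2 : pint p q2 by rewrite /q2; pint_tac.
split; first by split; pint_tac.
have hD := Dprod_taylor (pintN ph2); have pD := taylor_pint hD.
have pQ : pint p Q by pint_tac.
have := Dprod_half ep; move: hD pD pQ ps pe pq2; rewrite {}/q2; move: (D _) Q s e2 => d x t e hD pD pQ pt pe' pq2 xd.
apply: (@eqm_cancel_unit p 3 1 (d ^+ 2)); try by pint_tac.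
  by eapply (@taylor_eqm1 p 3); [exact isT | taylor_tac | ring].
rewrite mulrC xd.
by eapply taylor_eqm3; [taylor_tac | taylor_tac | field | field | field].
Qed.
Let pb : pint p b := pint_nat p _.
Let pl : pint p ((-1) ^+ m). Proof. exact/pintX/pintN/pint1. Qed.

Local Notation f := (Phij p m).
Local Notation phi := (phi0 m).

Let pphi : pint p phi. Proof. exact: pintM. Qed.

Lemma Phij_taylor :
  [/\ taylor p 3 (8%:R * f (-1) 0) (phi * 8%:R) (phi * (- 4%:R * s)) (phi * (3%:R * e2 - s ^+ 2 * 2%:R^-1)),
      taylor p 3 (8%:R * f (-3) 0) (phi * 8%:R) (phi * (- 12%:R * s)) (phi * (27%:R * e2 - 9%:R * s ^+ 2 * 2%:R^-1))
    & taylor p 3 (8%:R * f (-3) 2) (phi * 8%:R) (phi * (- 4%:R * s)) (phi * (27%:R * e2 - 25%:R * s ^+ 2 * 2%:R^-1))].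
Proof.
have [i1 i2 i3] := Phij_interp p_pr ep.
have e0 : f 0 0 = phi * D 0 := Phij_diag p_pr ep 0.
have e1 : f 1 1 = phi * D 1 := Phij_diag p_pr ep 1.
have e2' : f 2 2 = phi * D 2%:R := Phij_diag p_pr ep 2.
have e3 := Phij_anti p_pr ep.
rewrite e0 e1 e2' e3 in i1 i2 i3.
have t0 := Dprod_taylor (pint0 p); have t1 := Dprod_taylor (pint1 p).
have t2 := Dprod_taylor (pint_nat p 2); have t3 := Dprod_taylor (pintN (pint1 p)).
have tq := Q_taylor.
move: i1 i2 i3 t0 t1 t2 t3 tq pphi ps pe.
move: (f (-1) 0) (f (-3) 0) (f (-3) 2) (D 0) (D 1) (D 2%:R) (D (-1)) Q s e2 phi.
move=> y1 y2 y3 d0 d1 d2 d3 q s e w i1 i2 i3 t0 t1 t2 t3 tq pw pt pe'.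
split; (split; [by split; pint_tac |]).
- apply: (eqm_trans i1); by eapply taylor_eqm3; [taylor_tac | taylor_tac | field | field | field].
- apply: (eqm_trans i2); by eapply taylor_eqm3; [taylor_tac | taylor_tac | field | field | field].
apply: (eqm_trans i3); by eapply taylor_eqm3; [taylor_tac | taylor_tac | field | field | field].
Qed.

Lemma KK_taylor : eqm p 3 (8%:R * (Kp p + Km p))
  (phi * (16%:R - 8%:R * (p%:R * s) + 2%:R * (p%:R ^+ 2 * e2) + p%:R ^+ 2 * s ^+ 2)).
Proof.
have [h1 h2 h3] := Phij_taylor; have tq := Q_taylor.
have := Kp_Km_interp p_pr ep; cbv zeta.
rewrite -/(Pc m) -(Phij_Pc p_pr ep) -(Phij_J1 p_pr ep) -(Phij_J2 p_pr ep) => i.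
have c8 : coprime 8 p by apply: (@coprimeXl 3 2).
apply: (eqm_cancel p_pr c8); apply: (eqm_trans (eqm_mull (pint_nat p 8) i)).
have eQ : 2%:R ^+ p.+1 = 4%:R * Q.
  by rewrite -{1}[p]prednK ?prime_gt0 // !exprS; ring.
rewrite eQ; move: h1 h2 h3 tq pphi ps pe.
move: (f (-1) 0) (f (-3) 0) (f (-3) 2) Q s e2 phi => y1 y2 y3 q s e w h1 h2 h3 tq pw pt pe'.
have -> : 8%:R * (18%:R * y1 - 4%:R * q * y2 + 2%:R * y3) =
  18%:R * (8%:R * y1) - 4%:R * q * (8%:R * y2) + 2%:R * (8%:R * y3) by ring.
by eapply taylor_eqm3; [taylor_tac | taylor_tac | field | field | field].
Qed.

Lemma Pc_taylor : eqm p 2 (8%:R * Pc m) (phi * (8%:R - 4%:R * (p%:R * s))).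
Proof.
have [[_ h1] _ _] := Phij_taylor; rewrite (Phij_Pc p_pr ep) in h1.
apply: (eqm_trans (eqm_leq (isT : 2 <= 3)%N h1)).
exists (phi * (3%:R * e2 - s ^+ 2 * 2%:R^-1)); first by pint_tac.
ring.
Qed.

Lemma bin6_1_taylor : taylor p 3 'C(6 * m, m)%:R (b * 2%:R^-1) (b * 2%:R^-1 * (s - 2%:R))
  (b * 2%:R^-1 * (e2 - 2%:R * s - 6%:R)).
Proof.
split; first by split; pint_tac.
have t := Dprod_taylor (pint1 p); have h := bin6_1 p_pr ep; have px := pint_nat p 'C(6 * m, m).
apply: (@eqm_cancel_unit p 3 2%:R^-1 (2%:R * (1 - 3%:R * p%:R))); try by pint_tac.
  by eapply (@taylor_eqm1 p 3); [exact isT | taylor_tac | field].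
rewrite h; move: t ps pe pb; move: (D 1) s e2 b => d s e w t pt pe' pw.
by eapply taylor_eqm3; [taylor_tac | taylor_tac | field | field | field].
Qed.

(** The coefficients are those of b D(2) times the quotient of the linear factors in [bin10_1];
    inverses of 2 and 3 are kept as separate factors, so that integrality can be read off. *)
Lemma bin10_1_taylor : taylor p 3 'C(10 * m, m)%:R (b * 5%:R * (2%:R^-1 * 2%:R^-1 * 3%:R^-1))
  (b * (5%:R * 2%:R^-1 * 3%:R^-1 * s - 31%:R * (2%:R^-1 * 3%:R^-1 * 3%:R^-1)))
  (b * (5%:R * 3%:R^-1 * e2 - 31%:R * (3%:R^-1 * 3%:R^-1) * s - 443%:R * (2%:R^-1 * 3%:R^-1 * 3%:R^-1 * 3%:R^-1))).
Proof.
split; first by split; pint_tac.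
have t := Dprod_taylor (pint_nat p 2); have h := bin10_1 p_pr ep; have px := pint_nat p 'C(10 * m, m).
apply: (@eqm_cancel_unit p 3 (2%:R^-1 * 2%:R^-1 * 3%:R^-1) (4%:R * (1 - 5%:R * p%:R) * (3%:R - 5%:R * p%:R))); try by pint_tac.
  by eapply (@taylor_eqm1 p 3); [exact isT | taylor_tac | field].
rewrite h; move: t ps pe pb; move: (D _) s e2 b => d s e w t pt pe' pw.
by eapply taylor_eqm3; [taylor_tac | taylor_tac | field | field | field].
Qed.
Lemma Gprod_taylor x N : (N < p)%N -> pint p x -> taylor p 2 (G x N) 1 (x * H1 N) 0.
Proof.
move=> Np px; have pH := pint_H1 p_pr ep Np; split; first by split; [exact: pint1 | exact: pintM | exact: pint0].
apply: (eqm_trans (prod_taylor2 _ _ px)).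
  by move=> k _; apply: pint_invS => //; have := ltn_ord k; lia.
by apply: eqm_eq; rewrite -/(H1 N); ring.
Qed.

Let nltp : (n < p)%N. Proof. lia. Qed.
Let mltp : (m < p)%N. Proof. lia. Qed.

Lemma bin6_3_taylor : eqm p 3 (b * 'C(6 * m, 3 * m)%:R)
  (p%:R * (- 2%:R * (1 + 3%:R * p%:R + 2%:R * p%:R * s))).
Proof.
have px : pint p (b * 'C(6 * m, 3 * m)%:R) by pint_tac.
have h := bin6_3 p_pr ep; have pH := pint_H1 p_pr ep nltp; have pK := pint_H1 p_pr ep mltp.
have th := Gprod_taylor nltp (pintN (pint1 p)); have tG := Gprod_taylor nltp (pint1 p).
have tg := Gprod_taylor mltp (pintN (pint1 p)); have ph := taylor_pint th.
apply: (@eqm_cancel_unit p 3 (-1) ((3%:R * p%:R - 1) * G (-1) n)); try by pint_tac.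
  by move: th pH; move: (G (-1) n) (H1 n) => x H th pH; eapply (@taylor_eqm1 p 2); [exact isT | taylor_tac | field].
rewrite mulrAC h [in X in eqm _ _ _ X]mulrCA -[2%:R * p%:R]mulrC -mulrA.
(* The explicit factor p leaves a congruence modulo p^2, for which first order expansions of [Gprod]
   suffice. *)
apply: (@eqm_mulp p 1 2); rewrite sigE.
move: th tG tg pH pK; move: (G (-1) n) (G 1 n) (G (-1) m) (H1 n) (H1 m) => g1 g2 g3 H K th tG tg pH pK.
by eapply taylor_eqm2; [taylor_tac | taylor_tac | field | field].
Qed.

Lemma bin10_3_taylor : eqm p 3 (b * 'C(10 * m, 3 * m)%:R)
  (p%:R * (- 2%:R * (1 + 13%:R * 3%:R^-1 * p%:R + 3%:R * p%:R * s))).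
Proof.
have px : pint p (b * 'C(10 * m, 3 * m)%:R) by pint_tac.
have h := bin10_3 p_pr ep; have pH := pint_H1 p_pr ep nltp; have pK := pint_H1 p_pr ep mltp.
have th := Gprod_taylor nltp (pintN (pint1 p)); have tG := Gprod_taylor nltp (pint_nat p 2).
have tg := Gprod_taylor mltp (pintN (pint1 p)); have tk := Gprod_taylor mltp (pintN (pint_nat p 2)).
have ph := taylor_pint th.
apply: (@eqm_cancel_unit p 3 3%:R^-1 ((5%:R * p%:R - 1) * (5%:R * p%:R - 3%:R) * G (-1) n)); try by pint_tac.
  by move: th pH; move: (G (-1) n) (H1 n) => x H th pH; eapply (@taylor_eqm1 p 2); [exact isT | taylor_tac | field].
rewrite mulrAC h [in X in eqm _ _ _ X]mulrCA -[- 2%:R * p%:R]mulrC -!mulrA.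
apply: (@eqm_mulp p 1 2); rewrite sigE.
move: th tG tg tk pH pK; move: (G (-1) n) (G 2%:R n) (G (-1) m) (G (- 2%:R) m) (H1 n) (H1 m) => g1 g2 g3 g4 H K th tG tg tk pH pK.
by eapply taylor_eqm2; [taylor_tac | taylor_tac | field | field].
Qed.

Lemma Gprod2_sqr : eqm p 3 (G 2%:R m) (G 1 m ^+ 2 * (1 - p%:R ^+ 2 * H2 m)).
Proof.
have pk (k : 'I_m) : pint p k.+1%:R^-1 by apply: pint_invS => //; have := ltn_ord k; lia.
have pK := pint_H1 p_pr ep mltp.
have pK2 : pint p (H2 m) by apply: pint_sum => k _; apply/pintX/pk.
have h1 := @prod_taylor3 p _ (index_enum 'I_m) xpredT (fun k => k.+1%:R^-1) 1 (fun k _ => pk k) (pint1 p).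
have h2 := @prod_taylor3 p _ (index_enum 'I_m) xpredT (fun k => k.+1%:R^-1) 2%:R (fun k _ => pk k) (pint_nat p 2).
have c4 : coprime 4 p by apply: (@coprimeXl 2 2).
rewrite -/(G _ m) -/(H1 m) -/(H2 m) in h1 h2.
have t1 : taylor p 3 (2%:R * G 1 m) 2%:R (2%:R * H1 m) (H1 m ^+ 2 - H2 m).
  split; first by split; pint_tac.
  by apply: (eqm_trans h1); apply: eqm_eq; ring.
have t2 : taylor p 3 (2%:R * G 2%:R m) 2%:R (4%:R * H1 m) (4%:R * (H1 m ^+ 2 - H2 m)).
  split; first by split; pint_tac.
  by apply: (eqm_trans h2); apply: eqm_eq; ring.
apply: (eqm_cancel p_pr c4).
move: t1 t2 pK pK2; move: (G 1 m) (G 2%:R m) (H1 m) (H2 m) => x y H K t1 t2 pK pK2.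
have -> : 4%:R * (x ^+ 2 * (1 - p%:R ^+ 2 * K)) = (2%:R * x) ^+ 2 * (1 - p%:R ^+ 2 * K) by ring.
have -> : 4%:R * y = 2%:R * (2%:R * y) by ring.
by eapply taylor_eqm3; [taylor_tac | taylor_tac | field | field | field].
Qed.

(** Since [H2 n] vanishes modulo p, [H2 m] is minus the sum of squares over the second quarter,
    which [e2] and [sigma1] express. *)
Lemma H2_quarter : eqm p 1 (H2 m) (2%:R * e2 - s ^+ 2).
Proof.
have [z pz ez] := H2_half p_pr p_gt3 en; exists z => //; rewrite -ez subr0.
rewrite /e2; have -> : H2 n = H2 m + sigma2 by rewrite /H2 /sigma2 -addnn big_split_ord.
by field.
Qed.

Lemma bin10_5_taylor : taylor p 3 'C(10 * m, 5 * m)%:R (b * (2%:R^-1 * 3%:R^-1))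
  (b * (3%:R^-1 * s - 5%:R * 3%:R^-1 * 3%:R^-1))
  (b * (s ^+ 2 * 2%:R^-1 * 3%:R^-1 + e2 * 3%:R^-1 - 10%:R * 3%:R^-1 * 3%:R^-1 * s - 25%:R * (3%:R^-1 * 3%:R^-1 * 3%:R^-1))).
Proof.
split; first by split; pint_tac.
have h := bin10_5 p_pr ep; have px := pint_nat p 'C(10 * m, 5 * m).
have pG x : pint p x -> pint p (G x m).
  by move=> pxx; apply: pint_prod => k _; have := pint_invS p_pr (leq_ltn_trans (ltn_ord k) mltp) => ?; pint_tac.
have g1 := pG _ (pint1 p); have g2 := pG _ (pint_nat p 2).
have t1 := Gprod_taylor mltp (pint1 p); have pK := pint_H1 p_pr ep mltp.
have t2 := Dprod_taylor (pint_nat p 2); have pD := taylor_pint t2.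
apply: (@eqm_cancel_unit p 3 (2%:R^-1 * 2%:R^-1 * 3%:R^-1) (4%:R * (3%:R - 5%:R * p%:R) * G 1 m ^+ 2)); try by pint_tac.
  by move: t1 pK; move: (G 1 m) (H1 m) => x H t1 pK; eapply (@taylor_eqm1 p 2); [exact isT | taylor_tac | field].
rewrite mulrAC h Gprod_D.
have w := wolstenholme p_pr p_gt3 en.
apply: (@eqm_trans _ _ (2%:R * b * (1 - 5%:R * p%:R) * (G 1 m ^+ 2 * (1 - p%:R ^+ 2 * (2%:R * e2 - s ^+ 2)) * D 2%:R))).
  apply: eqmM.
  - by apply: eqm_mulr; [pint_tac | apply: eqm_mulr => //].
  - apply: eqm_mulr => //; apply: (eqm_trans Gprod2_sqr); apply: eqm_mull; first by pint_tac.
    by apply: eqmD; [exact: eqm_refl | apply: eqmN; apply: (@eqm_mulp p 2 1); exact: H2_quarter].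
  - by have := pint_nat p 'C(p.*2, p) => ?; pint_tac.
  - by pint_tac.
move: g1 t2 ps pe pb; move: (G 1 m) (D _) s e2 b => x d s e v g1 t2 pt pe' pv.
have -> : 2%:R * v * (1 - 5%:R * p%:R) * (x ^+ 2 * (1 - p%:R ^+ 2 * (2%:R * e - s ^+ 2)) * d) =
  x ^+ 2 * (2%:R * v * (1 - 5%:R * p%:R) * ((1 - p%:R ^+ 2 * (2%:R * e - s ^+ 2)) * d)) by ring.
rewrite [4%:R * _ * _]mulrC -[x ^+ 2 * _ * _]mulrA.
apply: eqm_mull; first by pint_tac.
by eapply taylor_eqm3; [taylor_tac | taylor_tac | field | field | field].
Qed.
End FinalCongruence.

(** * Comparison of the Jacobsthal sum with the truncated series *)

Section Main.
Variables p m : nat.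
Hypothesis p_pr : prime p.
Hypothesis ep : p = (4 * m).+1.

Local Notation n := m.*2.
Local Notation b := ('C(n, m)%:R : rat).
Local Notation s := (sigma1 m).
Local Notation e := (e2 m).
Local Notation l := ((-1) ^+ m : rat).

Let en : p = n.*2.+1. Proof. by rewrite ep; lia. Qed.
Let m_gt0 : (0 < m)%N. Proof. by move: p_pr; rewrite ep; case: m. Qed.
Let c2 : coprime 2 p. Proof. by rewrite coprime2n en /= odd_double. Qed.
Let c3 : coprime 3 p. Proof. by apply: coprime_lt => //; lia. Qed.
Let ph2 : pint p 2%:R^-1 := pintV p_pr c2.
Let ph3 : pint p 3%:R^-1 := pintV p_pr c3.
Let ps : pint p s := pint_sig p_pr ep.
Let pe : pint p e := pint_e2 p_pr ep.

(** By [jac_modp3], (p-1) (-1)^m times this is 8 times the Jacobsthal sum modulo p^3. *)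
Definition trace : rat :=
  15%:R * 'C(2 * m, m)%:R
     - 10%:R * (2%:R * 'C(6 * m, m)%:R + 'C(6 * m, 3 * m)%:R)
     + 3%:R * (2%:R * 'C(10 * m, m)%:R + 2%:R * 'C(10 * m, 3 * m)%:R + 'C(10 * m, 5 * m)%:R).

(** Of C(6m,3m) and C(10m,3m) only the products with b have been expanded. They yield the terms free
    of b, matched by [phi_W]; the multiple of b^2 is matched by [KK_taylor]. *)
Lemma trace_taylor : eqm p 3 (2%:R * (1 - p%:R) * (b * trace))
  (b ^+ 2 * (16%:R - 8%:R * (p%:R * s) + 2%:R * (p%:R ^+ 2 * e) + p%:R ^+ 2 * s ^+ 2)
   + p%:R * (16%:R + 8%:R * (p%:R * s))).
Proof.
have t1 := bin6_1_taylor p_pr ep; have t2 := bin10_1_taylor p_pr ep; have t3 := bin10_5_taylor p_pr ep.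
have h4 := bin6_3_taylor p_pr ep; have h5 := bin10_3_taylor p_pr ep.
rewrite /trace mul2n.
have -> (c6 c63 c10 c103 c105 : rat) : b * (15%:R * b - 10%:R * (2%:R * c6 + c63) + 3%:R * (2%:R * c10 + 2%:R * c103 + c105)) =
  b * (15%:R * b - 20%:R * c6 + 6%:R * c10 + 3%:R * c105) - 10%:R * (b * c63) + 6%:R * (b * c103) by ring.
have := pint_nat p 'C(n, m).
move: t1 t2 t3 h4 h5 ps pe.
move: (b * 'C(6 * m, 3 * m)%:R) (b * 'C(10 * m, 3 * m)%:R) => x63 x103.
move: ('C(6 * m, m)%:R : rat) ('C(10 * m, m)%:R : rat) ('C(10 * m, 5 * m)%:R : rat) b s e
  => c6 c10 c105 v t w t1 t2 t3 h4 h5 pt pw pv.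
have {}h4 : taylor p 3 x63 0 (- 2%:R) (- 6%:R - 4%:R * t).
  split; first by split; pint_tac.
  by apply: (eqm_trans h4); apply: eqm_eq; ring.
have {}h5 : taylor p 3 x103 0 (- 2%:R) (- 26%:R * 3%:R^-1 - 6%:R * t).
  split; first by split; pint_tac.
  by apply: (eqm_trans h5); apply: eqm_eq; field.
by eapply taylor_eqm3; [taylor_tac | taylor_tac | field | field | field].
Qed.

Local Notation phi := (phi0 m).

Lemma phi_unit : exists2 v, pint p v & eqm p 1 (v * phi) 1.
Proof.
have np : (n < p)%N by lia.
have mn : (m <= n)%N by lia.
have cb := coprime_bin p_pr np mn.
have b0 := coprime_neq0 p_pr cb; have pb := pintV p_pr cb.
exists (l / b); first by pint_tac.
by apply: eqm_eq; rewrite /phi0 mulrA mulrAC divfK // -expr2 sqrr_sign.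
Qed.

(** [Pc_taylor] replaces [Pc] by a multiple of phi modulo p^2 only, which is enough because the W's
    add up to a multiple of p; the factor 1 - ps/2 is then inverted to first order. *)
Lemma phi_W : eqm p 3 (phi * (8%:R * (Wp p + Wm n.+1))) (p%:R * (16%:R + 8%:R * (p%:R * s))).
Proof.
have [z pz ez] := Pc_W p_pr ep; have [w pw ew] := Pc_taylor p_pr ep.
have pu := pint_uk p_pr ep.
have pW : pint p (Wp p + Wm n.+1).
  by apply: pintD; apply: pint_sum => j _; have := pu j => ?; pint_tac.
have pphi : pint p phi by rewrite /phi0; pint_tac.
have [v pv ev] := Pc_unit p_pr ep; have pP := pint_Pc p_pr ep.
have [r pr er] : eqm p 1 (Wp p + Wm n.+1) 0.
  apply: (eqm_cancel_unit pv ev pW (pint0 p)); rewrite mulr0.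
  by exists (2%:R + p%:R ^+ 2 * z); [pint_tac | rewrite subr0 -[LHS](subrK (2%:R * p%:R)) ez; ring].
move: ez ew pW pphi ps er; move: (Wp p + Wm n.+1) (Pc m) phi s => x P f t ez ew pW pphi pt er.
rewrite subr0 expr1 in er.
exists ((8%:R * z - w * r) * (1 + t * p%:R * 2%:R^-1) + 2%:R * t ^+ 2 * f * r); first by pint_tac.
transitivity ((8%:R * (P * x - 2%:R * p%:R) - (8%:R * P - f * (8%:R - 4%:R * (p%:R * t))) * x) * (1 + t * p%:R * 2%:R^-1)
  + 2%:R * (p%:R * t) ^+ 2 * f * x); first by field.
by rewrite ez ew er; field.
Qed.

Variables x y : int.
Hypothesis exy : p%:Z = x ^+ 2 + y ^+ 2.
Hypothesis x4 : (4 %| x - 1)%Z.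

(** After multiplication by 8 phi, a unit, the left side is the expansion in [trace_taylor];
    [jac_modp3] and [jacobsthal] convert [trace] back to x. *)
Lemma sums_modp3 :
  eqm p 3 (Kp p + Km n.+1 + (Wp p + Wm n.+1)) (4%:R * (l * x%:~R)).
Proof.
have c8 : coprime 8 p by apply: (@coprimeXl 3 2).
have pu := pint_uk p_pr ep.
have pW : pint p (Wp p + Wm n.+1).
  by apply: pintD; apply: pint_sum => j _; have := pu j => ?; pint_tac.
have pK : pint p (Kp p + Km n.+1).
  by apply: pintD; apply: pint_sum => j _; have := pu j => ?; pint_tac.
have pphi : pint p phi by rewrite /phi0; pint_tac.
have [v pv ev] := phi_unit.
apply: (eqm_cancel p_pr c8); apply: (eqm_cancel_unit pv ev).
- by apply: pintM; [exact: pint_nat | exact: pintD].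
- by pint_tac.
apply: (@eqm_trans _ _ (2%:R * (1 - p%:R) * (b * trace))).
  apply: eqm_trans (eqm_sym trace_taylor).
  rewrite [8%:R * _]mulrDr mulrDr; apply: eqmD; last exact: phi_W.
  apply: (@eqm_trans _ _ (phi * (8%:R * (Kp p + Km p)))).
    apply: eqm_mull => //; apply: eqm_mull; first exact: pint_nat.
    by apply: eqmD; [exact: eqm_refl | exact/eqm_sym/(Km_tail p_pr ep)].
  apply: (eqm_trans (eqm_mull pphi (KK_taylor p_pr ep))); apply: eqm_eq.
  by rewrite mulrA -expr2 /phi0 exprMn sqrr_sign mul1r.
have := jac_modp3 p_pr ep; rewrite (jacobsthal p_pr ep exy x4) -/trace.
have -> : p.-1%:R = p%:R - 1 :> rat by rewrite -subn1 natrB ?prime_gt0.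
rewrite !(rmorphN, rmorphM, rmorphXn, rmorph1) /= => j.
have {}j := eqm_mull (pintM (pint_nat p 2) pphi) (eqmN j).
have l2 := sqrr_sign rat m.
move: j; rewrite /phi0; move: l b trace (x%:~R : rat) l2 => l b T X l2 j.
apply: eqm_sym; apply: (eqm_trans _ (eqm_trans j _)); apply: eqm_eq; first by ring.
by transitivity (l ^+ 2 * (2%:R * (1 - p%:R) * (b * T))); [ring | rewrite l2 mul1r].
Qed.
End Main.

Theorem theorem1p2 (p : nat) (x y : int) :
  prime p -> odd p ->
  p%:Z = x ^+ 2 + y ^+ 2 ->
  (4 %| x - 1)%Z -> (2 %| y)%Z ->
  rat_cong p 3
    (\sum_(k < p) ((k.+1)%:R * ('C(k.*2, k))%:R ^+ 2 / (8%:R ^+ k) : rat)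
     + \sum_(k < (p.-1)./2.+1)
         ((k.*2.+1)%:R * ('C(k.*2, k))%:R ^+ 2 / ((- 16%:R) ^+ k) : rat))
    (2%:R * (legendre 2 p)%:~R * x%:~R).
Proof.
move=> p_pr p_odd exy x4 y2.
have [m ep] : exists m, p = (4 * m).+1.
  have [i ei] := dvdzP x4; have [j ej] := dvdzP y2.
  have ex : x = i * 4 + 1 by rewrite -ei subrK.
  have e : p%:Z = 4 * (4 * i ^+ 2 + 2 * i + j ^+ 2) + 1 by rewrite exy ex ej; ring.
  exists (p %/ 4)%N; move: e; move: (4 * i ^+ 2 + _ + _) => t; lia.
apply: eqm_rat_cong => //.
have c2 : coprime 2 p by rewrite coprime2n.
(* Doubling splits the weights: 2(k+1) = 1 + (2k+1) and 2(2k+1) = 1 + (4k+1). *)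
apply: (eqm_cancel p_pr c2).
have -> : (p.-1)./2 = m.*2 by lia.
rewrite (legendre2E p_pr ep exy x4) rmorphXn rmorphN1 /=.
have -> : 2%:R * (2%:R * (-1) ^+ m * x%:~R) = 4%:R * ((-1) ^+ m * x%:~R) :> rat by ring.
apply: eqm_trans (sums_modp3 p_pr ep exy x4); apply: eqm_eq.
have uE k : u k = 'C(k.*2, k)%:R ^+ 2 / 16%:R ^+ k.
  by rewrite /u exprMn exprVn -exprM mulnC exprM; congr (_ / _ ^+ _); ring.
have n2 k : (2%:R : rat) ^+ k != 0 by rewrite expf_neq0.
have n8 k : (8%:R : rat) ^+ k != 0 by rewrite expf_neq0.
have n16 k : (16%:R : rat) ^+ k != 0 by rewrite expf_neq0.
rewrite mulrDr addrACA; congr (_ + _).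
  rewrite /Kp /Wp mulr_sumr -big_split; apply: eq_bigr => k _ /=.
  have e16 : 16%:R ^+ k = 8%:R ^+ k * 2%:R ^+ k :> rat by rewrite -exprMn; congr (_ ^+ _); ring.
  rewrite uE e16 -[k.+1%:R]natr1 -[k.*2.+1%:R]natr1 -mul2n natrM.
  have := n2 k; have := n8 k; move: (2%:R ^+ k : rat) (8%:R ^+ k : rat) => a c a0 c0.
  by field; rewrite a0 c0.
rewrite /Km /Wm mulr_sumr -big_split; apply: eq_bigr => k _ /=.
have e16 : ((- 16%:R) ^+ k)^-1 = (16%:R ^+ k)^-1 * (-1) ^+ k :> rat.
  by rewrite exprNn invfM -signr_odd; case: odd; rewrite ?expr1 ?invrN1 ?invr1 mulrC.
rewrite uE e16 -[k.*2.+1%:R]natr1 -[(4 * k).+1%:R]natr1 -mul2n !natrM.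
by ring.
Qed.
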